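(* Let $\mathcal{D}$ be a strict Picard 2-category with unit $e$ and symmetry $\beta$. Then the bottom stable Postnikov invariant $k_0\colon H\pi_0K(\mathcal{D})\to\Sigma^2H\pi_1K(\mathcal{D})$ is modeled by the stable quadratic map $k_0\colon\pi_0K(\mathcal{D})\to\pi_1K(\mathcal{D})$, $$[x]\mapsto\big[\,e\xrightarrow{\ \simeq\ }x\,x\,x^*\,x^*\xrightarrow{\ \beta_{x,x}\,x^*\,x^*\ }x\,x\,x^*\,x^*\xrightarrow{\ \simeq\ }e\,\big],$$ where $x$ is an object of $\mathcal{D}$ and $x^*$ denotes an inverse of $x$.
   Context: 2-categories and 2-functors are strict. $\otimes$ denotes the (pseudo) Gray tensor product of 2-categories, with structure 2-isomorphisms $\Sigma_{f,g}\colon (f\otimes 1)\circ(1\otimes g)\cong(1\otimes g)\circ(f\otimes 1)$. A Gray-monoid $(\mathcal{D},\oplus,e)$ is a monoid in $(2\text{-categories},\otimes)$. Write $xy$ for $x\oplus y$, $fb$, $ag$ for the images under $\oplus$ of $f\otimes 1_b$, $1_a\otimes g$, and for $f\colon a\to a'$, $g\colon b\to b'$ write $\Sigma_{f,g}\colon (fb')\circ(ag)\cong(a'g)\circ(fb)$ for the image in $\mathcal{D}$. A permutative Gray-monoid is a Gray-monoid $\mathcal{D}$ with a 2-natural isomorphism $\beta\colon\oplus\Rightarrow\oplus\circ\tau$ ($\tau$ the symmetry of $\otimes$), with components $\beta_{x,y}\colon xy\to yx$, such that $\beta_{y,x}\beta_{x,y}=\mathrm{id}$, $\beta_{e,x}=\mathrm{id}_x$,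 $\beta_{x,yz}=(y\beta_{x,z})\circ(\beta_{x,y}z)$. A 1-cell is invertible if it is an internal equivalence; an object $x$ is invertible if there are an object $x^*$ (an inverse) and invertible 1-cells $xx^*\simeq e$, $x^*x\simeq e$. A strict Picard 2-category is a permutative Gray-monoid in which all objects, 1-cells and 2-cells are invertible. $K$-theory. Let $\mathscr{F}$ be the category of finite pointed sets $\underline{n}_+=\{0,1,\dots,n\}$ (basepoint $0$). For a permutative Gray-monoid $\mathcal{D}$ there is a special $\Gamma$-2-category $\mathscr{F}\to 2\text{-categories}$ whose value at $\underline{n}_+$ has: objects $\{x_s,c_{s,t}\}$ with $x_s\in\mathcal{D}$ for $s\subseteq\{1,\dots,n\}$ and 1-cells $c_{s,t}\colon x_{s\cup t}\to x_sx_t$ for disjoint $s,t$, such that $x_\emptyset=e$, $c_{s,\emptyset}=c_{\emptyset,s}=\mathrm{id}$, $c_{t,s}=\beta_{x_s,x_t}c_{s,t}$, and $(c_{s,t}x_u)c_{s\cup t,u}=(x_sc_{t,u})c_{s,t\cup u}$; 1-cells $\{f_s,\gamma_{s,t}\}$ with $f_s\colon x_s\to x'_s$ and invertible 2-cells $\gamma_{s,t}\colon (x'_sf_t)(f_sx_t)c_{s,t}\cong c'_{s,t}f_{s\cup t}$, with $f_\emptyset=\mathrm{id}$, $\gamma_{s,\emptyset},\gamma_{\emptyset,s}$ identities, and $\gamma$ compatible with the symmetry and with triples $s,t,u$ (using the cells $\Sigma$); 2-cells $\{\alpha_s\colon f_s\Rightarrow g_s\}$ compatible with the $\gamma$'s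 and with $\alpha_\emptyset=\mathrm{id}$. A pointed map $\phi$ acts by $(\phi_*x)_u=x_{\phi^{-1}(u)}$, and similarly on other data. $K(\mathcal{D})$ is the connective spectrum associated by Segal's construction to the $\Gamma$-simplicial set (or $\Gamma$-space) obtained by applying the nerve/classifying space of 2-categories levelwise. For a strict Picard 2-category, $\pi_0K(\mathcal{D})$ is identified with equivalence classes of objects and $\pi_1K(\mathcal{D})$ with isomorphism classes of 1-cells $e\to e$. In the formula, for a chosen equivalence $u\colon e\simeq xx^*$ with inverse $u^*$, the first arrow is $(x\,u\,x^* )\circ u$ and the last is the reverse composite formed from $u^*$; the class does not depend on the choices. A stable quadratic map $A\to B$ of abelian groups is a homomorphism from $A$ to the 2-torsion of $B$. The group $[HA,\Sigma^2HB]$ of stable homotopy classes is naturally isomorphic to the group of stable quadratic maps $A\to B$; ''modeled by'' means corresponding under this isomorphism. Under it, the bottom stable Postnikov invariant $k_0$ of a connective spectrum $X$ corresponds to the map $\pi_0X\to\pi_1X$ given by precomposition with the Hopf map $\eta\colon\Sigma\mathbb{S}\to\mathbb{S}$. *)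

(* Defs.v *)
From HB Require Import structures.
From Stdlib Require Import Relation_Operators Relation_Definitions.
From mathcomp Require Import all_boot all_order all_algebra generic_quotient.
From mathcomp Require Import all_classical all_reals all_analysis.
Import Order.TTheory GRing.Theory Num.Theory.
Import numFieldNormedType.Exports.

Set Implicit Arguments.
Unset Strict Implicit.
Unset Printing Implicit Defensive.

Local Open Scope quotient_scope.
Local Open Scope ring_scope.

(* Compositions are total functions whose values matter only on composable
   arguments, so that strict equations between 1-cells and between 2-cells
   with propositionally equal boundaries can be written without transport.
   Composition is in the applicative order: [comp g f] is "g after f". *)
Record twocat := TwoCat {
  ob : Type;
  mor : Type;
  cell : Type;
  src : mor -> ob;
  tgt : mor -> ob;
  dom : cell -> mor;
  cod : cell -> mor;
  id1 : ob -> mor;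
  comp : mor -> mor -> mor;
  id2 : mor -> cell;
  vcomp : cell -> cell -> cell;
  hcomp : cell -> cell -> cell;
  src_cod : forall a, src (cod a) = src (dom a);
  tgt_cod : forall a, tgt (cod a) = tgt (dom a);
  src_id1 : forall x, src (id1 x) = x;
  tgt_id1 : forall x, tgt (id1 x) = x;
  src_comp : forall g f, tgt f = src g -> src (comp g f) = src f;
  tgt_comp : forall g f, tgt f = src g -> tgt (comp g f) = tgt g;
  comp1f : forall f, comp (id1 (tgt f)) f = f;
  compf1 : forall f, comp f (id1 (src f)) = f;
  compA : forall h g f, tgt f = src g -> tgt g = src h ->
    comp h (comp g f) = comp (comp h g) f;
  dom_id2 : forall f, dom (id2 f) = f;
  cod_id2 : forall f, cod (id2 f) = f;
  dom_vcomp : forall b a, cod a = dom b -> dom (vcomp b a) = dom a;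
  cod_vcomp : forall b a, cod a = dom b -> cod (vcomp b a) = cod b;
  vcomp1a : forall a, vcomp (id2 (cod a)) a = a;
  vcompa1 : forall a, vcomp a (id2 (dom a)) = a;
  vcompA : forall c b a, cod a = dom b -> cod b = dom c ->
    vcomp c (vcomp b a) = vcomp (vcomp c b) a;
  dom_hcomp : forall b a, tgt (dom a) = src (dom b) ->
    dom (hcomp b a) = comp (dom b) (dom a);
  cod_hcomp : forall b a, tgt (dom a) = src (dom b) ->
    cod (hcomp b a) = comp (cod b) (cod a);
  hcomp1a : forall a, hcomp (id2 (id1 (tgt (dom a)))) a = a;
  hcompa1 : forall a, hcomp a (id2 (id1 (src (dom a)))) = a;
  hcompA : forall c b a, tgt (dom a) = src (dom b) -> tgt (dom b) = src (dom c) ->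
    hcomp c (hcomp b a) = hcomp (hcomp c b) a;
  hcomp_id2 : forall g f, tgt f = src g ->
    hcomp (id2 g) (id2 f) = id2 (comp g f);
  interchange : forall b' b a' a,
    cod a = dom a' -> cod b = dom b' -> tgt (dom a) = src (dom b) ->
    hcomp (vcomp b' b) (vcomp a' a) = vcomp (hcomp b' a') (hcomp b a)
}.

Declare Scope twocat_scope.
Delimit Scope twocat_scope with C2.
Local Open Scope twocat_scope.

Notation "g \c f" := (comp g f) (at level 40, left associativity) : twocat_scope.
Notation "b \v a" := (vcomp b a) (at level 45, right associativity) : twocat_scope.
Notation "b \h a" := (hcomp b a) (at level 40, left associativity) : twocat_scope.
Notation "g \wl a" := (hcomp (id2 g) a) (at level 36, right associativity) : twocat_scope.
Notation "a \wr f" := (hcomp a (id2 f)) (at level 35, right associativity) : twocat_scope.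

Definition is_mor (C : twocat) (f : mor C) (x y : ob C) : Prop :=
  src f = x /\ tgt f = y.

Definition is_cell (C : twocat) (a : cell C) (f g : mor C) : Prop :=
  dom a = f /\ cod a = g.

Definition inverse2 (C : twocat) (a b : cell C) : Prop :=
  [/\ is_cell b (cod a) (dom a), b \v a = id2 (dom a) & a \v b = id2 (cod a)].

Definition invertible2 (C : twocat) (a : cell C) : Prop := exists b, inverse2 a b.

Definition iso1 (C : twocat) (f g : mor C) : Prop :=
  exists2 a, is_cell a f g & invertible2 a.

Definition equivalence_pair (C : twocat) (u v : mor C) : Prop :=
  [/\ is_mor v (tgt u) (src u),
      iso1 (v \c u) (id1 (src u)) & iso1 (u \c v) (id1 (tgt u))].

Definition invertible1 (C : twocat) (f : mor C) : Prop :=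
  exists g, equivalence_pair f g.

Definition equiv_ob (C : twocat) (x y : ob C) : Prop :=
  exists2 f, is_mor f x y & invertible1 f.

Record is_2functor (C D : twocat) (F0 : ob C -> ob D) (F1 : mor C -> mor D)
    (F2 : cell C -> cell D) : Prop := Is2Functor {
  f2_src : forall f, src (F1 f) = F0 (src f);
  f2_tgt : forall f, tgt (F1 f) = F0 (tgt f);
  f2_dom : forall a, dom (F2 a) = F1 (dom a);
  f2_cod : forall a, cod (F2 a) = F1 (cod a);
  f2_id1 : forall x, F1 (id1 x) = id1 (F0 x);
  f2_comp : forall g f, tgt f = src g -> F1 (g \c f) = F1 g \c F1 f;
  f2_id2 : forall f, F2 (id2 f) = id2 (F1 f);
  f2_vcomp : forall b a, cod a = dom b -> F2 (b \v a) = F2 b \v F2 a;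
  f2_hcomp : forall b a, tgt (dom a) = src (dom b) -> F2 (b \h a) = F2 b \h F2 a
}.

(* A monoid for the pseudo Gray tensor product, with the 2-functor
   D (x) D -> D unfolded along the generators and relations of D (x) D:
   [tens x y] is xy, [lten a g] is ag, [rten f b] is fb (and [lten2], [rten2]
   on 2-cells), and [Sigma f g] is the image of the structure 2-isomorphism,
   with inverse [Sigmai f g]. *)
Record gray_monoid := GrayMonoid {
  gm_cat :> twocat;
  tens : ob gm_cat -> ob gm_cat -> ob gm_cat;
  lten : ob gm_cat -> mor gm_cat -> mor gm_cat;
  rten : mor gm_cat -> ob gm_cat -> mor gm_cat;
  lten2 : ob gm_cat -> cell gm_cat -> cell gm_cat;
  rten2 : cell gm_cat -> ob gm_cat -> cell gm_cat;
  Sigma : mor gm_cat -> mor gm_cat -> cell gm_cat;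
  Sigmai : mor gm_cat -> mor gm_cat -> cell gm_cat;
  gunit : ob gm_cat;
  lten_functor : forall a, is_2functor (tens a) (lten a) (lten2 a);
  rten_functor : forall b,
    is_2functor (fun a => tens a b) (fun f => rten f b) (fun a => rten2 a b);
  Sigma_cell : forall f g, is_cell (Sigma f g)
    (rten f (tgt g) \c lten (src f) g) (lten (tgt f) g \c rten f (src g));
  SigmaK : forall f g, inverse2 (Sigma f g) (Sigmai f g);
  Sigma_natl : forall a g,
    Sigma (cod a) g \v (rten2 a (tgt g) \wr lten (src (dom a)) g)
    = (lten (tgt (dom a)) g \wl rten2 a (src g)) \v Sigma (dom a) g;
  Sigma_natr : forall f b,
    Sigma f (cod b) \v (rten f (tgt (dom b)) \wl lten2 (src f) b)
    = (lten2 (tgt f) b \wr rten f (src (dom b))) \v Sigma f (dom b);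
  Sigma_id1l : forall x g, Sigma (id1 x) g = id2 (lten x g);
  Sigma_id1r : forall f y, Sigma f (id1 y) = id2 (rten f y);
  Sigma_compl : forall f' f g, tgt f = src f' ->
    Sigma (f' \c f) g
    = (Sigma f' g \wr rten f (src g)) \v (rten f' (tgt g) \wl Sigma f g);
  Sigma_compr : forall f g' g, tgt g = src g' ->
    Sigma f (g' \c g)
    = (lten (tgt f) g' \wl Sigma f g) \v (Sigma f g' \wr lten (src f) g);
  tensA : forall x y z, tens (tens x y) z = tens x (tens y z);
  rtenA : forall f y z, rten (rten f y) z = rten f (tens y z);
  lrtenA : forall x g z, rten (lten x g) z = lten x (rten g z);
  ltenA : forall x y h, lten (tens x y) h = lten x (lten y h);
  rten2A : forall a y z, rten2 (rten2 a y) z = rten2 a (tens y z);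
  lrten2A : forall x a z, rten2 (lten2 x a) z = lten2 x (rten2 a z);
  lten2A : forall x y a, lten2 (tens x y) a = lten2 x (lten2 y a);
  rten2_Sigma : forall f g z, rten2 (Sigma f g) z = Sigma f (rten g z);
  Sigma_mid : forall f y h, Sigma (rten f y) h = Sigma f (lten y h);
  lten2_Sigma : forall x g h, lten2 x (Sigma g h) = Sigma (lten x g) h;
  tens1x : forall x, tens gunit x = x;
  tensx1 : forall x, tens x gunit = x;
  lten1 : forall f, lten gunit f = f;
  rten1 : forall f, rten f gunit = f;
  lten21 : forall a, lten2 gunit a = a;
  rten21 : forall a, rten2 a gunit = a
}.

(* The symmetry of the Gray tensor product sends Sigma_{f,g} to the inverse of
   Sigma_{g,f}, whence the form of [beta_Sigma]. *)
Record permutative := Permutative {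
  pm_gray :> gray_monoid;
  beta : ob pm_gray -> ob pm_gray -> mor pm_gray;
  beta_mor : forall x y, is_mor (beta x y) (tens x y) (tens y x);
  beta_natl : forall f y,
    beta (tgt f) y \c rten f y = lten y f \c beta (src f) y;
  beta_natr : forall x g,
    beta x (tgt g) \c lten x g = rten g x \c beta x (src g);
  beta_nat2l : forall a y,
    beta (tgt (dom a)) y \wl rten2 a y = lten2 y a \wr beta (src (dom a)) y;
  beta_nat2r : forall x b,
    beta x (tgt (dom b)) \wl lten2 x b = rten2 b x \wr beta x (src (dom b));
  beta_Sigma : forall f g,
    beta (tgt f) (tgt g) \wl Sigma f g = Sigmai g f \wr beta (src f) (src g);
  betaK : forall x y, beta y x \c beta x y = id1 (tens x y);
  beta1x : forall x, beta (gunit pm_gray) x = id1 x;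
  betaM : forall x y z,
    beta x (tens y z) = lten y (beta x z) \c rten (beta x y) z
}.

Definition inverse_ob (D : gray_monoid) (x xs : ob D) : Prop :=
  equiv_ob (tens x xs) (gunit D) /\ equiv_ob (tens xs x) (gunit D).

Record picard := Picard {
  pc_perm :> permutative;
  ob_inv : forall x : ob pc_perm, exists xs, inverse_ob x xs;
  mor_inv : forall f : mor pc_perm, invertible1 f;
  cell_inv : forall a : cell pc_perm, invertible2 a
}.

Section PicardGroups.
Variable D : picard.
Local Notation e := (gunit D).

Lemma cell_iso1 (a : cell D) : iso1 (dom a) (cod a).
Proof. by exists a; [| exact: cell_inv]. Qed.

Lemma iso1_refl (f : mor D) : iso1 f f.
Proof. by have := cell_iso1 (id2 f); rewrite dom_id2 cod_id2. Qed.

Lemma iso1_sym (f g : mor D) : iso1 f g -> iso1 g f.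
Proof.
by case=> a [<- <-] [b [[db cb] _ _]]; rewrite -db -cb; exact: cell_iso1.
Qed.

Lemma iso1_trans (f g h : mor D) : iso1 f g -> iso1 g h -> iso1 f h.
Proof.
case=> a [<- ca] _ [b [db <-] _].
have ab : cod a = dom b by rewrite ca db.
by have := cell_iso1 (b \v a); rewrite dom_vcomp // cod_vcomp.
Qed.

Lemma iso1_comp (f f' g g' : mor D) : tgt f = src g ->
  iso1 f f' -> iso1 g g' -> iso1 (g \c f) (g' \c f').
Proof.
move=> fg [a [da <-] _] [b [db <-] _].
have ab : tgt (dom a) = src (dom b) by rewrite da db.
by have := cell_iso1 (b \h a); rewrite dom_hcomp // cod_hcomp // da db.
Qed.

Lemma mor_equiv_ob (f : mor D) (x y : ob D) : is_mor f x y -> equiv_ob x y.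
Proof. by exists f; last exact: mor_inv. Qed.

Lemma equiv_ob_refl (x : ob D) : equiv_ob x x.
Proof.
by apply: (@mor_equiv_ob (id1 x)); split; rewrite ?src_id1 ?tgt_id1.
Qed.

Lemma equiv_ob_sym (x y : ob D) : equiv_ob x y -> equiv_ob y x.
Proof. by case=> f [<- <-] [g [hg _ _]]; exact: mor_equiv_ob hg. Qed.

Lemma equiv_ob_trans (x y z : ob D) :
  equiv_ob x y -> equiv_ob y z -> equiv_ob x z.
Proof.
case=> f [sf tf] _ [g [sg tg] _]; apply: (@mor_equiv_ob (g \c f)).
by split; rewrite ?src_comp ?tgt_comp // tf sg.
Qed.

Lemma equiv_ob_tens (x x' y y' : ob D) :
  equiv_ob x x' -> equiv_ob y y' -> equiv_ob (tens x y) (tens x' y').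
Proof.
case=> f [<- <-] _ [g [<- <-] _].
apply: (@equiv_ob_trans _ (tens (tgt f) (src g))).
  apply: (@mor_equiv_ob (rten f (src g))).
  by split; rewrite ?(f2_src (rten_functor _)) ?(f2_tgt (rten_functor _)).
apply: (@mor_equiv_ob (lten (tgt f) g)).
by split; rewrite ?(f2_src (lten_functor _)) ?(f2_tgt (lten_functor _)).
Qed.

Definition ob_rel (x y : {classic ob D}) : bool := `[< equiv_ob x y >].

Lemma ob_rel_refl : reflexive ob_rel.
Proof. by move=> x; apply/asboolP; exact: equiv_ob_refl. Qed.

Lemma ob_rel_sym : ssrbool.symmetric ob_rel.
Proof. by move=> x y; apply/asboolP/asboolP; exact: equiv_ob_sym. Qed.

Lemma ob_rel_trans : ssrbool.transitive ob_rel.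
Proof.
by move=> y x z /asboolP xy /asboolP yz; apply/asboolP; exact: equiv_ob_trans yz.
Qed.

Canonical ob_equiv := EquivRel ob_rel ob_rel_refl ob_rel_sym ob_rel_trans.

Definition pi0 : Type := {eq_quot ob_equiv}.
HB.instance Definition _ := Choice.on pi0.

Definition ob_class (x : ob D) : pi0 := \pi_({eq_quot ob_equiv}) x.

Lemma ob_classP (x y : ob D) : equiv_ob x y <-> ob_class x = ob_class y.
Proof.
split=> [xy|/eqmodP/asboolP//].
by apply/eqmodP/asboolP.
Qed.

Definition ob_repr (a : pi0) : ob D := repr (a : {eq_quot ob_equiv}).

Lemma ob_reprK (a : pi0) : ob_class (ob_repr a) = a.
Proof. exact: (@reprK _ {eq_quot ob_equiv}). Qed.

Definition pi0_add (a b : pi0) : pi0 := ob_class (tens (ob_repr a) (ob_repr b)).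

Lemma pi0_addE (x y : ob D) :
  pi0_add (ob_class x) (ob_class y) = ob_class (tens x y).
Proof. by apply/ob_classP/equiv_ob_tens; apply/ob_classP; rewrite ob_reprK. Qed.

Definition pi0_opp (a : pi0) : pi0 :=
  ob_class (projT1 (cid (ob_inv (ob_repr a)))).

Fact pi0_addA : ssrfun.associative pi0_add.
Proof.
move=> a b c; rewrite -(ob_reprK a) -(ob_reprK b) -(ob_reprK c).
by rewrite !pi0_addE tensA.
Qed.

Fact pi0_addC : ssrfun.commutative pi0_add.
Proof.
move=> a b; rewrite -(ob_reprK a) -(ob_reprK b) !pi0_addE.
by apply/ob_classP/mor_equiv_ob/beta_mor.
Qed.

Fact pi0_add0 : ssrfun.left_id (ob_class e) pi0_add.
Proof. by move=> a; rewrite -(ob_reprK a) pi0_addE tens1x. Qed.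

Fact pi0_addN : ssrfun.left_inverse (ob_class e) pi0_opp pi0_add.
Proof.
move=> a; rewrite -{2}(ob_reprK a) pi0_addE.
by apply/ob_classP; case: (projT2 (cid (ob_inv (ob_repr a)))).
Qed.

HB.instance Definition _ :=
  GRing.isZmodule.Build pi0 pi0_addA pi0_addC pi0_add0 pi0_addN.

Definition loop := {f : mor D | is_mor f e e}.

Definition Loop (f : mor D) (hf : is_mor f e e) : loop := exist _ f hf.

Definition loop_rel (f g : {classic loop}) : bool := `[< iso1 (sval f) (sval g) >].

Lemma loop_rel_refl : reflexive loop_rel.
Proof. by move=> f; apply/asboolP; exact: iso1_refl. Qed.

Lemma loop_rel_sym : ssrbool.symmetric loop_rel.
Proof. by move=> f g; apply/asboolP/asboolP; exact: iso1_sym. Qed.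

Lemma loop_rel_trans : ssrbool.transitive loop_rel.
Proof.
by move=> g f h /asboolP fg /asboolP gh; apply/asboolP; exact: iso1_trans gh.
Qed.

Canonical loop_equiv := EquivRel loop_rel loop_rel_refl loop_rel_sym loop_rel_trans.

Definition pi1 : Type := {eq_quot loop_equiv}.
HB.instance Definition _ := Choice.on pi1.

Definition loop_class (f : loop) : pi1 := \pi_({eq_quot loop_equiv}) f.

Lemma loop_classP (f g : loop) :
  iso1 (sval f) (sval g) <-> loop_class f = loop_class g.
Proof.
split=> [xy|/eqmodP/asboolP//].
by apply/eqmodP/asboolP.
Qed.

Definition loop_repr (a : pi1) : loop := repr (a : {eq_quot loop_equiv}).

Lemma loop_reprK (a : pi1) : loop_class (loop_repr a) = a.
Proof. exact: (@reprK _ {eq_quot loop_equiv}). Qed.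

Lemma loop_comp_subproof (g f : loop) : is_mor (sval g \c sval f) e e.
Proof.
case: g f => [g [sg tg]] [f [sf tf]] /=.
by split; rewrite ?src_comp ?tgt_comp // tf sg.
Qed.

Definition loop_comp (g f : loop) : loop := Loop (loop_comp_subproof g f).

Lemma loop_id_subproof : is_mor (id1 e) e e.
Proof. by split; rewrite ?src_id1 ?tgt_id1. Qed.

Definition loop_id : loop := Loop loop_id_subproof.

Lemma loop_inv_subproof (f : loop) :
  exists g : loop, iso1 (sval g \c sval f) (id1 e).
Proof.
case: f => [f [sf tf]]; have [g [hg gf _]] := mor_inv f.
rewrite sf in gf hg; rewrite tf in hg.
by exists (Loop hg).
Qed.

Definition pi1_add (a b : pi1) : pi1 :=
  loop_class (loop_comp (loop_repr a) (loop_repr b)).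

Definition pi1_opp (a : pi1) : pi1 :=
  loop_class (projT1 (cid (loop_inv_subproof (loop_repr a)))).

Lemma pi1_addE (f g : loop) :
  pi1_add (loop_class f) (loop_class g) = loop_class (loop_comp f g).
Proof.
apply/loop_classP/iso1_comp; try by apply/loop_classP; rewrite loop_reprK.
case: (loop_repr _) => [? [_ ->]].
by case: (loop_repr _) => [? [-> _]].
Qed.

Fact pi1_addA : ssrfun.associative pi1_add.
Proof.
move=> a b c; rewrite -(loop_reprK a) -(loop_reprK b) -(loop_reprK c).
rewrite !pi1_addE; apply/loop_classP => /=.
case: (loop_repr a) (loop_repr b) (loop_repr c) => [f [sf tf]] [g [sg tg]] [h [sh th]] /=.
by rewrite compA ?th ?tg //; exact: iso1_refl.
Qed.

Fact pi1_addC : ssrfun.commutative pi1_add.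
Proof.
move=> a b; rewrite -(loop_reprK a) -(loop_reprK b) !pi1_addE.
apply/loop_classP => /=.
case: (loop_repr a) (loop_repr b) => [f [sf tf]] [g [sg tg]] /=.
have [dS cS] := Sigma_cell f g; have := cell_iso1 (Sigma f g).
by rewrite dS cS sf tf sg tg !lten1 !rten1.
Qed.

Fact pi1_add0 : ssrfun.left_id (loop_class loop_id) pi1_add.
Proof.
move=> a; rewrite -(loop_reprK a) pi1_addE; apply/loop_classP => /=.
case: (loop_repr a) => [f [sf tf]] /=.
by rewrite -[X in id1 X \c f]tf comp1f; exact: iso1_refl.
Qed.

Fact pi1_addN : ssrfun.left_inverse (loop_class loop_id) pi1_opp pi1_add.
Proof.
move=> a; rewrite -{2}(loop_reprK a) pi1_addE.
by apply/loop_classP; case: (cid _).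
Qed.

HB.instance Definition _ :=
  GRing.isZmodule.Build pi1 pi1_addA pi1_addC pi1_add0 pi1_addN.

End PicardGroups.

Arguments ob_class {D} x.
Arguments loop_class {D} f.

Definition stable_quadratic (A B : zmodType) (q : {additive A -> B}) : Prop :=
  forall a, q a *+ 2 = 0.

Section QuadraticMap.
Variable D : picard.
Local Notation e := (gunit D).

Definition k0_mor (x xs : ob D) (u us : mor D) : mor D :=
  us \c (rten (lten x us) xs \c
    (rten (beta x x) (tens xs xs) \c (rten (lten x u) xs \c u))).

Lemma is_mor_comp (C : twocat) (g f : mor C) (x y z : ob C) :
  is_mor f x y -> is_mor g y z -> is_mor (g \c f) x z.
Proof.
by move=> [sf tf] [sg tg]; split; rewrite ?src_comp ?tgt_comp // tf sg.
Qed.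

Lemma lten_mor (G : gray_monoid) (a x y : ob G) (f : mor G) :
  is_mor f x y -> is_mor (lten a f) (tens a x) (tens a y).
Proof.
by case=> <- <-; split; rewrite ?(f2_src (lten_functor a)) ?(f2_tgt (lten_functor a)).
Qed.

Lemma rten_mor (G : gray_monoid) (a x y : ob G) (f : mor G) :
  is_mor f x y -> is_mor (rten f a) (tens x a) (tens y a).
Proof.
by case=> <- <-; split; rewrite ?(f2_src (rten_functor a)) ?(f2_tgt (rten_functor a)).
Qed.

Lemma k0_mor_subproof (x xs : ob D) (u us : mor D) :
  is_mor u e (tens x xs) -> equivalence_pair u us ->
  is_mor (k0_mor x xs u us) e e.
Proof.
move=> hu [hus _ _]; have [su tu] := hu; rewrite su tu in hus.
have E : tens (tens x (tens x xs)) xs = tens (tens x x) (tens xs xs).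
  by rewrite !tensA.
have E1 : tens (tens x e) xs = tens x xs by rewrite tensx1.
apply: (is_mor_comp _ hus); rewrite -[X in is_mor _ _ X]E1.
apply: is_mor_comp (rten_mor xs (lten_mor x hus)).
have h1 := rten_mor xs (lten_mor x hu); rewrite E1 E in h1.
rewrite E; apply: is_mor_comp (rten_mor _ (beta_mor x x)).
exact: is_mor_comp hu h1.
Qed.

Definition k0_loop (x xs : ob D) (u us : mor D)
    (hu : is_mor u e (tens x xs)) (hus : equivalence_pair u us) : loop D :=
  Loop (k0_mor_subproof hu hus).

End QuadraticMap.

Section GammaObject.
Variable D : permutative.
Local Notation e := (gunit D).

(* The non-basepoint elements of n_+ are indexed by 'I_n. *)
Record kob (n : nat) := KOb {
  kx : {set 'I_n} -> ob D;
  kc : forall s t : {set 'I_n}, [disjoint s & t] -> mor D;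
  kc_mor : forall (s t : {set 'I_n}) (st : [disjoint s & t]),
    is_mor (kc st) (kx (s :|: t)) (tens (kx s) (kx t));
  kx0 : kx finset.set0 = e;
  kc0s : forall (s : {set 'I_n}) (d : [disjoint finset.set0 & s]), kc d = id1 (kx s);
  kcs0 : forall (s : {set 'I_n}) (d : [disjoint s & finset.set0]), kc d = id1 (kx s);
  kcC : forall (s t : {set 'I_n}) (st : [disjoint s & t]) (ts : [disjoint t & s]),
    kc ts = beta (kx s) (kx t) \c kc st;
  kcA : forall (s t u : {set 'I_n}) (st : [disjoint s & t]) (st_u : [disjoint s :|: t & u])
      (tu : [disjoint t & u]) (s_tu : [disjoint s & t :|: u]),
    rten (kc st) (kx u) \c kc st_u = lten (kx s) (kc tu) \c kc s_tu
}.

(* The data of a 1-cell without its axioms: enough to form composites and to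
   say what a 2-cell between them is. *)
Record kdata (n : nat) := KData {
  kf : {set 'I_n} -> mor D;
  kg : forall s t : {set 'I_n}, [disjoint s & t] -> cell D
}.

Record is_kmor (n : nat) (x x' : kob n) (f : kdata n) : Prop := IsKMor {
  kf_mor : forall s, is_mor (kf f s) (kx x s) (kx x' s);
  kg_cell : forall (s t : {set 'I_n}) (st : [disjoint s & t]), is_cell (kg f st)
    (lten (kx x' s) (kf f t) \c rten (kf f s) (kx x t) \c kc x st)
    (kc x' st \c kf f (s :|: t));
  kg_inv : forall (s t : {set 'I_n}) (st : [disjoint s & t]), invertible2 (kg f st);
  kf0 : kf f finset.set0 = id1 e;
  kg0s : forall (s : {set 'I_n}) (d : [disjoint finset.set0 & s]), kg f d = id2 (kf f s);
  kgs0 : forall (s : {set 'I_n}) (d : [disjoint s & finset.set0]), kg f d = id2 (kf f s);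
  kgC : forall (s t : {set 'I_n}) (st : [disjoint s & t]) (ts : [disjoint t & s]),
    kg f ts
    = (beta (kx x' s) (kx x' t) \wl kg f st)
      \v ((beta (kx x' s) (kx x' t) \wl Sigma (kf f s) (kf f t)) \wr kc x st);
  kgA : forall (s t u : {set 'I_n}) (st : [disjoint s & t]) (st_u : [disjoint s :|: t & u])
      (tu : [disjoint t & u]) (s_tu : [disjoint s & t :|: u]),
    (rten (kc x' st) (kx x' u) \wl kg f st_u)
    \v (Sigmai (kc x' st) (kf f u)
          \wr (rten (kf f (s :|: t)) (kx x u) \c kc x st_u))
    \v ((lten (tens (kx x' s) (kx x' t)) (kf f u) \wl rten2 (kg f st) (kx x u))
          \wr kc x st_u)
    = (lten (kx x' s) (kc x' tu) \wl kg f s_tu)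
      \v (lten2 (kx x' s) (kg f tu)
            \wr (rten (kf f s) (kx x (t :|: u)) \c kc x s_tu))
      \v (((lten (tens (kx x' s) (kx x' t)) (kf f u)
              \c lten (kx x' s) (rten (kf f t) (kx x u)))
            \wl Sigma (kf f s) (kc x tu)) \wr kc x s_tu)
}.

Record kmor (n : nat) (x x' : kob n) := KMor {
  kmor_data :> kdata n;
  kmorP : is_kmor x x' kmor_data
}.

Definition is_kcell (n : nat) (x x' : kob n) (f g : kdata n)
    (a : {set 'I_n} -> cell D) : Prop :=
  [/\ forall s, is_cell (a s) (kf f s) (kf g s),
      a finset.set0 = id2 (id1 e)
    & forall (s t : {set 'I_n}) (st : [disjoint s & t]),
        kg g st \v ((lten2 (kx x' s) (a t) \h rten2 (a s) (kx x t)) \wr kc x st)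
        = (kc x' st \wl a (s :|: t)) \v kg f st].

(* The composite of f : x -> x' and f' : x' -> x''; the objects enter only
   through x, x' and x''. *)
Definition kcomp (n : nat) (x x' x'' : kob n) (f' : kmor x' x'') (f : kmor x x') :
    kdata n :=
  KData (fun s => kf f' s \c kf f s)
    (fun s t st =>
       (kg f' st \wr kf f (s :|: t))
       \v ((lten (kx x'' s) (kf f' t) \c rten (kf f' s) (kx x' t)) \wl kg f st)
       \v ((lten (kx x'' s) (kf f' t) \wl Sigmai (kf f' s) (kf f t))
             \wr (rten (kf f s) (kx x t) \c kc x st))).

(* A pointed map phi : m_+ -> n_+ is given on non-basepoint elements;
   [phi i = None] means that i is sent to the basepoint. *)
Section PointedMap.
Variables (m n : nat) (phi : 'I_m -> option 'I_n).

Definition preim (u : {set 'I_n}) : {set 'I_m} :=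
  [set i | if phi i is Some j then j \in u else false].

Lemma preim0 : preim finset.set0 = finset.set0.
Proof. by apply/setP=> i; rewrite !inE; case: (phi i) => // j; rewrite inE. Qed.

Lemma preimU (s t : {set 'I_n}) : preim (s :|: t) = preim s :|: preim t.
Proof. by apply/setP=> i; rewrite !inE; case: (phi i) => // j; rewrite inE. Qed.

Lemma preim_disjoint (s t : {set 'I_n}) :
  [disjoint s & t] -> [disjoint preim s & preim t].
Proof.
rewrite -!setI_eq0 => /eqP st; apply/eqP/setP => i; rewrite !inE.
by case: (phi i) => // j; have /setP/(_ j) := st; rewrite !inE.
Qed.

Lemma kc_eq (x : kob m) (s s' t t' : {set 'I_m}) (st : [disjoint s & t])
  (st' : [disjoint s' & t']) : s = s' -> t = t' -> kc x st = kc x st'.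
Proof. by move=> ss tt; subst s' t'; rewrite (bool_irrelevance st st'). Qed.

Lemma kg_eq (f : kdata m) (s s' t t' : {set 'I_m}) (st : [disjoint s & t])
  (st' : [disjoint s' & t']) : s = s' -> t = t' -> kg f st = kg f st'.
Proof. by move=> ss tt; subst s' t'; rewrite (bool_irrelevance st st'). Qed.

Program Definition push_kob (x : kob m) : kob n :=
  @KOb n (fun u => kx x (preim u))
    (fun s t st => kc x (preim_disjoint st)) _ _ _ _ _ _.
Next Obligation. by move=> x s t st /=; rewrite preimU; exact: kc_mor. Qed.
Next Obligation. by move=> x /=; rewrite preim0; exact: kx0. Qed.
Next Obligation.
move=> x s d /=.
have d0 : [disjoint finset.set0 & preim s] by rewrite -preim0 preim_disjoint.
by rewrite -(kc0s x d0); apply: kc_eq; rewrite ?preim0.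
Qed.
Next Obligation.
move=> x s d /=.
have d0 : [disjoint preim s & finset.set0] by rewrite -preim0 preim_disjoint.
by rewrite -(kcs0 x d0); apply: kc_eq; rewrite ?preim0.
Qed.
Next Obligation. by move=> x s t st ts /=; exact: kcC. Qed.
Next Obligation.
move=> x s t u st st_u tu s_tu /=.
have d1 : [disjoint preim s :|: preim t & preim u] by rewrite -preimU preim_disjoint.
have d2 : [disjoint preim s & preim t :|: preim u] by rewrite -preimU preim_disjoint.
rewrite (kc_eq x (preim_disjoint st_u) d1) ?preimU //.
by rewrite (kc_eq x (preim_disjoint s_tu) d2) ?preimU //; exact: kcA.
Qed.

Definition push_kdata (f : kdata m) : kdata n :=
  KData (fun u => kf f (preim u)) (fun s t st => kg f (preim_disjoint st)).

Lemma push_kmor_subproof (x x' : kob m) (f : kmor x x') :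
  is_kmor (push_kob x) (push_kob x') (push_kdata f).
Proof.
have F := kmorP f; split => /=.
- by move=> s; exact: kf_mor F _.
- by move=> s t st; have := kg_cell F (preim_disjoint st); rewrite preimU.
- by move=> s t st; exact: kg_inv F _ _ _.
- by rewrite preim0; exact: kf0 F.
- move=> s d; have d0 : [disjoint finset.set0 & preim s].
    by rewrite -preim0 preim_disjoint.
  by rewrite -(kg0s F d0); apply: kg_eq; rewrite ?preim0.
- move=> s d; have d0 : [disjoint preim s & finset.set0].
    by rewrite -preim0 preim_disjoint.
  by rewrite -(kgs0 F d0); apply: kg_eq; rewrite ?preim0.
- by move=> s t st ts; exact: kgC F _ _ _ _.
- move=> s t u st st_u tu s_tu.
  have d1 : [disjoint preim s :|: preim t & preim u].
    by rewrite -preimU preim_disjoint.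
  have d2 : [disjoint preim s & preim t :|: preim u].
    by rewrite -preimU preim_disjoint.
  have := kgA F (preim_disjoint st) d1 (preim_disjoint tu) d2.
  rewrite (kc_eq x (preim_disjoint st_u) d1) ?preimU //.
  rewrite (kc_eq x (preim_disjoint s_tu) d2) ?preimU //.
  rewrite (kg_eq f (preim_disjoint st_u) d1) ?preimU //.
  by rewrite (kg_eq f (preim_disjoint s_tu) d2) ?preimU.
Qed.

Definition push_kmor (x x' : kob m) (f : kmor x x') :
  kmor (push_kob x) (push_kob x') := KMor (push_kmor_subproof f).

Lemma push_kcell (x x' x'' : kob m) (f' : kmor x' x'') (f : kmor x x')
    (g : kdata m) (a : {set 'I_m} -> cell D) :
  is_kcell x x'' (kcomp f' f) g a ->
  is_kcell (push_kob x) (push_kob x'') (kcomp (push_kmor f') (push_kmor f))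
    (push_kdata g) (fun u => a (preim u)).
Proof.
case=> a1 a0 ac; split => /= [s||s t st]; rewrite ?preim0 //.
by have := ac _ _ (preim_disjoint st); rewrite preimU.
Qed.

End PointedMap.

(* The Duskin nerve of the value at n_+: a q-simplex is a normal lax functor out of
    the poset {0 < ... < q}. The 2-cell [sT ij jk] goes from the composite of
    [sF ij] and [sF jk] to [sF ik]. *)
Record knerve (n q : nat) := KNerve {
  sX : 'I_q.+1 -> kob n;
  sF : forall i j : 'I_q.+1, (i <= j)%N -> kmor (sX i) (sX j);
  sT : forall i j k : 'I_q.+1, (i <= j)%N -> (j <= k)%N -> {set 'I_n} -> cell D;
  sF_id : forall (i : 'I_q.+1) (ii : (i <= i)%N), (forall s, kf (sF ii) s = id1 (kx (sX i) s)) /\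
    (forall (s t : {set 'I_n}) (st : [disjoint s & t]), kg (sF ii) st = id2 (kc (sX i) st));
  sT_cell : forall (i j k : 'I_q.+1) (ij : (i <= j)%N) (jk : (j <= k)%N) (ik : (i <= k)%N),
    is_kcell (sX i) (sX k) (kcomp (sF jk) (sF ij)) (sF ik) (sT ij jk);
  sT_idl : forall (i k : 'I_q.+1) (ii : (i <= i)%N) (ik : (i <= k)%N) s,
    sT ii ik s = id2 (kf (sF ik) s);
  sT_idr : forall (i k : 'I_q.+1) (ik : (i <= k)%N) (kk : (k <= k)%N) s,
    sT ik kk s = id2 (kf (sF ik) s);
  sT_assoc : forall (i j k l : 'I_q.+1) (ij : (i <= j)%N) (jk : (j <= k)%N) (kl : (k <= l)%N)
      (ik : (i <= k)%N) (jl : (j <= l)%N) s,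
    sT ik kl s \v (kf (sF kl) s \wl sT ij jk s)
    = sT ij jl s \v (sT jk kl s \wr kf (sF ij) s)
}.

Program Definition nerve_push (m n q : nat) (phi : 'I_m -> option 'I_n)
    (z : knerve m q) : knerve n q :=
  @KNerve n q (fun i => push_kob phi (sX z i))
    (fun i j ij => push_kmor phi (sF z ij))
    (fun i j k ij jk u => sT z ij jk (preim phi u)) _ _ _ _ _.
Next Obligation. by move=> m n q phi z i ii /=; have [h1 h2] := sF_id z ii; split. Qed.
Next Obligation. by move=> m n q phi z i j k ij jk ik; exact: push_kcell (sT_cell z ij jk ik). Qed.
Next Obligation. by move=> m n q phi z i k ii ik s; exact: sT_idl. Qed.
Next Obligation. by move=> m n q phi z i k ik kk s; exact: sT_idr. Qed.
Next Obligation. by move=> m n q phi z i j k l ij jk kl ik jl s; exact: sT_assoc. Qed.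

Definition monotone (p q : nat) (theta : 'I_p.+1 -> 'I_q.+1) : Prop :=
  {homo theta : i j / (i <= j)%N}.

Program Definition nerve_pull (n p q : nat) (theta : 'I_p.+1 -> 'I_q.+1)
    (h : monotone theta) (z : knerve n q) : knerve n p :=
  @KNerve n p (fun i => sX z (theta i)) (fun i j ij => sF z (h i j ij))
    (fun i j k ij jk => sT z (h i j ij) (h j k jk)) _ _ _ _ _.
Next Obligation. by move=> n p q theta h z i ii; exact: sF_id. Qed.
Next Obligation. by move=> n p q theta h z i j k ij jk ik; exact: sT_cell. Qed.
Next Obligation. by move=> n p q theta h z i k ii ik s; exact: sT_idl. Qed.
Next Obligation. by move=> n p q theta h z i k ik kk s; exact: sT_idr. Qed.
Next Obligation. by move=> n p q theta h z i j k l ij jk kl ik jl s; exact: sT_assoc. Qed.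

End GammaObject.

Section SmallSimplices.
Variable D : permutative.
Local Notation e := (gunit D).

Lemma set_ord1 (s : {set 'I_1}) : s = finset.set0 \/ s = [set: 'I_1]%SET.
Proof.
have [s0|s0] := boolP (ord0 \in s); [right|left]; apply/setP=> i;
  by rewrite !inE (ord1 i) ?s0 // (negbTE s0).
Qed.

Lemma disjoint_ord1 (s t : {set 'I_1}) :
  [disjoint s & t] -> s = finset.set0 \/ t = finset.set0.
Proof.
case: (set_ord1 s) => ->; first by left.
case: (set_ord1 t) => ->; first by right.
by rewrite -setI_eq0 finset.setIT => /eqP/setP/(_ ord0); rewrite !inE.
Qed.

Lemma rten_id1 (a b : ob D) : rten (id1 a) b = id1 (tens a b).
Proof. exact: (f2_id1 (rten_functor b)). Qed.

Lemma lten_id1 (a b : ob D) : lten a (id1 b) = id1 (tens a b).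
Proof. exact: (f2_id1 (lten_functor a)). Qed.

Lemma rten2_id2 (f : mor D) (b : ob D) : rten2 (id2 f) b = id2 (rten f b).
Proof. exact: (f2_id2 (rten_functor b)). Qed.

Lemma lten2_id2 (a : ob D) (f : mor D) : lten2 a (id2 f) = id2 (lten a f).
Proof. exact: (f2_id2 (lten_functor a)). Qed.

Lemma vcomp_id2 (f : mor D) : id2 f \v id2 f = id2 f.
Proof. by have := vcomp1a (id2 f); rewrite cod_id2. Qed.

Lemma inverse2_id2 (f : mor D) (b : cell D) : inverse2 (id2 f) b -> b = id2 f.
Proof.
case; rewrite cod_id2 dom_id2 => -[db _] bf _.
by rewrite -[RHS]bf; have := vcompa1 b; rewrite db.
Qed.

Lemma invertible2_id2 (f : mor D) : invertible2 (id2 f).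
Proof.
by exists (id2 f); split; rewrite ?dom_id2 ?cod_id2 ?vcomp_id2 //; split;
  rewrite ?dom_id2 ?cod_id2.
Qed.

Lemma Sigmai_id1l (x : ob D) (g : mor D) : Sigmai (id1 x) g = id2 (lten x g).
Proof. by apply: inverse2_id2; rewrite -Sigma_id1l; exact: SigmaK. Qed.

Lemma Sigmai_id1r (f : mor D) (y : ob D) : Sigmai f (id1 y) = id2 (rten f y).
Proof. by apply: inverse2_id2; rewrite -Sigma_id1r; exact: SigmaK. Qed.

Lemma comp1f_mor (f : mor D) (x y : ob D) : is_mor f x y -> id1 y \c f = f.
Proof. by case=> _ <-; exact: comp1f. Qed.

Lemma compf1_mor (f : mor D) (x y : ob D) : is_mor f x y -> f \c id1 x = f.
Proof. by case=> <- _; exact: compf1. Qed.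

Lemma id1_mor (x : ob D) : is_mor (id1 x) x x.
Proof. by split; rewrite ?src_id1 ?tgt_id1. Qed.

Lemma comp11 (x : ob D) : id1 x \c id1 x = id1 x.
Proof. exact: comp1f_mor (id1_mor x). Qed.

Lemma id2_cell (f : mor D) : is_cell (id2 f) f f.
Proof. by split; rewrite ?dom_id2 ?cod_id2. Qed.

Lemma beta1x' (x : ob D) : beta e x = id1 x.
Proof. exact: beta1x. Qed.

Lemma betax1 (x : ob D) : beta x e = id1 x.
Proof.
have := betaK (p := D) e x; rewrite beta1x tens1x => <-.
by have [s _] := beta_mor (p := D) x e; rewrite -[X in _ \c id1 X](tensx1 x) -s compf1.
Qed.

Section Endo.
Variable x : ob D.

Definition obs (s : {set 'I_1}) : ob D := if s == finset.set0 then e else x.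

Lemma obs0 : obs finset.set0 = e.
Proof. by rewrite /obs eqxx. Qed.

(* The object {x_s, c_{s,t}} of the value at 1_+ with x_{1} = x. *)
Program Definition kob1 : kob D 1 :=
  @KOb D 1 obs (fun s t _ => id1 (obs (s :|: t))) _ _ _ _ _ _.
Next Obligation.
move=> s t /= /disjoint_ord1[]->;
  rewrite ?finset.set0U ?finset.setU0 obs0 ?tens1x ?tensx1; exact: id1_mor.
Qed.
Next Obligation. exact: obs0. Qed.
Next Obligation. by move=> s d; rewrite /= finset.set0U. Qed.
Next Obligation. by move=> s d; rewrite /= finset.setU0. Qed.
Next Obligation.
move=> s t /= /disjoint_ord1[]-> d; rewrite obs0.
  by rewrite beta1x finset.set0U finset.setU0 comp11.
by rewrite betax1 finset.set0U finset.setU0 comp11.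
Qed.
Next Obligation.
move=> s t u /= /disjoint_ord1 st /disjoint_ord1 st_u /disjoint_ord1 tu d.
rewrite rten_id1 lten_id1.
case: st st_u tu => ->.
  rewrite !finset.set0U => -[]-> _;
    by rewrite ?finset.set0U ?finset.setU0 ?obs0 ?tens1x ?tensx1.
rewrite !finset.setU0 => -[]-> _;
  by rewrite ?finset.set0U ?finset.setU0 ?obs0 ?tens1x ?tensx1.
Qed.

Section Mor.
Variables (f : mor D) (hf : is_mor f x x).

Definition mors (s : {set 'I_1}) : mor D := if s == finset.set0 then id1 e else f.

Lemma mors0 : mors finset.set0 = id1 e.
Proof. by rewrite /mors eqxx. Qed.

Lemma mors_mor s : is_mor (mors s) (obs s) (obs s).
Proof. by rewrite /mors /obs; case: ifP => // _; exact: id1_mor. Qed.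

Lemma mors1 s : mors s \c id1 (obs s) = mors s.
Proof. exact: compf1_mor (mors_mor s). Qed.

Lemma mors1l s : id1 (obs s) \c mors s = mors s.
Proof. exact: comp1f_mor (mors_mor s). Qed.

Definition endo_data : kdata D 1 :=
  KData mors (fun s t _ => id2 (mors (s :|: t))).

Let simp := (finset.set0U, finset.setU0, obs0, mors0, tens1x, tensx1, rten_id1,
  lten_id1, @rten1 D, @lten1 D, mors1, mors1l, comp11, beta1x, betax1,
  Sigma_id1l, Sigma_id1r, Sigmai_id1l, Sigmai_id1r, rten2_id2, lten2_id2).

Lemma wid s : id2 (id1 (obs s)) \h id2 (mors s) = id2 (mors s).
Proof. by rewrite hcomp_id2 ?mors1l //; case: (mors_mor s) => _ ->; rewrite src_id1. Qed.

Lemma widr s : id2 (mors s) \h id2 (id1 (obs s)) = id2 (mors s).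
Proof. by rewrite hcomp_id2 ?mors1 //; case: (mors_mor s) => -> _; rewrite tgt_id1. Qed.

Lemma wid1 y : id2 (id1 y) \h id2 (id1 y) = id2 (id1 y) :> cell D.
Proof. by rewrite hcomp_id2 ?comp11 // tgt_id1 src_id1. Qed.

Lemma endo_kmor_subproof : is_kmor kob1 kob1 endo_data.
Proof.
split => /=.
- exact: mors_mor.
- move=> s t /disjoint_ord1[]->; rewrite !simp; exact: id2_cell.
- by move=> s t d; exact: invertible2_id2.
- exact: mors0.
- by move=> s d; rewrite !simp.
- by move=> s d; rewrite !simp.
- by move=> s t /disjoint_ord1[]-> d; rewrite !simp !(wid, widr, wid1, vcomp_id2).
move=> s t u /disjoint_ord1 st /disjoint_ord1 st_u /disjoint_ord1 tu d.
case: st st_u tu => ->.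
  rewrite !finset.set0U => -[]-> _;
    by rewrite !simp !(wid, widr, wid1, vcomp_id2).
rewrite !finset.setU0 => -[]-> _;
  by rewrite !simp !(wid, widr, wid1, vcomp_id2).
Qed.

Definition endo_kmor : kmor kob1 kob1 := KMor endo_kmor_subproof.

End Mor.

Lemma mors_id s : mors (id1 x) s = id1 (obs s).
Proof. by rewrite /mors /obs; case: ifP. Qed.

Variables (f : mor D) (hf : is_mor f x x).

Definition endo_if (b : bool) : kmor kob1 kob1 :=
  if b then endo_kmor hf else endo_kmor (id1_mor x).

Lemma endo_if_comp (b c : bool) : ~~ (b && c) ->
  is_kcell kob1 kob1 (kcomp (endo_if c) (endo_if b)) (endo_if (b || c))
    (fun s => id2 (kf (endo_if (b || c)) s)).
Proof.
set simp := (finset.set0U, finset.setU0, obs0, mors0, tens1x, tensx1, rten_id1,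
  lten_id1, @rten1 D, @lten1 D, mors1 hf, mors1l hf, comp11, mors_id,
  Sigmai_id1l, Sigmai_id1r, rten2_id2, lten2_id2).
set simp2 := (wid hf, widr hf, wid1, vcomp_id2).
case: b c => [] [] //= _; split => /=.
- by move=> s; rewrite !simp; exact: id2_cell.
- by rewrite mors0.
- by move=> s t /disjoint_ord1[]->; rewrite !simp !simp2.
- by move=> s; rewrite !simp; exact: id2_cell.
- by rewrite mors0.
- by move=> s t /disjoint_ord1[]->; rewrite !simp !simp2.
- by move=> s; rewrite !simp; exact: id2_cell.
- by rewrite mors0.
- by move=> s t /disjoint_ord1[]->; rewrite !simp !simp2.
Qed.

(* The 1-simplex given by f : x -> x. *)
Program Definition endo_simplex : knerve D 1 1 :=
  @KNerve D 1 1 (fun _ => kob1) (fun i j _ => endo_if (i < j)%N)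
    (fun i j k _ _ s => id2 (kf (endo_if (i < k)%N) s)) _ _ _ _ _.
Next Obligation.
move=> i ii /=; rewrite ltnn; split=> [s|s t st]; by rewrite /= mors_id.
Qed.
Next Obligation.
move=> i j k ij jk ik.
have -> : (i < k)%N = (i < j)%N || (j < k)%N.
  case: i j k ij jk ik => [i hi] [j hj] [k hk] /=.
  by move: i j k hi hj hk => [|[|i]] [|[|j]] [|[|k]].
apply: endo_if_comp.
case: i j k ij jk ik => [i hi] [j hj] [k hk] /=.
by move: i j k hi hj hk => [|[|i]] [|[|j]] [|[|k]].
Qed.
Next Obligation. by []. Qed.
Next Obligation. by []. Qed.
Next Obligation.
move=> i j k l ij jk kl ik jl s.
set simp := (mors_id, wid hf, widr hf, wid1, vcomp_id2).
case: i j k l ij jk kl ik jl => [i hi] [j hj] [k hk] [l hl] /=.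
by move: i j k l hi hj hk hl => [|[|i]] [|[|j]] [|[|k]] [|[|l]] //= *;
  rewrite /endo_if /= ?simp.
Qed.

End Endo.

(* The vertex given by x, as a face of the degenerate 1-simplex at x. *)
Definition vertex (x : ob D) : knerve D 1 0 :=
  @nerve_pull D 1 0 1 (fun _ => ord0) (fun _ _ _ => leqnn 0)
    (endo_simplex (id1_mor x)).

End SmallSimplices.

Section Spheres.
Variable R : realType.
Local Open Scope classical_set_scope.

(* The n-sphere is R^n with a basepoint at infinity, so that the smash product
   of spheres is concatenation of coordinates. *)
Definition sphere (n : nat) : topologicalType :=
  one_point_compactification 'rV[R]_n.

Definition infty (n : nat) : sphere n := None.

Definition smash (m n : nat) (t : sphere m) (s : sphere n) : sphere (m + n) :=
  match t, s with
  | Some t', Some s' => Some (row_mx t' s')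
  | _, _ => None
  end.

(* S^3 = R^3 u {oo} is identified with the unit sphere of C^2 by the
   stereographic projection
     p = (x, y, z) |-> (Z, W) = (2(x + iy), 2z + i(|p|^2 - 1)) / (|p|^2 + 1)
   and S^2 = R^2 u {oo} with CP^1 = C u {oo}; the Hopf map is
   (Z, W) |-> W / Z. *)
Definition hopf (v : sphere 3) : sphere 2 :=
  if v is Some p then
    let x : R := p 0 (inord 0) in
    let y : R := p 0 (inord 1) in
    let z : R := p 0 (inord 2) in
    let r := x ^+ 2 + y ^+ 2 in
    let c := (x ^+ 2 + y ^+ 2 + z ^+ 2 - 1) / 2 in
    if r == 0 then None else
    Some (\row_(j < 2)
      (if j == 0 then (x * z + y * c) / r else (x * c - y * z) / r))
  else None.

Definition stdsimplex (q : nat) : set 'rV[R]_q.+1 :=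
  [set d | (forall i, 0 <= d 0 i) /\ \sum_i d 0 i = 1].
Arguments stdsimplex : clear implicits.

Definition simplex_pt (q : nat) (d : 'rV[R]_q.+1) (h : d \in stdsimplex q) :
  stdsimplex q := exist (fun d => d \in stdsimplex q) d h.

Lemma simplex_push_subproof (p q : nat) (theta : 'I_p.+1 -> 'I_q.+1)
    (d : stdsimplex p) :
  (\row_j \sum_(i | theta i == j) set_val d 0 i) \in stdsimplex q.
Proof.
have [d0 d1] := set_valP d; apply/mem_set; split=> [j|].
  by rewrite mxE; apply: sumr_ge0 => i _; exact: d0.
under eq_bigr do rewrite mxE.
by rewrite -[RHS]d1 [RHS](partition_big theta xpredT).
Qed.

Definition simplex_push (p q : nat) (theta : 'I_p.+1 -> 'I_q.+1)
  (d : stdsimplex p) : stdsimplex q := simplex_pt (simplex_push_subproof theta d).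

Lemma vertex_pt_subproof : const_mx 1 \in stdsimplex 0.
Proof.
apply/mem_set; split=> [i|]; first by rewrite mxE ler01.
by rewrite big_ord1 mxE.
Qed.

Definition vertex_pt : stdsimplex 0 := simplex_pt vertex_pt_subproof.

(* The path t |-> (1 - t, t) in the 1-simplex, constant outside [0, 1]. *)
Definition clamp (t : R) : R := Num.max 0 (Num.min 1 t).

Lemma edge_pt_subproof (t : R) :
  (\row_(j < 2) if j == 0 then 1 - clamp t else clamp t) \in stdsimplex 1.
Proof.
have c0 : 0 <= clamp t by rewrite /clamp le_max lexx.
have c1 : clamp t <= 1 by rewrite /clamp ge_max ler01 /= ge_min lexx.
apply/mem_set; split=> [i|]; first by rewrite mxE; case: ifP; rewrite ?subr_ge0.
by rewrite !big_ord_recr big_ord0 /= !mxE /= add0r subrK.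
Qed.

Definition edge_pt (t : R) : stdsimplex 1 := simplex_pt (edge_pt_subproof t).

End Spheres.

Arguments stdsimplex : clear implicits.
Arguments infty {R n}.
Arguments hopf {R} v.

Section Prespectra.
Variable R : realType.
Local Open Scope classical_set_scope.

Record prespectrum := Prespectrum {
  level :> nat -> topologicalType;
  base : forall n, level n;
  struct : forall n, sphere R 1 -> level n -> level n.+1
}.

Definition is_prespectrum (X : prespectrum) : Prop := forall n,
  [/\ continuous (fun ty : sphere R 1 * X n => struct ty.1 ty.2),
      forall t, struct t (base X n) = base X n.+1
    & forall y : X n, struct infty y = base X n.+1].

Definition sphere_prespectrum : prespectrum :=
  Prespectrum (fun n => @infty R n) (fun n t (s : sphere R n) => smash t s).

Section Homotopy.
Variable X : prespectrum.

Definition is_pmap (m n : nat) (f : sphere R m -> X n) : Prop :=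
  continuous f /\ f infty = base X n.

(* The composite of f /\ S^1 : S^(m+1) -> X_n /\ S^1 with the structure map; the
   suspension coordinate comes first. *)
Definition susp (m n : nat) (f : sphere R m -> X n) (v : sphere R m.+1) : X n.+1 :=
  if v is Some r then
    struct (Some (\row_(j < 1) r 0 ord0))
      (f (Some (\row_(j < m) r 0 (lift ord0 j))))
  else base X n.+1.

Fixpoint suspn (N m n : nat) (f : sphere R m -> X n) :
    sphere R (N + m) -> X (N + n) :=
  match N return sphere R (N + m) -> X (N + n) with
  | 0 => f
  | N'.+1 => susp (@suspn N' m n f)
  end.

Definition is_homotopy (m n : nat) (H : R * sphere R m -> X n)
    (f g : sphere R m -> X n) : Prop :=
  [/\ {within (`[0, 1] : set R) `*` setT, continuous H},
      forall v, H (0, v) = f v,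
      forall v, H (1, v) = g v
    & forall t, 0 <= t <= 1 -> H (t, infty) = base X n].

Definition is_nullhomotopy (m n : nat) (H : R * sphere R m -> X n)
    (f : sphere R m -> X n) : Prop :=
  is_homotopy H f (fun _ => base X n).

(* Equality in the stable homotopy group colim_N [S^(N+m), X_(N+n)]. *)
Definition stably_equal (m n : nat) (f g : sphere R m -> X n) : Prop :=
  exists N H, is_homotopy H (@suspn N m n f) (@suspn N m n g).

(* The homotopy groups vanish outside degree i. *)
Definition concentrated (i : nat) : Prop :=
  forall (m n : nat) (f : sphere R m -> X n), m <> (n + i)%N -> is_pmap f ->
    stably_equal f (fun _ => base X n).

(* Two nullhomotopies of the same map S^m -> X_n form a map S^(m+1) -> X_n. *)
Definition glue (m n : nat) (A B : R * sphere R m -> X n) (v : sphere R m.+1) : X n :=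
  if v is Some r then
    let t := r 0 ord0 in
    let w : sphere R m := Some (\row_(j < m) r 0 (lift ord0 j)) in
    if 0 <= t then A (Num.min t 1, w) else B (Num.min (- t) 1, w)
  else base X n.

End Homotopy.

Arguments suspn {X} N {m n} f v.

Definition is_spectrum_map (X Y : prespectrum) (phi : forall n, X n -> Y n) : Prop :=
  forall n, [/\ continuous (phi n), phi n (base X n) = base Y n
    & forall t y, phi n.+1 (struct t y) = struct t (phi n y)].

Definition is_spectrum_nullhomotopy (X Y : prespectrum)
    (N : forall n, R * X n -> Y n) (phi : forall n, X n -> Y n) : Prop :=
  forall n, [/\ {within (`[0, 1] : set R) `*` setT, continuous (N n)},
    forall y, N n (0, y) = phi n y, forall y, N n (1, y) = base Y n,
    forall t, 0 <= t <= 1 -> N n (t, base X n) = base Y n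
    & forall t s y, 0 <= t <= 1 -> N n.+1 (t, struct s y) = struct s (N n (t, y))].

Section PostnikovInvariant.
Variables (X E F : prespectrum).
Variables (p : forall n, X n -> E n) (k : forall n, E n -> F n).
Variable N : forall n, R * X n -> F n.

(* The map pi_1 X -> pi_2 F induced by X -> hofib k: the class c is the image of
   the class b. *)
Definition connecting (m n : nat) (b : sphere R m -> X n)
    (c : sphere R m.+1 -> F n) : Prop :=
  exists2 h, is_nullhomotopy h (fun v => p (b v))
    & c = glue (fun tv => k (h tv)) (fun tv => N (tv.1, b tv.2)).

Definition sphere_cast (m m' : nat) (h : m = m') (v : sphere R m) : sphere R m' :=
  ecast m (sphere R m) h v.

(* E is H(pi_0 X) via p, F is Sigma^2 H(pi_1 X) via [connecting], and
   X -> E -> F is the beginning of the Postnikov tower of X: the class of k is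
   the bottom Postnikov invariant of X. *)
Record is_bottom_invariant : Prop := IsBottomInvariant {
  bi_E : is_prespectrum E;
  bi_F : is_prespectrum F;
  bi_p : is_spectrum_map p;
  bi_k : is_spectrum_map k;
  bi_N : is_spectrum_nullhomotopy N (fun n y => k (p y));
  bi_E0 : concentrated E 0;
  bi_F2 : concentrated F 2;
  bi_inj0 : forall n (f g : sphere R n -> X n), is_pmap f -> is_pmap g ->
    stably_equal (fun v => p (f v)) (fun v => p (g v)) -> stably_equal f g;
  bi_surj0 : forall n (g : sphere R n -> E n), is_pmap g ->
    exists M (f : sphere R (M + n) -> X (M + n)%N),
      is_pmap f /\ stably_equal (fun v => p (f v)) (suspn M g);
  bi_inj1 : forall n (b b' : sphere R n.+1 -> X n) c c', is_pmap b -> is_pmap b' ->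
    connecting b c -> connecting b' c' -> stably_equal c c' -> stably_equal b b';
  bi_surj1 : forall n (g : sphere R n.+2 -> F n), is_pmap g ->
    exists M (b : sphere R (M + n.+1) -> X (M + n)%N) c,
      [/\ is_pmap b, connecting b c
        & stably_equal c (fun v => suspn M g (sphere_cast (esym (addnS M n.+1)) v))]
}.

(* The stable map eta : Sigma S -> S, at level m + 2. *)
Definition susp_hopf (m : nat) : sphere R (m + 3) -> sphere R (m + 2) :=
  suspn m (hopf : sphere R 3 -> sphere_prespectrum 2).
Arguments susp_hopf : clear implicits.

(* The isomorphism from [HA, Sigma^2 HB] to stable quadratic maps sends k to
   a |-> <k, a, eta>, the Toda bracket, formed from nullhomotopies of a eta and of
   k a (its indeterminacy is zero): c is in pi_2 F = B. It is the only isomorphism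
   natural in A and B, since Hom(A, B[2]) has no other natural automorphism than
   the identity. *)
Definition quadratic_value (m : nat) (a : sphere R (m + 2) -> E (m + 2)%N)
    (c : sphere R (m + 3).+1 -> F (m + 2)%N) : Prop :=
  exists h M, [/\ is_nullhomotopy h (fun v => a (susp_hopf m v)),
    is_nullhomotopy M (fun v => k (a v))
    & c = glue (fun tv => k (h tv))
        (fun tv => M (tv.1, susp_hopf m tv.2))].

End PostnikovInvariant.

End Prespectra.

Arguments suspn {R X} N {m n} f v.

Section SegalSpectrum.
Variables (R : realType) (D : permutative).
Local Notation e := (gunit D).
Local Open Scope classical_set_scope.

Definition kcells : Type := {classic {k : nat & {q : nat & knerve D k q}}}.

Definition kcell (k q : nat) (z : knerve D k q) : kcells :=
  existT _ k (existT _ q z).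

(* The n-th space is the value at S^n of the left Kan extension to pointed
   spaces of the Gamma-space k_+ |-> |N K(D)(k_+)|: the quotient of the
   disjoint union, over all k, q and all q-simplices z of the nerve at k_+, of
   Delta^q x (S^n)^k, by the relations below. *)
Definition kblock (n : nat) (c : kcells) : topologicalType :=
  (stdsimplex R (projT1 (projT2 c)) * 'rV[sphere R n]_(projT1 c))%type.

Definition kraw (n : nat) : topologicalType := {c : kcells & kblock n c}.

Definition kpoint (n k q : nat) (z : knerve D k q) (d : stdsimplex R q)
  (s : 'rV[sphere R n]_k) : kraw n := existT (kblock n) (kcell z) (d, s).

Inductive kstep (n : nat) : kraw n -> kraw n -> Prop :=
| kstep_gamma (k l q : nat) (phi : 'I_k -> option 'I_l) (z : knerve D k q)
    (d : stdsimplex R q) (s : 'rV[sphere R n]_l) :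
    kstep (kpoint (nerve_push phi z) d s)
      (kpoint z d (\row_i (if phi i is Some j then s 0 j else infty)))
| kstep_simplex (k p q : nat) (theta : 'I_p.+1 -> 'I_q.+1)
    (h : monotone theta) (z : knerve D k q) (d : stdsimplex R p)
    (s : 'rV[sphere R n]_k) :
    kstep (kpoint (nerve_pull h z) d s) (kpoint z (simplex_push theta d) s).

Definition krel (n : nat) (a b : kraw n) : bool :=
  `[< clos_refl_sym_trans (kraw n) (@kstep n) a b >].

Lemma krel_refl n : reflexive (@krel n).
Proof. by move=> a; apply/asboolP; exact: rst_refl. Qed.

Lemma krel_sym n : ssrbool.symmetric (@krel n).
Proof. by move=> a b; apply/asboolP/asboolP; exact: rst_sym. Qed.

Lemma krel_trans n : ssrbool.transitive (@krel n).
Proof.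
by move=> b a c /asboolP ab /asboolP bc; apply/asboolP; exact: rst_trans bc.
Qed.

Canonical krel_equiv n :=
  EquivRel (@krel n) (@krel_refl n) (@krel_sym n) (@krel_trans n).

Definition kspace (n : nat) : topologicalType :=
  quotient_topology {eq_quot krel_equiv n}.

Definition kpi (n : nat) (a : kraw n) : kspace n := \pi_({eq_quot krel_equiv n}) a.
Definition krepr (n : nat) (y : kspace n) : kraw n :=
  repr (y : {eq_quot krel_equiv n}).

Definition kbase (n : nat) : kspace n :=
  kpi (kpoint (vertex e) (vertex_pt R) (const_mx infty)).

(* The structure map S^1 /\ K(D)_n -> K(D)_(n+1) is
   (t, [z, d, s]) |-> [z, d, t /\ s]. *)
Definition kraw_struct (n : nat) (t : sphere R 1) (a : kraw n) : kraw n.+1 :=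
  let: existT c (d, s) := a in
  existT (kblock n.+1) c (d, \row_i smash t (s 0 i)).

Definition kstruct (n : nat) (t : sphere R 1) (y : kspace n) : kspace n.+1 :=
  kpi (kraw_struct t (krepr y)).

Lemma kstructE (n : nat) (t : sphere R 1) (a : kraw n) :
  kstruct t (kpi a) = kpi (kraw_struct t a).
Proof.
have step b c : @kstep n b c -> kstep (kraw_struct t b) (kraw_struct t c).
  case=> [k l q phi z d s|k p q theta h z d s]; last first.
    exact: (kstep_simplex h z d (\row_i smash t (s 0 i))).
  have -> : kraw_struct t (kpoint z d (\row_i (if phi i is Some j then s 0 j else infty)))
      = kpoint z d (\row_i (if phi i is Some j then (\row_j smash t (s 0 j)) 0 j
                            else infty)).
    rewrite /kraw_struct /kpoint /=; congr existT; congr pair.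
    apply/rowP => i; rewrite !mxE.
    by case: (phi i) => [j|]; rewrite ?mxE //; case: (t).
  exact: kstep_gamma.
have main b c : clos_refl_sym_trans _ (@kstep n) b c ->
    clos_refl_sym_trans _ (@kstep n.+1) (kraw_struct t b) (kraw_struct t c).
  elim=> [u v /step uv|u|u v _ uv|u v w _ uv _ vw]; first exact: rst_step.
  - exact: rst_refl.
  - exact: rst_sym.
  - exact: rst_trans uv vw.
apply/(@eqmodP _ (krel_equiv n.+1))/asboolP/main/asboolP.
by apply/(@eqmodP _ (krel_equiv n)); exact: reprK.
Qed.

Definition kspectrum : prespectrum R := Prespectrum kbase kstruct.

(* The class of x in pi_0 K(D), as a map S^0 -> K(D)_0. *)
Definition ob_map (x : ob D) (v : sphere R 0) : kspace 0 :=
  kpi (kpoint (vertex x) (vertex_pt R) (const_mx v)).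

(* The class of f : e -> e in pi_1 K(D), as a map S^1 -> K(D)_0; the point of
   S^0 other than the basepoint is [Some 0]. *)
Definition loop_map (f : mor D) (hf : is_mor f e e) (v : sphere R 1) : kspace 0 :=
  if v is Some t then
    kpi (kpoint (endo_simplex hf) (edge_pt (t 0 0)) (const_mx (Some 0)))
  else kbase 0.

End SegalSpectrum.

Arguments kspectrum R D : clear implicits.
Arguments ob_map R {D} x v.
Arguments loop_map R {D f} hf v.

Section BottomInvariant.
Variables (R : realType) (D : picard).
Local Notation KD := (kspectrum R D).

(* The classes in pi_0 K(D) and pi_1 K(D), at level 2 of the spectrum. *)
Definition ob_class2 (x : ob D) : sphere R 2 -> KD 2 :=
  suspn 2 (ob_map R x : sphere R 0 -> KD 0).

Definition loop_class2 (f : loop D) : sphere R 3 -> KD 2 :=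
  suspn 2 (loop_map R (svalP f) : sphere R 1 -> KD 0).

(* Precomposition with eta : Sigma S -> S is q, under the identifications of
   pi_0 K(D) and pi_1 K(D) with [pi0 D] and [pi1 D]. *)
Definition eta_precomposition (q : pi0 D -> pi1 D) : Prop :=
  forall (x : ob D) (f : loop D), q (ob_class x) = loop_class f ->
    stably_equal (fun v => ob_class2 x (hopf v)) (loop_class2 f).

(* The bottom invariant k of K(D) corresponds to q under the isomorphism of
   [H pi_0, Sigma^2 H pi_1] with stable quadratic maps, whatever the spectra E and F
   and the map k which represent it. *)
Definition models_k0 (q : pi0 D -> pi1 D) : Prop :=
  forall (E F : prespectrum R) (p : forall n, KD n -> E n)
    (k : forall n, E n -> F n) (N : forall n, R * KD n -> F n),
    is_bottom_invariant p k N ->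
  forall (x : ob D) (f : loop D), q (ob_class x) = loop_class f ->
  forall m (c c' : sphere R (m + 3).+1 -> F (m + 2)%N),
    quadratic_value k (fun v => p _ (suspn m (ob_class2 x) v)) c ->
    connecting p k N (suspn m (loop_class2 f)) c' ->
    stably_equal c c'.

End BottomInvariant.

(* Main.v *)
(* The loop assigned to x is the unique class f such that, for some h : e -> (x x) X,
   one has h f = (beta_{x,x} X) h up to isomorphism.  Additivity comes from the
   decomposition of beta_{xy,xy}, and 2-torsion from beta_{x,x}^2 = 1.

   The map S^3 -> K(D)_2 given by x and the Hopf map is deformed into an open book:
   with the unit coordinates (Z, W) of S^3, the point x placed at W / Z is split into
   two points labelled by x, placed at two opposite discs of the pages.  When the
   pages turn once around the binding the two discs are exchanged, so that the label
   of the pair runs along beta_{x,x}; merging the discs leaves the open book with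
   monodromy the loop beta_{x,x} of the label x x.  Transport along h makes its
   monodromy f, and the open book with monodromy f is the suspended loop f.

   For the Toda bracket <k, x, eta>, the nullhomotopies chosen for k x and for
   x eta may be changed without effect, since their differences are classes of
   pi_1 F = 0 and of pi_2 E = 0.  With the nullhomotopy N of k p, and with the
   homotopy from x eta to f followed by the nullhomotopy of f, the bracket becomes
   the image of f by the connecting map. *)
Require Import Defs.
From HB Require Import structures.
From mathcomp Require Import all_boot all_order all_algebra.
From mathcomp Require Import all_classical all_reals all_analysis.
From mathcomp Require Import zify ring lra.
Import Order.TTheory GRing.Theory Num.Theory.
Import numFieldNormedType.Exports.
Import Defs.

Set Implicit Arguments.
Unset Strict Implicit.
Unset Printing Implicit Defensive.
Local Open Scope ring_scope.
Local Open Scope twocat_scope.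

(** * The transported loop *)

(** The relation between an endomorphism and its transported loop makes no choice of [X] or [h], and
    its uniqueness rests on the commutation of loops at [e]; the displayed composite is met only
    once, as one witness. In the topology, maps are built into the spaces of [kspectrum] as points
    with one or two labels, and each piece is continuous because it factors through a single block.
    The structure map of [kspectrum] starts from a product with a quotient space; suspended
    homotopies are therefore moved through [p] and [N] into [E] and [F], whose structure maps are
    continuous by hypothesis. The discs are exchanged because their centres [a] and [-a] make half a
    turn while Z makes a full one: -a^2 follows Z, so (W^2 - a^2 d^2) / (d W) deforms into Z / W,
    and a rotation of the projective line turns this into W / Z. Here d vanishes near the binding.
    Most maps to a sphere are written as quotients whose numerator and denominator never vanish
    together, which reduces continuity at infinity to the criterion [cont_sfrac]. *)

Lemma compAm (C : twocat) (f g h : mor C) x y z w : is_mor f x y -> is_mor g y z -> is_mor h z w ->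
  h \c (g \c f) = h \c g \c f.
Proof. by move=> [_ tf] [sg tg] [sh _]; rewrite compA ?tf ?tg. Qed.

Section TransportedLoops.
Variable D : picard.
Local Notation e := (gunit D).

Lemma cell_iso (a : cell D) f g : is_cell a f g -> iso1 f g.
Proof. by case=> <- <-; exact: cell_iso1. Qed.

Lemma iso1_compl (g f f' : mor D) x y z : is_mor f x y -> is_mor g y z ->
  iso1 f f' -> iso1 (g \c f) (g \c f').
Proof.
by move=> [_ tf] [sg _] ff; apply: iso1_comp => //; rewrite ?tf //; exact: iso1_refl.
Qed.

Lemma iso1_compr (f g g' : mor D) x y z : is_mor f x y -> is_mor g y z ->
  iso1 g g' -> iso1 (g \c f) (g' \c f).
Proof.
by move=> [_ tf] [sg _] gg; apply: iso1_comp => //; rewrite ?tf //; exact: iso1_refl.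
Qed.

Lemma iso1_rten (f f' : mor D) b : iso1 f f' -> iso1 (rten f b) (rten f' b).
Proof.
case=> a [<- <-] _; apply: (@cell_iso (rten2 a b)).
by split; rewrite ?(f2_dom (rten_functor b)) ?(f2_cod (rten_functor b)).
Qed.

Lemma iso1_lten (f f' : mor D) b : iso1 f f' -> iso1 (lten b f) (lten b f').
Proof.
case=> a [<- <-] _; apply: (@cell_iso (lten2 b a)).
by split; rewrite ?(f2_dom (lten_functor b)) ?(f2_cod (lten_functor b)).
Qed.

Lemma iso1_Sigma (f g : mor D) x x' y y' : is_mor f x x' -> is_mor g y y' ->
  iso1 (rten f y' \c lten x g) (lten x' g \c rten f y).
Proof. by move=> [<- <-] [<- <-]; exact: cell_iso (Sigma_cell f g). Qed.

Lemma rten_comp (g f : mor D) x y z b : is_mor f x y -> is_mor g y z ->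
  rten (g \c f) b = rten g b \c rten f b.
Proof. by move=> [_ tf] [sg _]; apply: (f2_comp (rten_functor b)); rewrite tf. Qed.

Lemma lten_comp (g f : mor D) x y z b : is_mor f x y -> is_mor g y z ->
  lten b (g \c f) = lten b g \c lten b f.
Proof. by move=> [_ tf] [sg _]; apply: (f2_comp (lten_functor b)); rewrite tf. Qed.

(* The loop f is the transport of the endomorphism g : y -> y to the unit along
   an equivalence e -> y X. *)
Definition transports (y : ob D) (g f : mor D) : Prop :=
  exists X h, is_mor h e (tens y X) /\ iso1 (h \c f) (rten g X \c h).

Lemma mor_inverse (f : mor D) x y : is_mor f x y ->
  exists g, [/\ is_mor g y x, iso1 (g \c f) (id1 x) & iso1 (f \c g) (id1 y)].
Proof. by move=> [<- <-]; have [g [? ? ?]] := mor_inv f; exists g. Qed.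

Lemma iso1_cancell (h f f' : mor D) x y z : is_mor f x y -> is_mor f' x y ->
  is_mor h y z -> iso1 (h \c f) (h \c f') -> iso1 f f'.
Proof.
move=> mf mf' mh hff; have [k [mk kh _]] := mor_inverse mh.
have cancel g : is_mor g x y -> iso1 (k \c (h \c g)) g.
  move=> mg; rewrite (compAm mg mh mk) -{2}(comp1f_mor mg).
  exact: iso1_compr mg (is_mor_comp mh mk) kh.
apply: iso1_trans (iso1_sym (cancel _ mf)) _; apply: iso1_trans (cancel _ mf').
exact: iso1_compl (is_mor_comp mf mh) mk hff.
Qed.

(** The Eckmann-Hilton argument: at the unit, [Sigma] is an invertible 2-cell between the two
    composites. *)
Lemma iso1_loopC (f g : mor D) : is_mor f e e -> is_mor g e e -> iso1 (f \c g) (g \c f).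
Proof.
move=> mf mg; have := iso1_Sigma mf mg.
by rewrite !lten1 !rten1.
Qed.

Lemma transports_uniq y g f f' : is_mor g y y -> is_mor f e e -> is_mor f' e e ->
  transports y g f -> transports y g f' -> iso1 f f'.
Proof.
move=> mg mf mf' [X [h [mh hf]]] [X' [h' [mh' hf']]].
have [k mk] : exists k, is_mor k X X'.
  suff [k mk _] : equiv_ob X X' by exists k.
  have E : equiv_ob (tens y X) (tens y X').
    apply: equiv_ob_trans (mor_equiv_ob mh').
    exact: equiv_ob_sym (mor_equiv_ob mh).
  have comm a b : equiv_ob (tens a b) (tens b a) := mor_equiv_ob (beta_mor (p := D) a b).
  (* The chain is X = e X, (y X') X, X (y X') = (X y) X', (y X) X', e X' = X'. *)
  apply: (@equiv_ob_trans _ _ (tens (tens y X') X)).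
    rewrite -{1}[X]tens1x.
    by apply: equiv_ob_tens; [exact: mor_equiv_ob mh' | exact: equiv_ob_refl].
  apply: equiv_ob_trans (comm _ _) _; rewrite -tensA.
  rewrite -{2}[X']tens1x; apply: equiv_ob_tens; last exact: equiv_ob_refl.
  apply: equiv_ob_trans (comm _ _) _.
  exact: equiv_ob_sym (mor_equiv_ob mh).
have [h'i [mh'i h'i1 h'i2]] := mor_inverse mh'.
have mkh : is_mor (lten y k \c h) e (tens y X') := is_mor_comp mh (lten_mor y mk).
pose l := h'i \c (lten y k \c h).
have ml : is_mor l e e := is_mor_comp mkh mh'i.
have hl : iso1 (h' \c l) (lten y k \c h).
  rewrite /l (compAm mkh mh'i mh') -{2}(comp1f_mor mkh).
  exact: iso1_compr mkh (is_mor_comp mh'i mh') h'i2.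
have lf : iso1 (l \c f) (f' \c l).
  apply: (@iso1_cancell h' _ _ e e (tens y X')) => //.
  - exact: is_mor_comp mf ml.
  - exact: is_mor_comp ml mf'.
  have [my mr mr'] := And3 (lten_mor y mk) (rten_mor X mg) (rten_mor X' mg).
  rewrite (compAm mf ml mh') (compAm ml mf' mh').
  apply: iso1_trans (iso1_compr mf (is_mor_comp ml mh') hl) _.
  rewrite -(compAm mf mh my); apply: iso1_trans (iso1_compl (is_mor_comp mf mh) my hf) _.
  rewrite (compAm mh mr my).
  apply: iso1_trans (iso1_compr mh (is_mor_comp mr my) (iso1_sym (iso1_Sigma mg mk))) _.
  rewrite -(compAm mh my mr').
  apply: iso1_trans (iso1_compl mkh mr' (iso1_sym hl)) _.
  rewrite (compAm ml mh' mr').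
  exact: iso1_compr ml (is_mor_comp mh' mr') (iso1_sym hf').
have fl := iso1_trans (iso1_loopC mf ml) lf.
apply: (@iso1_cancell l _ _ e e e) => //.
exact: iso1_trans lf (iso1_loopC mf' ml).
Qed.

Lemma transports_iso y g f f' : is_mor f e e -> iso1 f f' ->
  transports y g f -> transports y g f'.
Proof.
move=> mf ff [X [h [mh hf]]]; exists X, h; split=> //.
by apply: iso1_trans hf; apply: iso1_sym; exact: iso1_compl mf mh ff.
Qed.

Lemma transports_conj y y' g g' p f : is_mor g y y -> is_mor g' y' y' ->
  is_mor f e e -> is_mor p y y' -> iso1 (p \c g) (g' \c p) ->
  transports y g f -> transports y' g' f.
Proof.
move=> mg mg' mf mp pg [X [h [mh hf]]]; exists X, (rten p X \c h).
have [rp rg rg'] := And3 (rten_mor X mp) (rten_mor X mg) (rten_mor X mg').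
split; first exact: is_mor_comp mh rp.
rewrite -(compAm mf mh rp); apply: iso1_trans (iso1_compl (is_mor_comp mf mh) rp hf) _.
rewrite (compAm mh rg rp) (compAm mh rp rg') -(rten_comp X mg mp) -(rten_comp X mp mg').
exact: iso1_compr mh (rten_mor X (is_mor_comp mg mp)) (iso1_rten X pg).
Qed.

Lemma transports_id y : transports y (id1 y) (id1 e).
Proof.
have [ys [[u mu _] _]] := ob_inv y.
have [us [mus _ _]] := mor_inverse mu; exists ys, us; split=> //.
by rewrite rten_id1 (compf1_mor mus) (comp1f_mor mus); exact: iso1_refl.
Qed.

(** The two witnesses may use different equivalences; by uniqueness the second loop can be
    recomputed with the [X] and [h] of the first. *)
Lemma transports_comp y g g' f f' : is_mor g y y -> is_mor g' y y ->
  is_mor f e e -> is_mor f' e e ->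
  transports y g f -> transports y g' f' -> transports y (g \c g') (f \c f').
Proof.
move=> mg mg' mf mf' tf tf'.
have [X [h [mh hf]]] := tf.
have [h' [mh' hh' h'h]] := mor_inverse mh.
have [mr mr'] := conj (rten_mor X mg) (rten_mor X mg').
pose f2 := h' \c (rten g' X \c h).
have mf2 : is_mor f2 e e := is_mor_comp (is_mor_comp mh mr') mh'.
have hf2 : iso1 (h \c f2) (rten g' X \c h).
  have m := is_mor_comp mh mr'.
  rewrite (compAm m mh' mh) -{2}(comp1f_mor m).
  exact: iso1_compr m (is_mor_comp mh' mh) h'h.
have ff2 : iso1 f' f2.
  by apply: (transports_uniq mg' mf' mf2 tf'); exists X, h.
apply: (@transports_iso _ _ (f \c f2)); first exact: is_mor_comp mf2 mf.
  exact: iso1_sym (iso1_compl mf' mf ff2).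
exists X, h; split=> //; rewrite (compAm mf2 mf mh) (rten_comp X mg' mg).
apply: iso1_trans (iso1_compr mf2 (is_mor_comp mf mh) hf) _.
rewrite -(compAm mf2 mh mr) -(compAm mh mr' mr).
exact: iso1_compl (is_mor_comp mf2 mh) mr hf2.
Qed.

(** The new complement is [zs X], with [zs] inverse to [z]; the equivalence from [X] to [z zs X] is
    moved past [g] by [Sigma]. *)
Lemma transports_rten y z g f : is_mor g y y -> is_mor f e e ->
  transports y g f -> transports (tens y z) (rten g z) f.
Proof.
move=> mg mf [X [h [mh hf]]].
have [zs [[u mu _] _]] := ob_inv z; have [v [mv _ _]] := mor_inverse mu.
have mk : is_mor (rten v X) X (tens z (tens zs X)).
  by have := rten_mor X mv; rewrite tens1x tensA.
have [my mr] := conj (lten_mor y mk) (rten_mor X mg).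
exists (tens zs X), (lten y (rten v X) \c h); rewrite tensA; split.
  exact: is_mor_comp mh my.
rewrite -(compAm mf mh my); apply: iso1_trans (iso1_compl (is_mor_comp mf mh) my hf) _.
rewrite (compAm mh mr my) rtenA (compAm mh my (rten_mor _ mg)).
exact: iso1_compr mh (is_mor_comp mr my) (iso1_sym (iso1_Sigma mg mk)).
Qed.

Lemma transports_lten y z g f : is_mor g y y -> is_mor f e e ->
  transports y g f -> transports (tens z y) (lten z g) f.
Proof.
move=> mg mf /(transports_rten z mg mf).
have mb := beta_mor (p := D) y z.
apply: (transports_conj _ _ mf mb); rewrite ?(rten_mor _ mg, lten_mor _ mg) //.
- exact: rten_mor.
- exact: lten_mor.
case: (mg) => sg tg; have := beta_natl (p := D) g z; rewrite sg tg => ->.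
exact: iso1_refl.
Qed.

(** Conjugation by [v v]: naturality of [beta] moves each copy of [v] across, and [Sigma] restores
    their order. *)
Lemma transports_beta (x y : ob D) v f : is_mor f e e -> is_mor v x y ->
  transports (tens x x) (beta x x) f -> transports (tens y y) (beta y y) f.
Proof.
move=> mf mv; have [vx yv] := conj (rten_mor x mv) (lten_mor y mv).
have [b bxy bxx] := And3 (beta_mor (p := D) y y) (beta_mor (p := D) x y) (beta_mor (p := D) x x).
have byx := beta_mor (p := D) y x.
apply: (transports_conj _ _ mf (is_mor_comp vx yv)) => //.
case: (mv) => sv tv.
have nr := beta_natr (p := D) y v; rewrite sv tv in nr.
have nl := beta_natl (p := D) v x; rewrite sv tv in nl.
have [vy xv] := conj (rten_mor y mv) (lten_mor x mv).
rewrite (compAm vx yv b) nr -(compAm vx byx vy) nl (compAm bxx xv vy).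
exact: iso1_compr bxx (is_mor_comp vx yv) (iso1_sym (iso1_Sigma mv mv)).
Qed.

(** The second hexagon, from the first by inversion: by [betaM] the right-hand side is a left
    inverse of [beta z (tens x y)], of which the left-hand side is the inverse. *)
Lemma betaMl (x y z : ob D) :
  beta (tens x y) z = rten (beta x z) y \c lten x (beta y z).
Proof.
have [bz b] := conj (beta_mor (p := D) z (tens x y)) (beta_mor (p := D) (tens x y) z).
set r := RHS.
have [bxz byz] := conj (beta_mor (p := D) x z) (beta_mor (p := D) y z).
have [bzx bzy] := conj (beta_mor (p := D) z x) (beta_mor (p := D) z y).
have := lten_mor x byz; rewrite -!tensA => m1.
have := rten_mor y bxz; rewrite !tensA -2!tensA => m2.
have mr : is_mor r (tens (tens x y) z) (tens z (tens x y)).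
  by rewrite -tensA; exact: is_mor_comp m1 m2.
have m3 : is_mor (rten (beta z x) y) (tens (tens z x) y) (tens (tens x z) y) := rten_mor y bzx.
have m4 : is_mor (lten x (beta z y)) (tens (tens x z) y) (tens (tens x y) z).
  by have := lten_mor x bzy; rewrite -!tensA.
have rK : r \c beta z (tens x y) = id1 (tens z (tens x y)).
  rewrite betaM /r -(compAm (is_mor_comp m3 m4) m1 m2) (compAm m3 m4 m1).
  rewrite -(lten_comp x bzy byz) betaK lten_id1 -tensA (comp1f_mor m3).
  by rewrite -(rten_comp y bzx bxz) betaK rten_id1 tensA.
rewrite -(comp1f_mor b) -rK -(compAm b bz mr) betaK.
by rewrite (compf1_mor mr).
Qed.

(** The symmetry of [x y] with itself is the conjugate, by the middle exchange
    [p : x x y y -> x y x y], of [beta x x] on the first two factors followed by [beta y y] on the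
    last two. *)
Lemma transports_beta_tens (x y : ob D) f g : is_mor f e e -> is_mor g e e ->
  transports (tens x x) (beta x x) f -> transports (tens y y) (beta y y) g ->
  transports (tens (tens x y) (tens x y)) (beta (tens x y) (tens x y)) (g \c f).
Proof.
move=> mf mg tf tg.
have [bx by_] := conj (beta_mor (p := D) x x) (beta_mor (p := D) y y).
have [bxy byx] := conj (beta_mor (p := D) x y) (beta_mor (p := D) y x).
pose X := tens (tens x x) (tens y y).
pose Y := tens (tens x y) (tens x y).
pose p := lten x (rten (beta x y) y); pose q := lten x (rten (beta y x) y).
have mp : is_mor p X Y.
  by have := lten_mor x (rten_mor y bxy); rewrite /X /Y !tensA.
have mq : is_mor q Y X.
  by have := lten_mor x (rten_mor y byx); rewrite /X /Y !tensA.
have qp : q \c p = id1 X.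
  rewrite /q /p -(lten_comp x (rten_mor y bxy) (rten_mor y byx)).
  by rewrite -(rten_comp y bxy byx) betaK rten_id1 lten_id1 /X !tensA.
pose g1 := rten (beta x x) (tens y y); pose g2 := lten (tens x x) (beta y y).
have m1 : is_mor g1 X X := rten_mor _ bx.
have m2 : is_mor g2 X X := lten_mor _ by_.
have E : beta (tens x y) (tens x y) = p \c (g2 \c (g1 \c q)).
  rewrite betaM !betaMl.
  have ty : is_mor (rten (beta x x) y) (tens x (tens x y)) (tens x (tens x y)).
    by have := rten_mor y bx; rewrite !tensA.
  have tx : is_mor (lten x (beta y x)) (tens x (tens y x)) (tens x (tens x y)) := lten_mor x byx.
  have sy : is_mor (lten x (beta y y)) (tens (tens x y) y) (tens (tens x y) y).
    by have := lten_mor x by_; rewrite !tensA.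
  rewrite (lten_comp x sy (rten_mor y bxy)) (rten_comp y tx ty).
  by rewrite -/p rtenA lrtenA -/q -ltenA -/g1 -/g2 -(compAm (is_mor_comp mq m1) m2 mp).
have tfg : transports X (g2 \c g1) (g \c f).
  apply: transports_comp => //; first exact: transports_lten.
  exact: transports_rten.
apply: (transports_conj _ _ _ mp) tfg; rewrite ?E.
- exact: is_mor_comp m1 m2.
- exact: is_mor_comp (is_mor_comp (is_mor_comp mq m1) m2) mp.
- exact: is_mor_comp mf mg.
rewrite -(compAm mp (is_mor_comp (is_mor_comp mq m1) m2) mp).
rewrite -(compAm mp (is_mor_comp mq m1) m2) -(compAm mp mq m1) qp (compf1_mor m1).
exact: iso1_refl.
Qed.

(** The equivalence [h] is [(x u xs) u], from [e] to [x x xs xs]; the part of the formula formed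
    from [us] is inverse to it up to isomorphism. *)
Lemma transports_k0 (x xs : ob D) (u us : mor D) (hu : is_mor u e (tens x xs))
    (hus : equivalence_pair u us) :
  transports (tens x x) (beta x x) (k0_mor x xs u us).
Proof.
case: hus => mus _; have [su tu] := hu; rewrite su tu in mus * => uus.
have E1 : tens (tens x e) xs = tens x xs by rewrite tensx1.
have E2 : tens (tens x (tens x xs)) xs = tens (tens x x) (tens xs xs) by rewrite !tensA.
have h1 := rten_mor xs (lten_mor x hu); rewrite E1 E2 in h1.
have h2 := rten_mor xs (lten_mor x mus); rewrite E1 E2 in h2.
have mb := rten_mor (tens xs xs) (beta_mor (p := D) x x).
have mh := is_mor_comp hu h1; have mh' := is_mor_comp h2 mus.
exists (tens xs xs), (rten (lten x u) xs \c u); split=> //.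
have mbh := is_mor_comp mh mb.
rewrite /k0_mor (compAm mbh h2 mus) (compAm mbh mh' mh) -[X in iso1 _ X](comp1f_mor mbh).
apply: (iso1_compr mbh (is_mor_comp mh' mh)).
rewrite -(compAm mh' hu h1) (compAm h2 mus hu).
have m := is_mor_comp mus hu.
apply: (@iso1_trans _ _ (rten (lten x u) xs \c rten (lten x us) xs)).
  apply: (iso1_compl (is_mor_comp h2 m) h1).
  rewrite -[X in iso1 _ X](comp1f_mor h2); exact: iso1_compr h2 m uus.
have l1 := lten_mor x mus; have l2 := lten_mor x hu.
rewrite -(rten_comp xs l1 l2) -(lten_comp x mus hu).
apply: iso1_trans (iso1_rten xs (iso1_lten x uus)) _.
by rewrite lten_id1 rten_id1 E2; exact: iso1_refl.
Qed.

Lemma transports_beta_ex (x : ob D) :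
  exists f : loop D, transports (tens x x) (beta x x) (sval f).
Proof.
have [xs [xxs _]] := ob_inv x; have [u mu [us hus]] := equiv_ob_sym xxs.
by exists (k0_loop mu hus); exact: transports_k0.
Qed.

Definition beta_loop (x : ob D) : loop D := sval (cid (transports_beta_ex x)).

Lemma beta_loopP x : transports (tens x x) (beta x x) (sval (beta_loop x)).
Proof. exact: (svalP (cid (transports_beta_ex x))). Qed.

Lemma beta_loop_uniq x (f : loop D) : transports (tens x x) (beta x x) (sval f) ->
  loop_class (beta_loop x) = loop_class f.
Proof.
move=> tf; apply/loop_classP.
have U := transports_uniq (beta_mor (p := D) x x) (svalP (beta_loop x)) (svalP f).
exact: U (beta_loopP x) tf.
Qed.

Definition k0_map (a : pi0 D) : pi1 D := loop_class (beta_loop (ob_repr a)).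

(** The representative chosen by [ob_repr] is equivalent to [x], and [transports_beta] carries the
    loop along the equivalence. *)
Lemma k0_mapE x : k0_map (ob_class x) = loop_class (beta_loop x).
Proof.
have [v mv _] : equiv_ob x (ob_repr (ob_class x)) by apply/ob_classP; rewrite ob_reprK.
apply: beta_loop_uniq; exact: (transports_beta (svalP (beta_loop x)) mv (beta_loopP x)).
Qed.

Lemma k0_map_is_additive : {morph k0_map : a b / a + b}.
Proof.
(* [addrC] is used because [transports_beta_tens] composes the two loops in the opposite order. *)
move=> a b; rewrite -(ob_reprK a) -(ob_reprK b) [_ + _]pi0_addE !k0_mapE addrC.
rewrite [_ + _]pi1_addE; apply: beta_loop_uniq.
set x := ob_repr a; set y := ob_repr b.
exact: (transports_beta_tens (svalP (beta_loop x)) (svalP (beta_loop y)) (beta_loopP x) (beta_loopP y)).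
Qed.

Lemma k0_map0 : k0_map 0 = 0.
Proof. by apply: (addrI (k0_map 0)); rewrite -k0_map_is_additive !addr0. Qed.

HB.instance Definition _ :=
  GRing.isNmodMorphism.Build (pi0 D) (pi1 D) k0_map (conj k0_map0 k0_map_is_additive).

Lemma k0_map_quadratic : stable_quadratic k0_map.
Proof.
move=> a; rewrite -(ob_reprK a) /= k0_mapE; set x := ob_repr a.
rewrite mulr2n [_ + _]pi1_addE; apply/loop_classP => /=.
have mb := beta_mor (p := D) x x; have mf := svalP (beta_loop x).
have tb := transports_comp mb mb mf mf (beta_loopP x) (beta_loopP x).
rewrite betaK in tb.
exact: transports_uniq (id1_mor _) (is_mor_comp mf mf) (id1_mor e) tb (transports_id _).
Qed.

End TransportedLoops.

(** * Simplices of the nerve *)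

Section NerveExtensionality.
Variable D : permutative.

Lemma kob_eq n (x x' : kob D n) : (forall s, kx x s = kx x' s) ->
  (forall (s t : {set 'I_n}) (st : [disjoint s & t]), kc x st = kc x' st) -> x = x'.
Proof.
case: x x' => [X C p1 p2 p3 p4 p5 p6] [X' C' p1' p2' p3' p4' p5' p6'] /= xE cE.
have ? : X = X' by apply/funext.
have ? : C = C'.
  by apply: functional_extensionality_dep => s; apply: functional_extensionality_dep => t;
     apply/funext => st.
subst X' C'; f_equal; exact: Prop_irrelevance.
Qed.

Lemma kmor_eq n (x x' : kob D n) (f g : kmor x x') : (forall s, kf f s = kf g s) ->
  (forall (s t : {set 'I_n}) (st : [disjoint s & t]), kg f st = kg g st) -> f = g.
Proof.
case: f g => [[f1 f2] pf] [[g1 g2] pg] /= fE gE.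
have ? : f1 = g1 by apply/funext.
have ? : f2 = g2.
  by apply: functional_extensionality_dep => s; apply: functional_extensionality_dep => t;
     apply/funext => st.
subst g1 g2; f_equal; exact: Prop_irrelevance.
Qed.

(** Simplices must be compared by equality, since the relations [kstep] identify points on simplices
    that are literally faces or pushforwards; the axioms of a simplex are propositions and do not
    obstruct this. *)
Lemma knerve_eq n q (z z' : knerve D n q) :
  (forall i s, kx (sX z i) s = kx (sX z' i) s) ->
  (forall i (s t : {set 'I_n}) (st : [disjoint s & t]), kc (sX z i) st = kc (sX z' i) st) ->
  (forall (i j : 'I_q.+1) (ij : (i <= j)%N) s, kf (sF z ij) s = kf (sF z' ij) s) ->
  (forall (i j : 'I_q.+1) (ij : (i <= j)%N) (s t : {set 'I_n}) (st : [disjoint s & t]),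
    kg (sF z ij) st = kg (sF z' ij) st) ->
  (forall (i j k : 'I_q.+1) (ij : (i <= j)%N) (jk : (j <= k)%N) s, sT z ij jk s = sT z' ij jk s) ->
  z = z'.
Proof.
case: z z' => [X F T p1 p2 p3 p4 p5] [X' F' T' p1' p2' p3' p4' p5'] /= h1 h2 h3 h4 h5.
have ? : X = X' by apply/funext => i; apply: kob_eq => //; exact: h2.
subst X'.
have ? : F = F'.
  apply: functional_extensionality_dep => i; apply: functional_extensionality_dep => j.
  by apply/funext => ij; apply: kmor_eq => *; [exact: h3 | exact: h4].
have ? : T = T'.
  apply: functional_extensionality_dep => i; apply: functional_extensionality_dep => j.
  apply: functional_extensionality_dep => k.
  by apply: functional_extensionality_dep => ij; apply/funext => jk; apply/funext => s.
subst F' T'; f_equal; exact: Prop_irrelevance.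
Qed.

End NerveExtensionality.

Section Cells.
Variable D : permutative.

Lemma vcompa1_cell (a : cell D) f g : is_cell a f g -> a \v id2 f = a.
Proof. by case=> <- _; exact: vcompa1. Qed.

Lemma vcomp1a_cell (a : cell D) f g : is_cell a f g -> id2 g \v a = a.
Proof. by case=> _ <-; exact: vcomp1a. Qed.

Lemma hcomp1a_cell (a : cell D) f g x y : is_cell a f g -> is_mor f x y ->
  id2 (id1 y) \h a = a.
Proof. by move=> [<- _] [_ <-]; exact: hcomp1a. Qed.

Lemma hcompa1_cell (a : cell D) f g x y : is_cell a f g -> is_mor f x y ->
  a \h id2 (id1 x) = a.
Proof. by move=> [<- _] [<- _]; exact: hcompa1. Qed.

Lemma hcomp_id2_mor (g f : mor D) x y z : is_mor f x y -> is_mor g y z ->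
  id2 g \h id2 f = id2 (g \c f).
Proof. by move=> [_ tf] [sg _]; apply: hcomp_id2; rewrite tf. Qed.

End Cells.

Section Simplices.
Variables (D : permutative) (n : nat).
Local Notation e := (gunit D).

Definition idk_data (x : kob D n) : kdata D n :=
  KData (fun s => id1 (kx x s)) (fun s t st => id2 (kc x st)).

Lemma idk_subproof (x : kob D n) : is_kmor x x (idk_data x).
Proof.
split=> /=.
- by move=> s; exact: id1_mor.
- move=> s t st; rewrite rten_id1 lten_id1.
  have m := kc_mor x st.
  rewrite comp11 (comp1f_mor m) (compf1_mor m); exact: id2_cell.
- by move=> *; exact: invertible2_id2.
- by rewrite kx0.
- by move=> s d; rewrite kc0s.
- by move=> s d; rewrite kcs0.
- move=> s t st ts; rewrite Sigma_id1l lten_id1 (kcC x st).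
  have m := kc_mor x st; have mb := beta_mor (kx x s) (kx x t).
  rewrite (hcomp_id2_mor m mb) (hcomp_id2_mor (id1_mor _) mb) (compf1_mor mb).
  by rewrite (hcomp_id2_mor m mb) vcomp_id2.
- move=> s t u st st_u tu s_tu.
  have [m1 m2 m3 m4] := And4 (kc_mor x st) (kc_mor x st_u) (kc_mor x tu) (kc_mor x s_tu).
  have r1 := rten_mor (kx x u) m1; have l3 := lten_mor (kx x s) m3.
  rewrite Sigmai_id1r Sigma_id1l !(rten_id1, lten_id1) rten2_id2 lten2_id2.
  rewrite (comp1f_mor m2) tensA (comp1f_mor m4) comp11.
  rewrite (hcomp_id2_mor m2 r1) -tensA (hcomp_id2_mor r1 (id1_mor _)) (comp1f_mor r1).
  rewrite (hcomp_id2_mor m2 r1) ?vcomp_id2.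
  rewrite (hcomp_id2_mor m4 l3) -?tensA.
  have l3' : is_mor (lten (kx x s) (kc x tu)) (tens (kx x s) (kx x (t :|: u)))
     (tens (tens (kx x s) (kx x t)) (kx x u)) by rewrite tensA.
  rewrite (hcomp_id2_mor l3' (id1_mor _)) (comp1f_mor l3') (hcomp_id2_mor m4 l3') ?vcomp_id2.
  by rewrite (kcA x st st_u tu s_tu).
Qed.

Definition idk (x : kob D n) : kmor x x := KMor (idk_subproof x).

Lemma kcomp_idr (x x' : kob D n) (f : kmor x x') :
  is_kcell x x' (kcomp f (idk x)) f (fun s => id2 (kf f s)).
Proof.
have F := kmorP f; split=> /= [s||s t st].
- by rewrite (compf1_mor (kf_mor F s)); exact: id2_cell.
- by rewrite (kf0 F).
have [m1 m2 m3] := And3 (kf_mor F s) (kf_mor F t) (kf_mor F (s :|: t)).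
have [mc mc' cg] := And3 (kc_mor x st) (kc_mor x' st) (kg_cell F st).
have l2 := lten_mor (kx x' s) m2; have r1 := rten_mor (kx x t) m1.
have m := is_mor_comp r1 l2.
rewrite rten_id1 (comp1f_mor mc) (hcompa1_cell cg (is_mor_comp mc m)).
rewrite Sigmai_id1r rten2_id2 lten2_id2.
rewrite (hcomp_id2_mor r1 l2) (hcomp_id2_mor mc m) (hcomp_id2_mor m3 mc') vcomp_id2.
by rewrite (vcompa1_cell cg) (vcomp1a_cell cg).
Qed.

Lemma kcomp_idl (x x' : kob D n) (f : kmor x x') :
  is_kcell x x' (kcomp (idk x') f) f (fun s => id2 (kf f s)).
Proof.
have F := kmorP f; split=> /= [s||s t st].
- by rewrite (comp1f_mor (kf_mor F s)); exact: id2_cell.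
- by rewrite (kf0 F).
have [m1 m2 m3] := And3 (kf_mor F s) (kf_mor F t) (kf_mor F (s :|: t)).
have [mc mc' cg] := And3 (kc_mor x st) (kc_mor x' st) (kg_cell F st).
have l2 := lten_mor (kx x' s) m2; have r1 := rten_mor (kx x t) m1.
have m := is_mor_comp r1 l2.
rewrite rten_id1 lten_id1 comp11.
rewrite (hcomp1a_cell cg (is_mor_comp mc m)).
rewrite Sigmai_id1l rten2_id2 lten2_id2.
rewrite (hcomp_id2_mor l2 (id1_mor _)) (comp1f_mor l2).
rewrite (hcomp_id2_mor r1 l2) (hcomp_id2_mor mc m).
rewrite (hcomp_id2_mor (is_mor_comp mc r1) l2) (compAm mc r1 l2).
by rewrite (hcomp_id2_mor m3 mc') (vcompa1_cell cg) !(vcomp1a_cell cg).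
Qed.

Section Edge.
Variables (x x' : kob D n) (f : kmor x x').

Definition edge_ob (a : nat) : kob D n := if a is 0 then x else x'.

(** Indexing by natural numbers lets the matching on both ends reduce; the case of an edge from 1 to
    0 is void. *)
Definition edge_mor (a b : nat) : (a <= b)%N -> kmor (edge_ob a) (edge_ob b) :=
  match a, b return (a <= b)%N -> kmor (edge_ob a) (edge_ob b) with
  | 0, 0 => fun _ => idk x
  | 0, _.+1 => fun _ => f
  | _.+1, 0 => fun h => False_rect _ (notF h)
  | _.+1, _.+1 => fun _ => idk x'
  end.

Program Definition edge_simplex : knerve D n 1 :=
  @KNerve D n 1 (fun i => edge_ob i) (fun i j ij => edge_mor ij)
    (fun i j k ij jk s => id2 (kf (edge_mor (leq_trans ij jk)) s)) _ _ _ _ _.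
Next Obligation. by move=> [[|i] hi] ii; split. Qed.
Next Obligation.
move=> [i hi] [j hj] [k hk] /= ij jk ik; rewrite (bool_irrelevance (leq_trans ij jk) ik).
move: i j k {hi hj hk} ij jk ik => [|i] [|j] [|k] // ij jk ik; rewrite /edge_mor /=.
- exact: kcomp_idl.
- exact: kcomp_idr.
- exact: kcomp_idl.
- exact: kcomp_idl.
Qed.
Next Obligation. by move=> i k ii ik s /=; rewrite (bool_irrelevance (leq_trans _ _) ik). Qed.
Next Obligation. by move=> i k ik kk s /=; rewrite (bool_irrelevance (leq_trans _ _) ik). Qed.
Next Obligation.
move=> [i hi] [j hj] [k hk] [l hl] /= ij jk kl ik jl s.
have F := kmorP f.
have m := kf_mor F s.
have w1 := hcomp_id2_mor m (id1_mor _); have w2 := hcomp_id2_mor (id1_mor _) m.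
rewrite (comp1f_mor m) in w1; rewrite (compf1_mor m) in w2.
have w3 y : id2 (id1 y) \h id2 (id1 y) = id2 (id1 y) :> cell D.
  by rewrite (hcomp_id2_mor (id1_mor _) (id1_mor _)) comp11.
have := (w1, w2, w3, vcomp_id2).
by move: i j k l {hi hj hk hl} ij jk kl ik jl => [|i] [|j] [|k] [|l] //= ij jk kl ik jl E;
  rewrite /edge_mor /= ?E.
Qed.

End Edge.

End Simplices.

(** * Simplices of the value at 1_+ from normal lax functors into [D] *)

Section LaxSimplex.
Variable D : permutative.
Local Notation e := (gunit D).

Definition cells (a : cell D) (s : {set 'I_1}) : cell D :=
  if s == finset.set0 then id2 (id1 e) else a.

Lemma cells0 a : cells a finset.set0 = id2 (id1 e).
Proof. by rewrite /cells eqxx. Qed.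

Lemma mors_is_mor (f : mor D) x y (s : {set 'I_1}) : is_mor f x y ->
  is_mor (mors f s) (obs x s) (obs y s).
Proof. by rewrite /mors /obs; case: ifP => // _ _; exact: id1_mor. Qed.

Lemma cells_is_cell (a : cell D) f g (s : {set 'I_1}) : is_cell a f g ->
  is_cell (cells a s) (mors f s) (mors g s).
Proof. by rewrite /cells /mors; case: ifP => // _ _; exact: id2_cell. Qed.

Lemma mors_comp (g f : mor D) s : mors (g \c f) s = mors g s \c mors f s.
Proof. by rewrite /mors; case: ifP => // _; rewrite comp11. Qed.

Lemma cells_id2 (f : mor D) s : cells (id2 f) s = id2 (mors f s).
Proof. by rewrite /cells /mors; case: ifP. Qed.

Section Mor1.
Variables (f : mor D) (x y : ob D) (hf : is_mor f x y).

Lemma kmor1_subproof : is_kmor (kob1 x) (kob1 y) (endo_data f).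
Proof.
pose simp := (finset.set0U, finset.setU0, obs0, @mors0 D, @tens1x D, @tensx1 D, rten_id1,
  lten_id1, @rten1 D, @lten1 D, comp11, @beta1x D, betax1,
  Sigma_id1l, Sigma_id1r, Sigmai_id1l, Sigmai_id1r, rten2_id2, lten2_id2).
have m s := mors_is_mor s hf.
have m1 s : mors f s \c id1 (obs x s) = mors f s := compf1_mor (m s).
have m1l s : id1 (obs y s) \c mors f s = mors f s := comp1f_mor (m s).
have w1 s : id2 (id1 (obs y s)) \h id2 (mors f s) = id2 (mors f s).
  by rewrite (hcomp_id2_mor (m s) (id1_mor _)) m1l.
have w2 s : id2 (mors f s) \h id2 (id1 (obs x s)) = id2 (mors f s).
  by rewrite (hcomp_id2_mor (id1_mor _) (m s)) m1.
have w3 z : id2 (id1 z) \h id2 (id1 z) = id2 (id1 z) :> cell D.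
  by rewrite (hcomp_id2_mor (id1_mor _) (id1_mor _)) comp11.
split => /=.
- exact: m.
- move=> s t /disjoint_ord1[]->; rewrite !simp !(m1, m1l); exact: id2_cell.
- by move=> s t d; exact: invertible2_id2.
- exact: mors0.
- by move=> s d; rewrite !simp.
- by move=> s d; rewrite !simp.
- by move=> s t /disjoint_ord1[]-> d; rewrite !simp ?(m1, m1l) ?(w1, w2, w3, vcomp_id2).
move=> s t u /disjoint_ord1 st /disjoint_ord1 st_u /disjoint_ord1 tu d.
case: st st_u tu => ->.
  rewrite !finset.set0U => -[]-> _;
    by rewrite !simp ?(m1, m1l) ?(w1, w2, w3, vcomp_id2).
rewrite !finset.setU0 => -[]-> _;
  by rewrite !simp ?(m1, m1l) ?(w1, w2, w3, vcomp_id2).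
Qed.

Definition kmor1 : kmor (kob1 x) (kob1 y) := KMor kmor1_subproof.

End Mor1.

Lemma kcell1 (f g h : mor D) x y z (hf : is_mor f x y) (hg : is_mor g y z)
    (hh : is_mor h x z) a : is_cell a (g \c f) h ->
  is_kcell (kob1 x) (kob1 z) (kcomp (kmor1 hg) (kmor1 hf)) (kmor1 hh) (cells a).
Proof.
move=> ca.
pose simp := (finset.set0U, finset.setU0, obs0, @mors0 D, cells0, @tens1x D, @tensx1 D, rten_id1,
  lten_id1, @rten1 D, @lten1 D, comp11, @lten21 D, @rten21 D,
  Sigmai_id1l, Sigmai_id1r, rten2_id2, lten2_id2).
have [mf mg mh] := And3 (fun s => mors_is_mor s hf) (fun s => mors_is_mor s hg)
  (fun s => mors_is_mor s hh).
have C s : is_cell (cells a s) (mors g s \c mors f s) (mors h s).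
  by rewrite -mors_comp; exact: cells_is_cell.
have mgf s := is_mor_comp (mf s) (mg s).
split=> /= [s||s t].
- exact: C.
- exact: cells0.
have i s := hcomp_id2_mor (id1_mor _) (mf s).
have j s := hcomp_id2_mor (id1_mor _) (mg s).
have i' s := hcomp_id2_mor (mf s) (id1_mor _).
have j' s := hcomp_id2_mor (mg s) (id1_mor _).
have k s := hcomp_id2_mor (mf s) (mg s).
have l s := hcomp_id2_mor (id1_mor _) (mgf s).
have a5 s := compf1_mor (mgf s).
have w3 u : id2 (id1 u) \h id2 (id1 u) = id2 (id1 u) :> cell D.
  by rewrite (hcomp_id2_mor (id1_mor _) (id1_mor _)) comp11.
have [a1 a2 a3 a4] := And4 (fun s => compf1_mor (mf s)) (fun s => comp1f_mor (mf s))
  (fun s => compf1_mor (mg s)) (fun s => comp1f_mor (mg s)).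
have [b1 b2 b3 b4] := And4 (fun s => hcomp1a_cell (C s) (mgf s))
  (fun s => hcompa1_cell (C s) (mgf s))
  (fun s => vcomp1a_cell (C s)) (fun s => vcompa1_cell (C s)).
by move=> /disjoint_ord1[]->; rewrite !simp !(i, j, i', j', k, l, w3, a1, a2, a3, a4, a5) ?vcomp_id2 ?(b1, b2) ?(b3, b4).
Qed.

Section Lax.
Variables (q : nat) (X : nat -> ob D) (F : nat -> nat -> mor D) (T : nat -> nat -> nat -> cell D).
Hypotheses (HF : forall a b, (a <= b)%N -> is_mor (F a b) (X a) (X b))
  (F1 : forall a, F a a = id1 (X a))
  (HT : forall a b c, (a <= b)%N -> (b <= c)%N -> is_cell (T a b c) (F b c \c F a b) (F a c))
  (Tl : forall a c, T a a c = id2 (F a c)) (Tr : forall a c, T a c c = id2 (F a c))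
  (TA : forall a b c d, (a <= b)%N -> (b <= c)%N -> (c <= d)%N ->
    T a c d \v (F c d \wl T a b c) = T a b d \v (T b c d \wr F a b)).

Program Definition lax_simplex : knerve D 1 q :=
  @KNerve D 1 q (fun i => kob1 (X i)) (fun i j ij => kmor1 (HF ij))
    (fun i j k _ _ => cells (T i j k)) _ _ _ _ _.
Next Obligation.
move=> i ii /=; rewrite F1; split=> [s|s t st]; rewrite ?mors_id //.
Qed.
Next Obligation. by move=> i j k ij jk ik /=; exact: (kcell1 (HF ij) (HF jk) (HF ik) (HT ij jk)). Qed.
Next Obligation. by move=> i k ii ik s /=; rewrite Tl cells_id2. Qed.
Next Obligation. by move=> i k ik kk s /=; rewrite Tr cells_id2. Qed.
Next Obligation.
move=> i j k l ij jk kl ik jl s; rewrite /= /cells /mors; case: ifP => [_|_]; last exact: (TA ij jk kl).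
by rewrite (hcomp_id2_mor (id1_mor _) (id1_mor _)).
Qed.

End Lax.

Section Triangle.
Variables (x y z : ob D) (f g h : mor D) (a : cell D).
Hypotheses (mf : is_mor f x y) (mg : is_mor g y z) (mh : is_mor h x z)
  (ca : is_cell a (g \c f) h).

Definition tri_ob (i : nat) : ob D := match i with 0 => x | 1 => y | _ => z end.
Definition tri_mor (i j : nat) : mor D :=
  match i, j with
  | 0, 0 => id1 x | 0, 1 => f | 0, _ => h
  | 1, 1 => id1 y | 1, _ => g | _, _ => id1 z
  end.
Definition tri_cell (i j k : nat) : cell D :=
  match i, j, k with 0, 1, _.+2 => a | _, _, _ => id2 (tri_mor i k) end.

Lemma tri_is_mor i j : (i <= j)%N -> is_mor (tri_mor i j) (tri_ob i) (tri_ob j).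
Proof.
by move: i j => [|[|i]] [|[|j]] //= _; exact: id1_mor.
Qed.

Lemma tri_mor1 i : tri_mor i i = id1 (tri_ob i).
Proof. by move: i => [|[|i]]. Qed.

Lemma tri_is_cell i j k : (i <= j)%N -> (j <= k)%N ->
  is_cell (tri_cell i j k) (tri_mor j k \c tri_mor i j) (tri_mor i k).
Proof.
by move: i j k => [|[|i]] [|[|j]] [|[|k]] //= _ _;
  rewrite ?(comp11, comp1f_mor mf, compf1_mor mf, comp1f_mor mg, compf1_mor mg,
    comp1f_mor mh, compf1_mor mh) //; exact: id2_cell.
Qed.

Lemma tri_celll i k : tri_cell i i k = id2 (tri_mor i k).
Proof. by move: i k => [|[|i]] [|[|k]]. Qed.

Lemma tri_cellr i k : tri_cell i k k = id2 (tri_mor i k).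
Proof. by move: i k => [|[|i]] [|[|k]]. Qed.

Lemma tri_cellA i j k l : (i <= j)%N -> (j <= k)%N -> (k <= l)%N ->
  tri_cell i k l \v (tri_mor k l \wl tri_cell i j k)
  = tri_cell i j l \v (tri_cell j k l \wr tri_mor i j).
Proof.
have mgf := is_mor_comp mf mg.
have w3 u : id2 (id1 u) \h id2 (id1 u) = id2 (id1 u) :> cell D.
  by rewrite (hcomp_id2_mor (id1_mor _) (id1_mor _)) comp11.
have W (f' : mor D) x' y' (m : is_mor f' x' y') :=
  conj (etrans (hcomp_id2_mor m (id1_mor _)) (congr1 _ (comp1f_mor m)))
       (etrans (hcomp_id2_mor (id1_mor _) m) (congr1 _ (compf1_mor m))).
have [[f1 f2] [g1 g2] [h1 h2]] := And3 (W _ _ _ mf) (W _ _ _ mg) (W _ _ _ mh).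
have gf := hcomp_id2_mor mf mg.
have [b1 b2 b3 b4] := And4 (hcomp1a_cell ca mgf) (hcompa1_cell ca mgf)
  (vcomp1a_cell ca) (vcompa1_cell ca).
by move: i j k l => [|[|i]] [|[|j]] [|[|k]] [|[|l]] //= _ _ _;
  rewrite ?(f1, f2, g1, g2, h1, h2, w3, gf, b1, b2) ?vcomp_id2 ?(b3, b4).
Qed.

Definition tri_simplex : knerve D 1 2 :=
  lax_simplex 2 tri_is_mor tri_mor1 tri_is_cell tri_celll tri_cellr tri_cellA.

End Triangle.

End LaxSimplex.

(** * Objects and 1-cells of the value at 2_+ *)

Section PairObjects.
Variable D : permutative.
Local Notation e := (gunit D).

Definition opt (b : bool) (x : ob D) : ob D := if b then x else e.

Lemma disjoint_in n (s t : {set 'I_n}) i : [disjoint s & t] -> ~~ ((i \in s) && (i \in t)).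
Proof. by rewrite -setI_eq0 => /eqP/setP/(_ i); rewrite !inE => ->. Qed.

Local Notation i0 := (ord0 : 'I_2).
Local Notation i1 := (ord_max : 'I_2).

Section Kob2.
Variables x1 x2 : ob D.

Definition pob (s : {set 'I_2}) : ob D := tens (opt (i0 \in s) x1) (opt (i1 \in s) x2).

(** The shuffle which moves the [x1] of [t] past the [x2] of [s]; it is an identity unless [t]
    contains the first index and [s] the second. *)
Definition pc (s t : {set 'I_2}) : mor D :=
  lten (opt (i0 \in s) x1)
    (rten (beta (opt (i0 \in t) x1) (opt (i1 \in s) x2)) (opt (i1 \in t) x2)).

Let simp := (@tens1x D, @tensx1 D, @rten1 D, @lten1 D, rten_id1, lten_id1, @beta1x D, betax1, comp11).

Program Definition kob2 : kob D 2 :=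
  @KOb D 2 pob (fun s t _ => pc s t) _ _ _ _ _ _.
Next Obligation.
move=> s t st; rewrite /pob /pc !inE.
have := disjoint_in i0 st; have := disjoint_in i1 st.
(* By disjointness each index lies in [s], in [t] or in neither; in each of these cases the
   structure cell is an identity or a single [beta]. *)
case: (i0 \in s) (i0 \in t) (i1 \in s) (i1 \in t) => [] [] [] [] //= _ _;
  rewrite /opt /= ?simp; try exact: id1_mor; exact: beta_mor.
Qed.
Next Obligation. by rewrite /pob !inE /= tens1x. Qed.
Next Obligation. by move=> s d; rewrite /pc /pob /= !inE /= /opt !simp. Qed.
Next Obligation. by move=> s d; rewrite /pc /pob /= !inE /= /opt !simp. Qed.
Next Obligation.
move=> s t st ts; rewrite /pob /pc.
have := disjoint_in i0 st; have := disjoint_in i1 st.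
case: (i0 \in s) (i0 \in t) (i1 \in s) (i1 \in t) => [] [] [] [] //= _ _;
  rewrite /opt /= ?simp // ?betaK // (compf1_mor (beta_mor _ _)) //.
Qed.
Next Obligation.
move=> s t u st st_u tu s_tu; rewrite /pob /pc !inE.
have := disjoint_in i0 st; have := disjoint_in i1 st.
have := disjoint_in i0 tu; have := disjoint_in i1 tu.
have := disjoint_in i0 st_u; have := disjoint_in i1 st_u; rewrite !inE.
case: (i0 \in s) (i0 \in t) (i0 \in u) (i1 \in s) (i1 \in t) (i1 \in u)
  => [] [] [] [] [] [] //= _ _ _ _ _ _; rewrite /opt /= ?simp //.
all: rewrite ?(compf1_mor (beta_mor _ _)) ?(comp1f_mor (beta_mor _ _)) //.
Qed.

End Kob2.

Definition swap2 (i : 'I_2) : option 'I_2 := Some (if i == i0 then i1 else i0).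
Definition fold2 (i : 'I_2) : option 'I_1 := Some ord0.
Definition fst2 (i : 'I_2) : option 'I_1 := if i == i0 then Some ord0 else None.
Definition snd2 (i : 'I_2) : option 'I_1 := if i == i0 then None else Some ord0.

Lemma preim_swap0 (s : {set 'I_2}) : (i0 \in preim swap2 s) = (i1 \in s).
Proof. by rewrite inE. Qed.
Lemma preim_swap1 (s : {set 'I_2}) : (i1 \in preim swap2 s) = (i0 \in s).
Proof. by rewrite inE. Qed.

Section Swap.
Variable x : ob D.

(** The symmetry sits over the full set only: each point alone keeps a constant label, and [beta]
    appears when the two points are merged. *)
Definition swap_mor (s : {set 'I_2}) : mor D :=
  if (i0 \in s) && (i1 \in s) then beta x x
  else id1 (tens (opt (i0 \in s) x) (opt (i1 \in s) x)).

Definition swap_data : kdata D 2 :=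
  KData swap_mor
    (fun s t st => id2 (kc (push_kob swap2 (kob2 x x)) st \c swap_mor (s :|: t))).

Let simp := (@tens1x D, @tensx1 D, @rten1 D, @lten1 D, rten_id1, lten_id1, @beta1x D, betax1, comp11,
  @lten21 D, @rten21 D, Sigma_id1l, Sigma_id1r, Sigmai_id1l, Sigmai_id1r, rten2_id2, lten2_id2).

Lemma swap_subproof : is_kmor (kob2 x x) (push_kob swap2 (kob2 x x)) swap_data.
Proof.
have mb := beta_mor (p := D) x x.
have [b1 b2] := conj (compf1_mor mb) (comp1f_mor mb).
have w3 u : id2 (id1 u) \h id2 (id1 u) = id2 (id1 u) :> cell D.
  by rewrite (hcomp_id2_mor (id1_mor _) (id1_mor _)) comp11.
have w1 := hcomp_id2_mor mb (id1_mor _); have w2 := hcomp_id2_mor (id1_mor _) mb.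
have w4 := hcomp_id2_mor mb mb.
rewrite betaK b1 b2 in w1 w2 w4.
have fin := (b1, b2, w1, w2, w3, w4, vcomp_id2, @betaK D x x).
split=> /=.
- move=> s; rewrite /pob /swap_mor !preim_swap0 !preim_swap1.
  by case: (i0 \in s) (i1 \in s) => [] [] //=; rewrite /opt ?simp //; exact: id1_mor.
- move=> s t st; rewrite /pc /pob /swap_mor !preim_swap0 !preim_swap1 !inE.
  have := disjoint_in i0 st; have := disjoint_in i1 st.
  case: (i0 \in s) (i0 \in t) (i1 \in s) (i1 \in t) => [] [] [] [] //= _ _;
    rewrite /opt /= ?simp ?fin; exact: id2_cell.
- by move=> *; exact: invertible2_id2.
- by rewrite /swap_mor !inE /= tens1x.
- move=> s d; rewrite /pc /swap_mor !preim_swap0 !preim_swap1 !inE /=.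
  by case: (i0 \in s) (i1 \in s) => [] [] //=; rewrite /opt ?simp ?fin.
- move=> s d; rewrite /pc /swap_mor !preim_swap0 !preim_swap1 !inE /=.
  by case: (i0 \in s) (i1 \in s) => [] [] //=; rewrite /opt ?simp ?fin.
- move=> s t st ts; rewrite /pc /pob /swap_mor !preim_swap0 !preim_swap1 !inE.
  have := disjoint_in i0 st; have := disjoint_in i1 st.
  by case: (i0 \in s) (i0 \in t) (i1 \in s) (i1 \in t) => [] [] [] [] //= _ _;
    rewrite /opt /= ?simp ?fin.
- move=> s t u st st_u tu s_tu; rewrite /pc /pob /swap_mor !preim_swap0 !preim_swap1 !inE.
  have := disjoint_in i0 st; have := disjoint_in i1 st.
  have := disjoint_in i0 tu; have := disjoint_in i1 tu.
  have := disjoint_in i0 st_u; have := disjoint_in i1 st_u; rewrite !inE.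
  by case: (i0 \in s) (i0 \in t) (i0 \in u) (i1 \in s) (i1 \in t) (i1 \in u)
    => [] [] [] [] [] [] //= _ _ _ _ _ _; rewrite /opt /= ?simp ?fin.
Qed.

Definition swap_kmor := KMor swap_subproof.

End Swap.

Section Acting.
Variables (y X : ob D) (g : mor D) (mg : is_mor g y y).

(** [g] acts on the first label alone, so that the second point can be deleted without affecting the
    loop. *)
Definition act_mor (s : {set 'I_2}) : mor D :=
  rten (if i0 \in s then g else id1 e) (opt (i1 \in s) X).

Definition act_data : kdata D 2 :=
  KData act_mor (fun s t st => id2 (kc (kob2 y X) st \c act_mor (s :|: t))).

Let simp := (@tens1x D, @tensx1 D, @rten1 D, @lten1 D, rten_id1, lten_id1, @beta1x D, betax1, comp11,
  @lten21 D, @rten21 D, Sigma_id1l, Sigma_id1r, Sigmai_id1l, Sigmai_id1r, rten2_id2, lten2_id2).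

Lemma act_subproof : is_kmor (kob2 y X) (kob2 y X) act_data.
Proof.
have mb := beta_mor (p := D) y X.
have mr := rten_mor X mg; have ml := lten_mor X mg.
have nat : lten X g \c beta y X = beta y X \c rten g X.
  by case: mg => sg tg; have := beta_natl (p := D) g X; rewrite sg tg => ->.
have w3 u : id2 (id1 u) \h id2 (id1 u) = id2 (id1 u) :> cell D.
  by rewrite (hcomp_id2_mor (id1_mor _) (id1_mor _)) comp11.
have mrb := is_mor_comp mr mb.
have C1 := (compf1_mor mb, compf1_mor mr, compf1_mor ml, compf1_mor mg, compf1_mor mrb).
have C2 := (comp1f_mor mb, comp1f_mor mr, comp1f_mor ml, comp1f_mor mg, comp1f_mor mrb).
have I f x z (m : is_mor f x z) : id2 f \h id2 (id1 x) = id2 f :> cell D.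
  by rewrite (hcomp_id2_mor (id1_mor _) m) (compf1_mor m).
have J f x z (m : is_mor f x z) : id2 (id1 z) \h id2 f = id2 f :> cell D.
  by rewrite (hcomp_id2_mor m (id1_mor _)) (comp1f_mor m).
have H1 := (I _ _ _ mb, I _ _ _ mr, I _ _ _ ml, I _ _ _ mg, I _ _ _ mrb).
have H2 := (J _ _ _ mb, J _ _ _ mr, J _ _ _ ml, J _ _ _ mg, J _ _ _ mrb).
have H3 := (hcomp_id2_mor mr mb, hcomp_id2_mor mb ml).
have mb' := beta_mor (p := D) X y.
have K : beta X y \c (beta y X \c rten g X) = rten g X.
  by rewrite (compAm mr mb mb') betaK (comp1f_mor mr).
have E1 : id2 (beta X y) \h id2 (beta y X \c rten g X) = id2 (rten g X).
  by rewrite (hcomp_id2_mor mrb mb') K.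
have E2 : id2 (beta X y \c lten X g) \h id2 (beta y X) = id2 (rten g X).
  by rewrite (hcomp_id2_mor mb (is_mor_comp ml mb')) -(compAm mb ml mb') nat K.
have fin := (C1, C2, H1, H2, E1, hcomp_id2_mor ml mb', E2, H3, w3, vcomp_id2, nat).
split=> /=.
- move=> s; rewrite /pob /act_mor.
  by case: (i0 \in s) (i1 \in s) => [] [] //=; rewrite /opt ?simp //; exact: id1_mor.
- move=> s t st; rewrite /pc /pob /act_mor !inE.
  have := disjoint_in i0 st; have := disjoint_in i1 st.
  case: (i0 \in s) (i0 \in t) (i1 \in s) (i1 \in t) => [] [] [] [] //= _ _;
    rewrite /opt /= ?simp ?fin; exact: id2_cell.
- by move=> *; exact: invertible2_id2.
- by rewrite /act_mor !inE /= rten1.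
- move=> s d; rewrite /pc /act_mor !inE /=.
  by case: (i0 \in s) (i1 \in s) => [] [] //=; rewrite /opt ?simp ?fin.
- move=> s d; rewrite /pc /act_mor !inE /=.
  by case: (i0 \in s) (i1 \in s) => [] [] //=; rewrite /opt ?simp ?fin.
- move=> s t st ts; rewrite /pc /pob /act_mor !inE.
  have := disjoint_in i0 st; have := disjoint_in i1 st.
  by case: (i0 \in s) (i0 \in t) (i1 \in s) (i1 \in t) => [] [] [] [] //= _ _;
    rewrite /opt /= ?simp ?fin.
- move=> s t u st st_u tu s_tu; rewrite /pc /pob /act_mor !inE.
  have := disjoint_in i0 st; have := disjoint_in i1 st.
  have := disjoint_in i0 tu; have := disjoint_in i1 tu.
  have := disjoint_in i0 st_u; have := disjoint_in i1 st_u; rewrite !inE.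
  by case: (i0 \in s) (i0 \in t) (i0 \in u) (i1 \in s) (i1 \in t) (i1 \in u)
    => [] [] [] [] [] [] //= _ _ _ _ _ _; rewrite /opt /= ?simp ?fin.
Qed.

Definition act_kmor := KMor act_subproof.

End Acting.

End PairObjects.

(** * Faces and pushforwards of the simplices *)

Section SimplexIdentities.
Variable D : permutative.
Local Notation e := (gunit D).

Lemma const_monotone p q (c : 'I_q.+1) : monotone (fun _ : 'I_p.+1 => c).
Proof. by move=> *. Qed.

Definition pt_simplex n (x : kob D n) : knerve D n 0 :=
  nerve_pull (@const_monotone 0 1 ord0) (edge_simplex (idk x)).

Lemma pull_edge0 n (x x' : kob D n) (f : kmor x x') :
  nerve_pull (@const_monotone 0 1 ord0) (edge_simplex f) = pt_simplex x.
Proof. by apply: knerve_eq. Qed.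

Lemma pull_edge1 n (x x' : kob D n) (f : kmor x x') :
  nerve_pull (@const_monotone 0 1 ord_max) (edge_simplex f) = pt_simplex x'.
Proof. by apply: knerve_eq. Qed.

Lemma push_pt m n (phi : 'I_m -> option 'I_n) (x : kob D m) :
  nerve_push phi (pt_simplex x) = pt_simplex (push_kob phi x).
Proof. by apply: knerve_eq. Qed.

Lemma pt_kob1 (x : ob D) : pt_simplex (kob1 x) = vertex x.
Proof. by apply: knerve_eq => //= *; rewrite ?mors_id. Qed.

Lemma endo_idE (x : ob D) :
  endo_simplex (id1_mor x) = nerve_pull (@const_monotone 1 0 ord0) (vertex x).
Proof.
apply: knerve_eq => //= i j *; rewrite ?/endo_if ?mors_id //; do ?case: ifP => //=; rewrite ?mors_id //.
Qed.

Lemma endo_edgeE (x : ob D) f (mf : is_mor f x x) :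
  endo_simplex mf = edge_simplex (kmor1 mf).
Proof.
apply: knerve_eq => //=.
- by move=> [[|i] hi].
- by move=> [[|i] hi].
- by move=> [[|[|i]] hi] [[|[|j]] hj] // ij s; rewrite /= ?mors_id.
- by move=> [[|[|i]] hi] [[|[|j]] hj] // ij s t st; rewrite /= ?mors_id.
- by move=> [[|[|i]] hi] [[|[|j]] hj] [[|[|k]] hk] // ij jk s; rewrite /= ?mors_id.
Qed.

Lemma pull_endo (x : ob D) f (mf : is_mor f x x) (c : 'I_2) :
  nerve_pull (@const_monotone 0 1 c) (endo_simplex mf) = vertex x.
Proof. by apply: knerve_eq => //= *; rewrite ?ltnn. Qed.

Lemma edge_push_eq (n : nat) (x x' : kob D n) (phi : 'I_n -> option 'I_1)
    (f : kmor x x') (y y' : ob D) g (mg : is_mor g y y') :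
  push_kob phi x = kob1 y -> push_kob phi x' = kob1 y' ->
  (forall s, kf f (preim phi s) = mors g s) ->
  (forall (s t : {set 'I_1}) (st : [disjoint s & t]), kg f (preim_disjoint phi st) = id2 (mors g (s :|: t))) ->
  nerve_push phi (edge_simplex f) = edge_simplex (kmor1 mg).
Proof.
move=> E E' fE gE.
have X s : kx x (preim phi s) = obs y s by have := congr1 (@kx _ _ ^~ s) E.
have X' s : kx x' (preim phi s) = obs y' s by have := congr1 (@kx _ _ ^~ s) E'.
have C (s t : {set 'I_1}) (st : [disjoint s & t]) : kc x (preim_disjoint phi st) = id1 (obs y (s :|: t)).
  by have := congr1 (fun z => kc z st) E.
have C' (s t : {set 'I_1}) (st : [disjoint s & t]) : kc x' (preim_disjoint phi st) = id1 (obs y' (s :|: t)).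
  by have := congr1 (fun z => kc z st) E'.
apply: knerve_eq => //=.
- by move=> [[|i] hi] s //=.
- by move=> [[|i] hi] s t st //=.
- by move=> [[|[|i]] hi] [[|[|j]] hj] //= ij s; rewrite ?X ?X'.
- by move=> [[|[|i]] hi] [[|[|j]] hj] //= ij s t st; rewrite ?C ?C'.
- by move=> [[|[|i]] hi] [[|[|j]] hj] [[|[|k]] hk] //= ij jk s; rewrite ?X ?X' ?fE.
Qed.

Lemma setT1_neq0 : ([set: 'I_1]%SET == finset.set0) = false.
Proof. by apply/eqP => /setP/(_ ord0); rewrite !inE. Qed.

Section Kob2.
Variables x1 x2 : ob D.

Let simp := (@tens1x D, @tensx1 D, @rten1 D, @lten1 D, rten_id1, lten_id1, @beta1x D, betax1, comp11).

Lemma fold_kob2 : push_kob fold2 (kob2 x1 x2) = kob1 (tens x1 x2).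
Proof.
apply: kob_eq => [s|s t /= /disjoint_ord1[]->] /=; rewrite /pc /pob !inE /fold2 /fst2 /snd2 /obs /=.
- by case: (set_ord1 s) => ->; rewrite ?inE /opt /= ?simp ?eqxx ?setT1_neq0.
- by case: (set_ord1 t) => ->; rewrite ?inE /opt /= ?simp finset.set0U ?eqxx ?setT1_neq0.
- by case: (set_ord1 s) => ->; rewrite ?inE /opt /= ?simp finset.setU0 ?eqxx ?setT1_neq0.
Qed.

Lemma fst_kob2 : push_kob fst2 (kob2 x1 x2) = kob1 (x1).
Proof.
apply: kob_eq => [s|s t /= /disjoint_ord1[]->] /=; rewrite /pc /pob !inE /fold2 /fst2 /snd2 /obs /=.
- by case: (set_ord1 s) => ->; rewrite ?inE /opt /= ?simp ?eqxx ?setT1_neq0.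
- by case: (set_ord1 t) => ->; rewrite ?inE /opt /= ?simp finset.set0U ?eqxx ?setT1_neq0.
- by case: (set_ord1 s) => ->; rewrite ?inE /opt /= ?simp finset.setU0 ?eqxx ?setT1_neq0.
Qed.

Lemma snd_kob2 : push_kob snd2 (kob2 x1 x2) = kob1 (x2).
Proof.
apply: kob_eq => [s|s t /= /disjoint_ord1[]->] /=; rewrite /pc /pob !inE /fold2 /fst2 /snd2 /obs /=.
- by case: (set_ord1 s) => ->; rewrite ?inE /opt /= ?simp ?eqxx ?setT1_neq0.
- by case: (set_ord1 t) => ->; rewrite ?inE /opt /= ?simp finset.set0U ?eqxx ?setT1_neq0.
- by case: (set_ord1 s) => ->; rewrite ?inE /opt /= ?simp finset.setU0 ?eqxx ?setT1_neq0.
Qed.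

End Kob2.

Lemma swap_swap_kob2 (x : ob D) : push_kob fold2 (push_kob swap2 (kob2 x x)) = kob1 (tens x x)
  /\ push_kob fst2 (push_kob swap2 (kob2 x x)) = kob1 x
  /\ push_kob snd2 (push_kob swap2 (kob2 x x)) = kob1 x.
Proof.
pose simp := (@tens1x D, @tensx1 D, @rten1 D, @lten1 D, rten_id1, lten_id1, @beta1x D, betax1, comp11).
split; [|split]; apply: kob_eq => [s|s t /= /disjoint_ord1[]->] /=; rewrite /pc /pob !inE /fold2 /fst2 /snd2 /= ?inE /obs /=.
all: try (case: (set_ord1 s) => ->; rewrite ?inE /opt /= ?simp ?finset.setU0 ?finset.set0U ?eqxx ?setT1_neq0 //).
all: try (case: (set_ord1 t) => ->; rewrite ?inE /opt /= ?simp ?finset.setU0 ?finset.set0U ?eqxx ?setT1_neq0 //).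
Qed.

(** With either point deleted the label is constant. Hence the exchange has no effect on points that
    are kept apart, and [beta] is seen only where they coincide. *)
Lemma push_swap_edge (x : ob D) :
  [/\ nerve_push fold2 (edge_simplex (swap_kmor x)) = endo_simplex (beta_mor x x),
      nerve_push fst2 (edge_simplex (swap_kmor x)) = endo_simplex (id1_mor x)
    & nerve_push snd2 (edge_simplex (swap_kmor x)) = endo_simplex (id1_mor x)].
Proof.
have [h1 [h2 h3]] := swap_swap_kob2 x.
pose simp := (@tens1x D, @tensx1 D, @rten1 D, @lten1 D, rten_id1, lten_id1, @beta1x D, betax1, comp11).
have mb := beta_mor (p := D) x x.
rewrite !endo_edgeE; split; (apply: edge_push_eq; rewrite ?fold_kob2 ?fst_kob2 ?snd_kob2 //).
all: try by move=> s; rewrite /= /mors /swap_mor /pc ?inE /fold2 /fst2 /snd2 /= ?inE /=;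
  case: (set_ord1 s) => ->; rewrite ?inE /opt /= ?simp ?eqxx ?setT1_neq0 ?(comp1f_mor mb).
all: move=> s t /= /disjoint_ord1[]->; rewrite /= /mors /swap_mor /pc ?inE /fold2 /fst2 /snd2 /= ?inE /=.
all: try by case: (set_ord1 t) => ->; rewrite ?inE /opt /= ?simp ?finset.set0U ?eqxx ?setT1_neq0 ?(comp1f_mor mb).
all: by case: (set_ord1 s) => ->; rewrite ?inE /opt /= ?simp ?finset.setU0 ?eqxx ?setT1_neq0 ?(comp1f_mor mb).
Qed.

Lemma push_act_edge (y X : ob D) g (mg : is_mor g y y) :
  [/\ nerve_push fold2 (edge_simplex (act_kmor X mg)) = endo_simplex (rten_mor X mg),
      nerve_push fst2 (edge_simplex (act_kmor X mg)) = endo_simplex mg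
    & nerve_push snd2 (edge_simplex (act_kmor X mg)) = endo_simplex (id1_mor X)].
Proof.
pose simp := (@tens1x D, @tensx1 D, @rten1 D, @lten1 D, rten_id1, lten_id1, @beta1x D, betax1, comp11).
have mr := rten_mor X mg.
rewrite !endo_edgeE; split; (apply: edge_push_eq; rewrite ?fold_kob2 ?fst_kob2 ?snd_kob2 //).
all: try by move=> s; rewrite /= /mors /act_mor /pc ?inE /fold2 /fst2 /snd2 /= ?inE /=;
  case: (set_ord1 s) => ->; rewrite ?inE /opt /= ?simp ?eqxx ?setT1_neq0 ?(comp1f_mor mr) ?(comp1f_mor mg).
all: move=> s t /= /disjoint_ord1[]->; rewrite /= /mors /act_mor /pc ?inE /fold2 /fst2 /snd2 /= ?inE /=.
all: try by case: (set_ord1 t) => ->; rewrite ?inE /opt /= ?simp ?finset.set0U ?eqxx ?setT1_neq0 ?(comp1f_mor mr) ?(comp1f_mor mg).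
all: by case: (set_ord1 s) => ->; rewrite ?inE /opt /= ?simp ?finset.setU0 ?eqxx ?setT1_neq0 ?(comp1f_mor mr) ?(comp1f_mor mg).
Qed.

Section TriangleFaces.
Variables (x y z : ob D) (f g h : mor D) (a : cell D).
Hypotheses (mf : is_mor f x y) (mg : is_mor g y z) (mh : is_mor h x z)
  (ca : is_cell a (g \c f) h).

Definition face01 (i : 'I_2) : 'I_3 := inord i.
Definition face12 (i : 'I_2) : 'I_3 := inord i.+1.
Definition face02 (i : 'I_2) : 'I_3 := inord i.*2.

Lemma face01_monotone : monotone face01.
Proof. by move=> [[|[|i]] hi] [[|[|j]] hj] //= _; rewrite !inordK. Qed.
Lemma face12_monotone : monotone face12.
Proof. by move=> [[|[|i]] hi] [[|[|j]] hj] //= _; rewrite !inordK. Qed.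
Lemma face02_monotone : monotone face02.
Proof. by move=> [[|[|i]] hi] [[|[|j]] hj] //= _; rewrite !inordK. Qed.

Lemma tri_faces :
  [/\ nerve_pull face01_monotone (tri_simplex mf mg mh ca) = edge_simplex (kmor1 mf),
      nerve_pull face12_monotone (tri_simplex mf mg mh ca) = edge_simplex (kmor1 mg)
    & nerve_pull face02_monotone (tri_simplex mf mg mh ca) = edge_simplex (kmor1 mh)].
Proof.
split; apply: knerve_eq => //=.
all: try by move=> [[|[|i]] hi] s; rewrite //= inordK.
all: try by move=> [[|[|i]] hi] s t st; rewrite //= inordK.
all: try by move=> [[|[|i]] hi] [[|[|j]] hj] //= ij s; rewrite /tri_mor !inordK //= mors_id.
all: try by move=> [[|[|i]] hi] [[|[|j]] hj] //= ij s t st; rewrite /tri_mor !inordK //= mors_id.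
all: by move=> [[|[|i]] hi] [[|[|j]] hj] [[|[|k]] hk] //= ij jk s; rewrite !inordK //= cells_id2 ?mors_id.
Qed.

End TriangleFaces.

End SimplexIdentities.

(** * Points of the K-theory spectrum *)

Section Points.
Variables (R : realType) (D : permutative).
Local Notation e := (gunit D).
Local Open Scope classical_set_scope.

Lemma kpi_eq n (a b : kraw R D n) : kstep a b -> kpi a = kpi b.
Proof.
move=> ab; apply/(@eqmodP _ (krel_equiv R D n))/asboolP.
exact: Relation_Operators.rst_step.
Qed.

Definition row2 (T : Type) (A B : T) : 'rV[T]_2 := \row_i (if i == ord0 then A else B).

Variable n : nat.
Implicit Types A B : sphere R n.

(** Points of the spectrum viewed as labelled configurations: [P1] has one point [A] and [P2] two
    points [A] and [B] of the sphere, and the label is the point [d] of the realized simplex [z]. *)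
Definition P1 q (z : knerve D 1 q) (d : stdsimplex R q) A : kspace R D n :=
  kpi (kpoint z d (const_mx A)).
Definition P2 q (z : knerve D 2 q) (d : stdsimplex R q) A B : kspace R D n :=
  kpi (kpoint z d (row2 A B)).

Lemma P1_fold q (z : knerve D 2 q) d A : P1 (nerve_push fold2 z) d A = P2 z d A A.
Proof.
rewrite /P1 /P2 (kpi_eq (kstep_gamma _ _ _ _)); congr (kpi (kpoint _ _ _)).
by apply/rowP => i; rewrite !mxE /= mxE; case: ifP.
Qed.

Lemma P1_fst q (z : knerve D 2 q) d A : P1 (nerve_push fst2 z) d A = P2 z d A infty.
Proof.
rewrite /P1 /P2 (kpi_eq (kstep_gamma _ _ _ _)); congr (kpi (kpoint _ _ _)).
by apply/rowP => i; rewrite !mxE /fst2; case: ifP; rewrite // mxE.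
Qed.

Lemma P1_snd q (z : knerve D 2 q) d A : P1 (nerve_push snd2 z) d A = P2 z d infty A.
Proof.
rewrite /P1 /P2 (kpi_eq (kstep_gamma _ _ _ _)); congr (kpi (kpoint _ _ _)).
by apply/rowP => i; rewrite !mxE /snd2; case: ifP; rewrite // mxE.
Qed.

Lemma P2_swap q (z : knerve D 2 q) d A B : P2 (nerve_push swap2 z) d A B = P2 z d B A.
Proof.
rewrite /P2 (kpi_eq (kstep_gamma _ _ _ _)); congr (kpi (kpoint _ _ _)).
by apply/rowP => i; rewrite !mxE /swap2; case: ifP; rewrite // mxE.
Qed.

Lemma P1_pull p q (theta : 'I_p.+1 -> 'I_q.+1) (h : monotone theta) (z : knerve D 1 q) d A :
  P1 (nerve_pull h z) d A = P1 z (simplex_push theta d) A.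
Proof. exact: kpi_eq (kstep_simplex _ _ _ _). Qed.

Lemma P2_pull p q (theta : 'I_p.+1 -> 'I_q.+1) (h : monotone theta) (z : knerve D 2 q) d A B :
  P2 (nerve_pull h z) d A B = P2 z (simplex_push theta d) A B.
Proof. exact: kpi_eq (kstep_simplex _ _ _ _). Qed.

Lemma simplex_eq q (d d' : stdsimplex R q) : set_val d = set_val d' -> d = d'.
Proof. by move=> h; apply: val_inj. Qed.

Lemma simplex0_eq (d d' : stdsimplex R 0) : d = d'.
Proof.
suff h (c : stdsimplex R 0) : set_val c = const_mx 1 by apply: simplex_eq; rewrite !h.
have [_ h] := set_valP c; apply/rowP => i; rewrite [RHS]mxE (ord1 i).
by rewrite big_ord1 in h.
Qed.

Lemma edge_pt_val (t : R) :
  set_val (edge_pt t) = \row_(j < 2) (if j == 0 then 1 - clamp t else clamp t).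
Proof. by []. Qed.

Lemma clamp_itv (t : R) : 0 <= clamp t <= 1.
Proof. by rewrite /clamp le_max lexx /= ge_max ler01 ge_min lexx. Qed.

Lemma clamp_le0 (t : R) : t <= 0 -> clamp t = 0.
Proof. by move=> t0; rewrite /clamp; apply/max_idPl; rewrite ge_min t0 orbT. Qed.

Lemma clamp_ge1 (t : R) : 1 <= t -> clamp t = 1.
Proof. by move=> t1; rewrite /clamp (min_idPl t1); apply/max_idPr. Qed.

Lemma clamp_id (t : R) : 0 <= t <= 1 -> clamp t = t.
Proof.
by case/andP=> t0 t1; rewrite /clamp (min_idPr t1); apply/max_idPr.
Qed.

Lemma edge_pt_clamp (t : R) : edge_pt (clamp t) = edge_pt t.
Proof. by apply: simplex_eq; rewrite !edge_pt_val (clamp_id (clamp_itv t)). Qed.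

Lemma simplex_push_const p q (c : 'I_q.+1) (d : stdsimplex R p) :
  set_val (simplex_push (fun _ => c) d) = \row_j (j == c)%:R.
Proof.
have [_ h] := set_valP d; apply/rowP => j; rewrite !mxE.
by case: (eqVneq j c) => _; [rewrite -[RHS]h | rewrite big_pred0].
Qed.

Lemma edge_pt_le0 (t : R) (d : stdsimplex R 0) : t <= 0 -> simplex_push (fun _ => ord0) d = edge_pt t :> stdsimplex R 1.
Proof.
move=> t0; apply: simplex_eq; rewrite simplex_push_const edge_pt_val clamp_le0 //.
by apply/rowP => j; rewrite !mxE subr0; case: eqP.
Qed.

Lemma edge_pt_ge1 (t : R) (d : stdsimplex R 0) : 1 <= t -> simplex_push (fun _ => ord_max) d = edge_pt t :> stdsimplex R 1.
Proof.
move=> t0; apply: simplex_eq; rewrite simplex_push_const edge_pt_val clamp_ge1 //.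
by apply/rowP => -[[|[|j]] hj]; rewrite !mxE ?subrr.
Qed.

Lemma knerve0_eq q (z z' : knerve D 0 q) : z = z'.
Proof.
have set0E (s : {set 'I_0}) : s = finset.set0 by apply/setP => -[].
apply: knerve_eq => [i s|i s t st|i j ij s|i j ij s t st|i j k ij jk s].
- by rewrite (set0E s) !kx0.
- move: st; rewrite (set0E s) => st; rewrite !kc0s (set0E t) !kx0 //.
- by rewrite (set0E s) (kf0 (kmorP (sF z ij))) (kf0 (kmorP (sF z' ij))).
- move: st; rewrite (set0E s) => st; rewrite (kg0s (kmorP (sF z ij))) (kg0s (kmorP (sF z' ij))).
  by rewrite (set0E t) (kf0 (kmorP (sF z ij))) (kf0 (kmorP (sF z' ij))).
have [_ h _] := sT_cell z ij jk (leq_trans ij jk).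
have [_ h' _] := sT_cell z' ij jk (leq_trans ij jk).
by rewrite (set0E s) h h'.
Qed.

(** Coordinates that are all at infinity come from the map to 0_+ which forgets every index. Over
    0_+ the nerve has one simplex in each dimension, a degeneracy of the vertex. *)
Lemma kpoint_infty k q (z : knerve D k q) d (s : 'rV[sphere R n]_k) : (forall i, s 0 i = infty) ->
  kpi (kpoint z d s) = kbase R D n.
Proof.
have E k' (phi := fun _ : 'I_k' => None : option 'I_0) q' (z' : knerve D k' q') d' (s' : 'rV[sphere R n]_k') :
    (forall i, s' 0 i = infty) ->
    kpi (kpoint z' d' s') = kpi (kpoint (nerve_push phi z') d' (const_mx infty)).
  move=> h; rewrite (kpi_eq (kstep_gamma _ _ _ _)); congr (kpi (kpoint _ _ _)).
  by apply/rowP => i; rewrite mxE h.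
move=> h; rewrite (E _ _ z) // /kbase [RHS]E => [|i]; last by rewrite mxE.
rewrite (knerve0_eq (nerve_push _ z)
  (nerve_pull (@const_monotone q 0 ord0) (nerve_push (fun _ => None) (vertex e)))).
rewrite (kpi_eq (kstep_simplex _ _ _ _)); congr (kpi (kpoint _ _ _)).
exact: simplex0_eq.
Qed.

Lemma P1_infty q (z : knerve D 1 q) d : P1 z d infty = kbase R D n.
Proof. by apply: kpoint_infty => i; rewrite mxE. Qed.

Lemma P2_infty q (z : knerve D 2 q) d : P2 z d infty infty = kbase R D n.
Proof. by apply: kpoint_infty => i; rewrite mxE; case: ifP. Qed.

(** [vertex e] is the pushforward of the vertex over 0_+ along the inclusion of no point into one
    point, so a point labelled [e] can be deleted. *)
Lemma P1_unit d A : P1 (vertex e) d A = kbase R D n.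
Proof.
pose phi (i : 'I_0) : option 'I_1 := None.
pose z : knerve D 0 0 := nerve_push (fun _ => None) (vertex e).
suff -> : vertex e = nerve_push phi z.
  rewrite /P1 (kpi_eq (kstep_gamma _ _ _ _)); apply: kpoint_infty.
  by case.
have E s : obs e s = e by rewrite /obs; case: ifP.
have E0 (s : {set 'I_1}) : preim (fun _ : 'I_1 => None : option 'I_0) (preim phi s) = finset.set0.
  by apply/setP => i; rewrite !inE.
apply: knerve_eq => //= *; rewrite ?E0 ?E ?obs0 ?mors0 //.
all: rewrite ?mors_id ?E //.
Qed.

Lemma vertexE (x : ob D) f (mf : is_mor f x x) (t : R) d A :
  (t <= 0) || (1 <= t) -> P1 (endo_simplex mf) (edge_pt t) A = P1 (vertex x) d A.
Proof.
case/orP=> ht.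
  by rewrite -(edge_pt_le0 d ht) -(P1_pull (@const_monotone 0 1 ord0)) pull_endo.
by rewrite -(edge_pt_ge1 d ht) -(P1_pull (@const_monotone 0 1 ord_max)) pull_endo.
Qed.

Lemma P1_endo_id (x : ob D) t d A : P1 (endo_simplex (id1_mor x)) t A = P1 (vertex x) d A.
Proof.
by rewrite endo_idE P1_pull; congr (P1 _ _ _); exact: simplex0_eq.
Qed.

Lemma P1_edge0 (x y : ob D) f (mf : is_mor f x y) (t : R) d A :
  t <= 0 -> P1 (edge_simplex (kmor1 mf)) (edge_pt t) A = P1 (vertex x) d A.
Proof.
by move=> ht; rewrite -(edge_pt_le0 d ht) -(P1_pull (@const_monotone 0 1 ord0)) pull_edge0 pt_kob1.
Qed.

Lemma P1_edge1 (x y : ob D) f (mf : is_mor f x y) (t : R) d A :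
  1 <= t -> P1 (edge_simplex (kmor1 mf)) (edge_pt t) A = P1 (vertex y) d A.
Proof.
by move=> ht; rewrite -(edge_pt_ge1 d ht) -(P1_pull (@const_monotone 0 1 ord_max)) pull_edge1 pt_kob1.
Qed.

Section PairPoints.
Variable x y : ob D.

Definition pairv := pt_simplex (kob2 x y).

Lemma pairv_fold d A : P2 pairv d A A = P1 (vertex (tens x y)) d A.
Proof. by rewrite -P1_fold push_pt fold_kob2 pt_kob1. Qed.
Lemma pairv_fst d A : P2 pairv d A infty = P1 (vertex x) d A.
Proof. by rewrite -P1_fst push_pt fst_kob2 pt_kob1. Qed.
Lemma pairv_snd d A : P2 pairv d infty A = P1 (vertex y) d A.
Proof. by rewrite -P1_snd push_pt snd_kob2 pt_kob1. Qed.

End PairPoints.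

Section SwapPoints.
Variable x : ob D.
Local Notation w := (edge_simplex (swap_kmor x)).

Lemma swap0 (t : R) d A B : t <= 0 -> P2 w (edge_pt t) A B = P2 (pairv x x) d A B.
Proof.
by move=> ht; rewrite -(edge_pt_le0 d ht) -(P2_pull (@const_monotone 0 1 ord0)) pull_edge0.
Qed.
Lemma swap1 (t : R) d A B : 1 <= t -> P2 w (edge_pt t) A B = P2 (pairv x x) d B A.
Proof.
move=> ht; rewrite -(edge_pt_ge1 d ht) -(P2_pull (@const_monotone 0 1 ord_max)) pull_edge1.
by rewrite -push_pt P2_swap.
Qed.
Lemma swap_fold t A : P2 w t A A = P1 (endo_simplex (beta_mor x x)) t A.
Proof. by rewrite -P1_fold; have [-> _ _] := push_swap_edge x. Qed.
Lemma swap_fst t d A : P2 w t A infty = P1 (vertex x) d A.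
Proof. by rewrite -P1_fst; have [_ -> _] := push_swap_edge x; exact: P1_endo_id. Qed.
Lemma swap_snd t d A : P2 w t infty A = P1 (vertex x) d A.
Proof. by rewrite -P1_snd; have [_ _ ->] := push_swap_edge x; exact: P1_endo_id. Qed.

End SwapPoints.

Section ActPoints.
Variables (y X : ob D) (g : mor D) (mg : is_mor g y y).
Local Notation w := (edge_simplex (act_kmor X mg)).

Lemma act_end (t : R) d A B : (t <= 0) || (1 <= t) -> P2 w (edge_pt t) A B = P2 (pairv y X) d A B.
Proof.
case/orP=> ht.
  by rewrite -(edge_pt_le0 d ht) -(P2_pull (@const_monotone 0 1 ord0)) pull_edge0.
by rewrite -(edge_pt_ge1 d ht) -(P2_pull (@const_monotone 0 1 ord_max)) pull_edge1.
Qed.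
Lemma act_fold t A : P2 w t A A = P1 (endo_simplex (rten_mor X mg)) t A.
Proof. by rewrite -P1_fold; have [-> _ _] := push_act_edge X mg. Qed.
Lemma act_fst t A : P2 w t A infty = P1 (endo_simplex mg) t A.
Proof. by rewrite -P1_fst; have [_ -> _] := push_act_edge X mg. Qed.
Lemma act_snd t d A : P2 w t infty A = P1 (vertex X) d A.
Proof. by rewrite -P1_snd; have [_ _ ->] := push_act_edge X mg; exact: P1_endo_id. Qed.

End ActPoints.

(* The point with barycentric coordinates (1 - b, b - a, a), for 0 <= a <= b <= 1. *)
Definition tri_coord (a b : R) : 'rV[R]_3 :=
  \row_(i < 3) (match val i with 0 => 1 - b | 1 => b - a | _ => a end).

Lemma tri_pt_subproof (a b : R) :
  tri_coord (Num.min (clamp a) (clamp b)) (clamp b) \in stdsimplex R 2.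
Proof.
have /andP[b0 b1] := clamp_itv b; have /andP[a0 a1] := clamp_itv a.
apply/mem_set; split=> [i|].
  rewrite mxE; case: (val i) => [|[|j]]; rewrite ?subr_ge0 //.
    by rewrite ge_min lexx orbT.
  by rewrite le_min a0 b0.
by rewrite !big_ord_recr big_ord0 /= !mxE /= add0r addrA subrK subrK.
Qed.

(** [a] is cut off at [b] so that the coordinates are nonnegative for all real arguments. *)
Definition tri_pt (a b : R) : stdsimplex R 2 := simplex_pt (tri_pt_subproof a b).

Lemma tri_pt_val (a b : R) : 0 <= a -> a <= b -> b <= 1 -> set_val (tri_pt a b) = tri_coord a b.
Proof.
move=> a0 ab b1; rewrite [LHS](_ : _ = tri_coord (Num.min (clamp a) (clamp b)) (clamp b)) //.
rewrite !clamp_id ?a0 ?b1 ?(le_trans a0 ab) ?(le_trans ab b1) //.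
by rewrite (min_idPl ab).
Qed.

Lemma simplex_push2 (theta : 'I_2 -> 'I_3) (b : R) j : 0 <= b <= 1 ->
  set_val (simplex_push theta (edge_pt b)) 0 j
  = (if theta ord0 == j then 1 - b else 0) + (if theta ord_max == j then b else 0).
Proof.
move=> b01; rewrite mxE big_mkcond !big_ord_recr big_ord0 /= add0r edge_pt_val !mxE /= clamp_id //.
by congr (_ + _); congr (if theta _ == _ then _ else _); exact: val_inj.
Qed.

Lemma tri_pt01 (b : R) : 0 <= b <= 1 -> tri_pt 0 b = simplex_push face01 (edge_pt b).
Proof.
move=> b01; case/andP: (b01) => b0 b1; apply: simplex_eq; rewrite tri_pt_val //.
apply/rowP => j; rewrite simplex_push2 // mxE.
rewrite -!val_eqE /= !inordK //.
by case: j => [[|[|[|j]]] hj] //=; rewrite ?subr0 ?addr0 ?add0r.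
Qed.

Lemma tri_pt12 (a : R) : 0 <= a <= 1 -> tri_pt a 1 = simplex_push face12 (edge_pt a).
Proof.
move=> a01; case/andP: (a01) => a0 a1; apply: simplex_eq; rewrite tri_pt_val //.
apply/rowP => j; rewrite simplex_push2 // mxE.
rewrite -!val_eqE /= !inordK //.
by case: j => [[|[|[|j]]] hj] //=; rewrite ?subrr ?subr0 ?addr0 ?add0r.
Qed.

Lemma tri_pt02 (a : R) : 0 <= a <= 1 -> tri_pt a a = simplex_push face02 (edge_pt a).
Proof.
move=> a01; case/andP: (a01) => a0 a1; apply: simplex_eq; rewrite tri_pt_val //.
apply/rowP => j; rewrite simplex_push2 // mxE.
rewrite -!val_eqE /= !inordK //.
by case: j => [[|[|[|j]]] hj] //=; rewrite ?subrr ?subr0 ?addr0 ?add0r.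
Qed.

Section TrianglePoints.
Variables (x y z : ob D) (f g h : mor D) (a : cell D).
Hypotheses (mf : is_mor f x y) (mg : is_mor g y z) (mh : is_mor h x z)
  (ca : is_cell a (g \c f) h).
Local Notation tri := (tri_simplex mf mg mh ca).

Lemma P1_tri01 (b : R) A : 0 <= b <= 1 ->
  P1 tri (tri_pt 0 b) A = P1 (edge_simplex (kmor1 mf)) (edge_pt b) A.
Proof.
by move=> b01; rewrite tri_pt01 // -(P1_pull face01_monotone); have [-> _ _] := tri_faces mf mg mh ca.
Qed.

Lemma P1_tri12 (b : R) A : 0 <= b <= 1 ->
  P1 tri (tri_pt b 1) A = P1 (edge_simplex (kmor1 mg)) (edge_pt b) A.
Proof.
by move=> b01; rewrite tri_pt12 // -(P1_pull face12_monotone); have [_ -> _] := tri_faces mf mg mh ca.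
Qed.

Lemma P1_tri02 (b : R) A : 0 <= b <= 1 ->
  P1 tri (tri_pt b b) A = P1 (edge_simplex (kmor1 mh)) (edge_pt b) A.
Proof.
by move=> b01; rewrite tri_pt02 // -(P1_pull face02_monotone); have [_ _ ->] := tri_faces mf mg mh ca.
Qed.

End TrianglePoints.

End Points.

(** * Pointwise continuity, spheres *)

Local Open Scope classical_set_scope.

Section ContAt.
Variable T : topologicalType.

(** Continuity is handled point by point, because many formulas below are well behaved only for a
    parameter in [0, 1] or on one side of [cX v = 0]. *)
Definition cont_at (U : topologicalType) (f : T -> U) (p : T) : Prop := f x @[x --> p] --> f p.

Lemma cont_at_near (U : topologicalType) (f g : T -> U) p :
  cont_at f p -> (\forall x \near p, f x = g x) -> cont_at g p.
Proof.
move=> cf fg; rewrite /cont_at -(nbhs_singleton fg).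
by apply: cvg_trans cf; exact: near_eq_cvg.
Qed.

Lemma contP (U : topologicalType) (f : T -> U) : (forall p, cont_at f p) -> continuous f.
Proof. by []. Qed.

Lemma cont_eq (U : topologicalType) (f g : T -> U) p :
  (forall x, f x = g x) -> cont_at g p -> cont_at f p.
Proof. by move=> /funext ->. Qed.

Lemma cont_at_comp (U V : topologicalType) (f : T -> U) (g : U -> V) p :
  cont_at f p -> {for f p, continuous g} -> cont_at (fun x => g (f x)) p.
Proof. by move=> cf cg; apply: cvg_comp cf cg. Qed.

Lemma cont_app (U V : topologicalType) (g : U -> V) (f : T -> U) p :
  continuous g -> cont_at f p -> cont_at (fun x => g (f x)) p.
Proof. by move=> cg cf; apply: cvg_comp cf _; exact: cg. Qed.

Lemma cont_at_comp2 (U V W : topologicalType) (f : T -> U) (g : T -> V) (h : U * V -> W) p :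
  cont_at f p -> cont_at g p -> {for (f p, g p), continuous h} ->
  cont_at (fun x => h (f x, g x)) p.
Proof.
move=> cf cg ch; apply: (@cvg_comp _ _ _ (fun x => (f x, g x)) h _ (nbhs (f p, g p))) => //.
exact: cvg_pair.
Qed.

Variable R : realType.
Implicit Types f g : T -> R.

Lemma cont_cst (U : topologicalType) (c : U) p : cont_at (fun _ => c) p.
Proof. exact: cvg_cst. Qed.
Lemma cont_add f g p : cont_at f p -> cont_at g p -> cont_at (fun x => f x + g x) p.
Proof. exact: cvgD. Qed.
Lemma cont_opp f p : cont_at f p -> cont_at (fun x => - f x) p.
Proof. exact: cvgN. Qed.
Lemma cont_mul f g p : cont_at f p -> cont_at g p -> cont_at (fun x => f x * g x) p.
Proof. exact: cvgM. Qed.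
Lemma cont_exp f n p : cont_at f p -> cont_at (fun x => f x ^+ n) p.
Proof. by move=> cf; elim: n => [|n IH]; [exact: cont_cst | under eq_fun do rewrite exprS; exact: cont_mul]. Qed.
Lemma cont_inv f p : f p != 0 -> cont_at f p -> cont_at (fun x => (f x)^-1) p.
Proof. by move=> f0 cf; apply: cvgV. Qed.
Lemma cont_max f g p : cont_at f p -> cont_at g p -> cont_at (fun x => Num.max (f x) (g x)) p.
Proof. by move=> cf cg; exact: continuous_max. Qed.
Lemma cont_min f g p : cont_at f p -> cont_at g p -> cont_at (fun x => Num.min (f x) (g x)) p.
Proof. by move=> cf cg; exact: continuous_min. Qed.
Lemma cont_sqrt f p : cont_at f p -> cont_at (fun x => Num.sqrt (f x)) p.
Proof. by move=> cf; apply: cont_at_comp cf _; exact: sqrt_continuous. Qed.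
Lemma cont_clamp f p : cont_at f p -> cont_at (fun x => clamp (f x)) p.
Proof. move=> cf; apply: (@cont_max (fun _ => 0)); first exact: cont_cst.
by apply: (@cont_min (fun _ => 1)) => //; exact: cont_cst. Qed.

Lemma near_lt f p (c : R) : cont_at f p -> f p < c -> \forall x \near p, f x < c.
Proof. by move=> cf fc; apply: (cf [set y | y < c]); apply: open_nbhs_nbhs; split=> //; exact: open_lt. Qed.
Lemma near_gt f p (c : R) : cont_at f p -> c < f p -> \forall x \near p, c < f x.
Proof. by move=> cf fc; apply: (cf [set y | c < y]); apply: open_nbhs_nbhs; split=> //; exact: open_gt. Qed.

(** Where [phi] vanishes both maps converge to the same value, so a neighbourhood of it eventually
    contains both; elsewhere one of the two maps is used locally. *)
Lemma cont_paste (U : topologicalType) (phi : T -> R) (f g : T -> U) p : cont_at phi p ->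
  (phi p <= 0 -> cont_at f p) -> (0 <= phi p -> cont_at g p) ->
  (phi p = 0 -> f p = g p) ->
  cont_at (fun x => if phi x <= 0 then f x else g x) p.
Proof.
move=> cphi cf cg fg; have [lt0|gt0|eq0] := ltgtP (phi p) 0.
- apply: (cont_at_near (cf (ltW lt0))); near=> x; rewrite ifT //.
  by apply: ltW; near: x; exact: near_lt.
- apply: (cont_at_near (cg (ltW gt0))); near=> x; rewrite leNgt ifF //.
  by apply/negbF; near: x; exact: near_gt.
have {}cf : cont_at f p by apply: cf; rewrite eq0.
have {}cg : cont_at g p by apply: cg; rewrite eq0.
move=> A; rewrite eq0 lexx => nA.
have nA' : nbhs (g p) A by rewrite -fg.
have cfA : \forall x \near p, A (f x) := cf _ nA.
have cgA : \forall x \near p, A (g x) := cg _ nA'.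
suff : \forall x \near p, A (if phi x <= 0 then f x else g x) by [].
by near=> x; case: ifP => _; [near: x | near: x].
Unshelve. all: end_near. Qed.

Lemma cont_mx (U : topologicalType) m n (f : T -> 'M[U]_(m, n)) p :
  (forall i j, cont_at (fun x => f x i j) p) -> cont_at f p.
Proof.
move=> cf A [P MP sPA]; apply: filterS (_ : \forall x \near p, forall i j, P i j (f x i j)).
  by move=> x; exact: sPA.
by do 2![apply: filter_forall => ?]; exact/cf/MP.
Qed.

(** The tube lemma, in its near-covering form. *)
Lemma tube (K U : topologicalType) (A : set K) (F : T * K -> U) (V : set U) p :
  compact A -> open V -> (forall k, A k -> {for (p, k), continuous F}) ->
  (forall k, A k -> V (F (p, k))) -> \forall x \near p, forall k, A k -> V (F (x, k)).
Proof.
move=> /compact_near_coveringP cA oV cF FV.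
apply: (cA _ (nbhs p) (fun x k => V (F (x, k)))) => k Ak.
have /(_ V) := cF k Ak; rewrite /nbhs /= => h.
have [|[B1 B2] [/= n1 n2] sB] := h; first by apply: open_nbhs_nbhs; split=> //; exact: FV.
by exists (B2, B1) => // -[k' x'] /= [? ?]; exact: sB.
Qed.

End ContAt.

Arguments cont_at : simpl never.

Ltac cont := repeat first
  [ refine (@cont_cst _ _ _ _) | refine (@cont_add _ _ _ _ _ _ _) | refine (@cont_opp _ _ _ _ _)
  | refine (@cont_mul _ _ _ _ _ _ _) | refine (@cont_exp _ _ _ _ _ _)
  | refine (@cont_max _ _ _ _ _ _ _) | refine (@cont_min _ _ _ _ _ _ _)
  | refine (@cont_clamp _ _ _ _ _) | refine (@cont_sqrt _ _ _ _ _) ].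

(** * Neighbourhoods of infinity and quotients with values in a sphere *)

Section SphereTopology.
Variable R : realType.

Definition nsq m (v : 'rV[R]_m) : R := \sum_i v 0 i ^+ 2.

Lemma nsq_ge0 m (v : 'rV[R]_m) : 0 <= nsq v.
Proof. by apply: sumr_ge0 => i _; exact: sqr_ge0. Qed.

Lemma nsq_coord m (v : 'rV[R]_m) i : v 0 i ^+ 2 <= nsq v.
Proof.
by rewrite /nsq (bigD1 i) //= lerDl; apply: sumr_ge0 => j _; exact: sqr_ge0.
Qed.

Lemma nsqZ m a (v : 'rV[R]_m) : nsq (a *: v) = a ^+ 2 * nsq v.
Proof. by rewrite /nsq mulr_sumr; apply: eq_bigr => i _; rewrite mxE exprMn. Qed.

Lemma cont_nsq m (T : topologicalType) (f : T -> 'rV[R]_m) p :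
  (forall i, cont_at (fun x => f x 0 i) p) -> cont_at (fun x => nsq (f x)) p.
Proof.
move=> cf; rewrite /cont_at /nsq; apply: cvg_big => [|i _]; last exact: cont_exp.
exact: add_continuous.
Qed.

Lemma mx_norm_coord m (v : 'rV[R]_m) i : `|v 0 i| <= `|v|.
Proof.
rewrite [leRHS]/Num.norm /= mx_normrE; apply/bigmax_geP; right => /=.
by exists (0, i).
Qed.

Lemma nsq_continuous m : continuous (@nsq m).
Proof. by move=> v; apply: cont_nsq => i; exact: coord_continuous. Qed.

(** A compact set is bounded, so its complement contains the outside of a ball; conversely closed
    balls are compact. *)
Lemma nbhs_inftyP m (U : set (sphere R m)) :
  nbhs (infty : sphere R m) U <-> U infty /\ exists B, forall v, B < nsq v -> U (Some v).
Proof.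
split=> [nU|[U0 [B UB]]].
  split; first exact: nbhs_singleton nU.
  case: nU => C [cC _] CU.
  have [M [_ HM]] := compact_bounded cC.
  exists (m%:R * (`|M| + 1) ^+ 2) => v hv; apply: CU; left; exists v => // Cv.
  have := HM (`|M| + 1) _ v Cv; rewrite ltr_pwDr ?ler_norm // => /(_ isT) vM.
  move: hv; rewrite ltNge => /negP; apply.
  apply: (@le_trans _ _ (\sum_(i < m) (`|M| + 1) ^+ 2)); last first.
    by rewrite sumr_const card_ord mulr_natl.
  apply: ler_sum => i _; rewrite -[leLHS]ger0_norm ?sqr_ge0 // normrX.
  rewrite ler_sqr ?nnegrE ?addr_ge0 //; apply: le_trans vM.
  exact: mx_norm_coord.
exists [set v | nsq v <= B].
  have cB : closed [set v : 'rV[R]_m | nsq v <= B].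
    apply: (@closed_comp _ _ (@nsq m) [set y | y <= B]); last exact: closed_le.
    by move=> v _; exact: nsq_continuous.
  split=> //; apply: bounded_closed_compact cB.
  exists (Num.max 0 B + 1); split; first by rewrite num_real.
  move=> M BM v /= vB.
  have h1 : 0 <= Num.max 0 B by rewrite le_max lexx.
  have h2 : B <= Num.max 0 B by rewrite le_max lexx orbT.
  have [M0 M1 MB] : [/\ 0 <= M, 1 <= M & B <= M] by split; lra.
  rewrite [leLHS]/Num.norm /= mx_normrE; apply/bigmax_leP; split=> //= -[i j] _ /=.
  rewrite (ord1 i) -ler_sqr ?nnegrE // real_normK ?num_real //.
  apply: (le_trans (nsq_coord v j)); apply: (le_trans vB); apply: (le_trans MB).
  by rewrite expr2 ler_peMr.
move=> [v|]; first by case=> [[w wB [<-]]|]//; apply: UB; rewrite ltNge; exact/negP.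
by [].
Qed.

Lemma cont_Some m (T : topologicalType) (f : T -> 'rV[R]_m) p : cont_at f p ->
  cont_at (fun x => Some (f x) : sphere R m) p.
Proof.
by move=> cf; apply: cont_at_comp cf _; exact: one_point_compactification_some_continuous.
Qed.

(* The value v tends to the point at infinity where e vanishes, as |v|^2 e is
   bounded below. *)
Lemma cont_infty m (T : topologicalType) (G : T -> sphere R m) (e n : T -> R) p :
  cont_at e p -> cont_at n p -> e p = 0 -> 0 < n p -> G p = infty ->
  (\forall x \near p, forall v, G x = Some v -> n x <= nsq v * e x) -> cont_at G p.
Proof.
move=> ce cn e0 n0 Gp hG A; rewrite Gp => /nbhs_inftyP[A0 [B AB]].
pose c := n p / 2; have c0 : 0 < c by rewrite divr_gt0.
have cn' : c < n p by rewrite /c ltr_pdivrMr // mulr_natr mulr2n ltrDl.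
have B0 : 0 < `|B| + 1 by rewrite ltr_pwDr.
have ce' : e p < c / (`|B| + 1) by rewrite e0 divr_gt0.
suff : \forall x \near p, A (G x) by [].
near=> x.
have nx : c < n x by near: x; exact: near_gt.
have ex : e x < c / (`|B| + 1) by near: x; exact: near_lt.
have hx : forall v, G x = Some v -> n x <= nsq v * e x by near: x.
case E : (G x) => [v|] //; apply: AB.
have hv := hx _ E; rewrite ltNge; apply/negP => vB.
have : n x < c.
  apply: (le_lt_trans hv); have [e0'|e0'] := leP (e x) 0.
    by apply: le_lt_trans c0; rewrite mulr_ge0_le0 // nsq_ge0.
  move: ex; rewrite ltr_pdivlMr // => ex; apply: le_lt_trans ex; rewrite mulrC ler_pM2l //.
  by apply: (le_trans vB); apply: (le_trans (ler_norm _)); rewrite lerDl.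
by rewrite ltNge (ltW nx).
Unshelve. all: end_near. Qed.

Definition sfrac m (u : 'rV[R]_m) (e : R) : sphere R m :=
  if e == 0 then infty else Some (e^-1 *: u).

(** The identity [nsq u = e n] says that |u / e|^2 e = n, and [n] stays away from 0 where [e] tends
    to 0; this is the hypothesis of [cont_infty]. *)
Lemma cont_sfrac m (T : topologicalType) (u : T -> 'rV[R]_m) (e n : T -> R) p :
  (forall i, cont_at (fun x => u x 0 i) p) -> cont_at e p -> cont_at n p ->
  (forall x, nsq (u x) = e x * n x) -> (e p = 0 -> 0 < n p) ->
  cont_at (fun x => sfrac (u x) (e x)) p.
Proof.
move=> cu ce cn hn n0; have [e0|e0] := eqVneq (e p) 0.
  apply: (cont_infty ce cn) => //; first exact: n0.
    by rewrite /sfrac e0 eqxx.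
  near=> x => v; rewrite /sfrac; case: eqP => // /eqP ex [<-].
  by rewrite nsqZ hn expr2 mulrACA mulVf // mul1r mulrAC mulVf // mul1r.
have nz : \forall x \near p, e x != 0.
  case: (ltgtP (e p) 0) e0 => // h _; near=> x.
    by rewrite lt_eqF //; near: x; exact: near_lt.
  by rewrite gt_eqF //; near: x; exact: near_gt.
apply: (@cont_at_near _ _ (fun x => Some ((e x)^-1 *: u x) : sphere R m)); last first.
  by near=> x; rewrite /sfrac ifF //; apply/negbTE; near: x.
apply: cont_Some; apply: cont_mx => i j; rewrite (ord1 i).
apply: (@cont_at_near _ _ (fun x => (e x)^-1 * u x 0 j)); last by near=> x; rewrite mxE.
by apply: cont_mul => //; exact: cont_inv.
Unshelve. all: end_near. Qed.

End SphereTopology.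

(** * Coordinates on the unit sphere and the Hopf map *)

Section UnitCoordinates.
Variable R : realType.

Lemma cont_at_Some m (U : topologicalType) (f : sphere R m -> U) (w : 'rV[R]_m) :
  cont_at (fun w => f (Some w)) w -> cont_at f (Some w).
Proof. by move=> cf A /cf. Qed.

(* Stereographic projection from the point at infinity to the unit sphere. *)
Definition uscale m (v : sphere R m) : R := if v is Some w then 2 / (nsq w + 1) else 0.
Definition ucoord m (v : sphere R m) (i : 'I_m) : R := if v is Some w then w 0 i * uscale v else 0.
Definition ulast m (v : sphere R m) : R := 1 - uscale v.

Lemma nsq1_gt0 m (w : 'rV[R]_m) : 0 < nsq w + 1.
Proof. by rewrite ltr_wpDl // nsq_ge0. Qed.

Lemma uscale_eq0 m (v : sphere R m) : (uscale v == 0) = (v == infty).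
Proof.
by case: v => [w|] /=; rewrite ?eqxx // mulf_eq0 invr_eq0 pnatr_eq0 /= gt_eqF // nsq1_gt0.
Qed.

Lemma uscale_continuous m : continuous (@uscale m).
Proof.
move=> [w|].
  apply: cont_at_Some; apply: cont_mul; first exact: cont_cst.
  apply: cont_inv; first by rewrite gt_eqF // nsq1_gt0.
  by apply: cont_add; [exact: nsq_continuous | exact: cont_cst].
move=> A /nbhs_ballP[e /= e0 eA]; apply/nbhs_inftyP; split.
  by apply: eA => /=; exact: ballxx.
exists (2 / e) => w hw; apply: eA => /=.
rewrite /ball /= sub0r normrN ger0_norm ?divr_ge0 ?ltW ?nsq1_gt0 //.
rewrite ltr_pdivrMr ?nsq1_gt0 // mulrC -ltr_pdivrMr //.
by apply: (lt_trans hw); rewrite ltrDl.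
Qed.

(** At infinity this forces the coordinates to tend to 0 along with [uscale]. *)
Lemma ucoord_sq m (v : sphere R m) i : ucoord v i ^+ 2 <= 2 * uscale v.
Proof.
case: v => [w|] /=; last by rewrite expr0n mulr0.
have h := nsq1_gt0 w; have h1 := nsq_coord w i; have h2 := nsq_ge0 w.
rewrite exprMn expr_div_n.
have -> : 2 * (2 / (nsq w + 1)) = (nsq w + 1) * (2 ^+ 2 / (nsq w + 1) ^+ 2).
  by field; rewrite gt_eqF.
rewrite ler_wpM2r ?divr_ge0 ?sqr_ge0 //; lra.
Qed.

Lemma ucoord_continuous m i : continuous (fun v : sphere R m => ucoord v i).
Proof.
move=> [w|].
  apply: cont_at_Some; apply: cont_mul; first exact: coord_continuous.
  apply: cont_mul; first exact: cont_cst.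
  apply: cont_inv; first by rewrite gt_eqF // nsq1_gt0.
  by apply: cont_add; [exact: nsq_continuous | exact: cont_cst].
move=> A /nbhs_ballP[e /= e0 eA].
have : \forall v \near (infty : sphere R m), uscale v < e ^+ 2 / 2.
  by apply: near_lt; [exact: uscale_continuous | rewrite /= divr_gt0 // exprn_gt0].
apply: filterS => v hv; apply: eA; rewrite /ball /= sub0r normrN.
rewrite -ltr_sqr ?nnegrE ?(ltW e0) // real_normK ?num_real //.
have := ucoord_sq v i; lra.
Qed.

Lemma ulast_continuous m : continuous (@ulast m).
Proof. move=> v; apply: (@cont_add _ _ (fun _ => 1) (fun v => - uscale v)); first exact: cont_cst.
by apply: cont_opp; exact: uscale_continuous. Qed.

Lemma cont_ucoord (T : topologicalType) m (A : T -> sphere R m) i p :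
  cont_at A p -> cont_at (fun x => ucoord (A x) i) p.
Proof. by move=> cA; apply: (@cont_app _ _ _ (fun v => ucoord v i)) => //; exact: ucoord_continuous. Qed.

Lemma cont_uscale (T : topologicalType) m (A : T -> sphere R m) p :
  cont_at A p -> cont_at (fun x => uscale (A x)) p.
Proof. by move=> cA; apply: (@cont_app _ _ _ (@uscale m)) => //; exact: uscale_continuous. Qed.

Lemma cont_ulast (T : topologicalType) m (A : T -> sphere R m) p :
  cont_at A p -> cont_at (fun x => ulast (A x)) p.
Proof. by move=> cA; apply: (@cont_app _ _ _ (@ulast m)) => //; exact: ulast_continuous. Qed.

Lemma unit_sphere m (v : sphere R m) : \sum_i ucoord v i ^+ 2 + ulast v ^+ 2 = 1.
Proof.
rewrite /ulast; case: v => [w|] /=; last by rewrite big1 ?subr0 ?expr1n ?add0r // => i _; rewrite expr0n.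
have h := nsq1_gt0 w.
under eq_bigr do rewrite exprMn.
rewrite -mulr_suml -/(nsq w); field; rewrite gt_eqF //.
Qed.

Definition cX (v : sphere R 3) := ucoord v (inord 0).
Definition cY (v : sphere R 3) := ucoord v (inord 1).
Definition cZ (v : sphere R 3) := ucoord v (inord 2).
Definition cC (v : sphere R 3) := ulast v.

Lemma unit_sphere3 v : cX v ^+ 2 + cY v ^+ 2 + cZ v ^+ 2 + cC v ^+ 2 = 1.
Proof.
rewrite -(unit_sphere v) !big_ord_recr big_ord0 /= add0r /cX /cY /cZ.
by congr (ucoord v _ ^+ 2 + ucoord v _ ^+ 2 + ucoord v _ ^+ 2 + _); apply: val_inj; rewrite /= inordK.
Qed.

(* The quotient of the complex numbers n1 + i n2 and m1 + i m2. *)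
Definition cfrac (n1 n2 m1 m2 : R) : sphere R 2 :=
  sfrac (row2 (n1 * m1 + n2 * m2) (n2 * m1 - n1 * m2)) (m1 ^+ 2 + m2 ^+ 2).

(* The quotient of n1 + i n2 by a real d. *)
Definition rfrac (n1 n2 d : R) : sphere R 2 := sfrac (row2 (n1 * d) (n2 * d)) (d ^+ 2).

Lemma nsq2 (a b : R) : nsq (row2 a b) = a ^+ 2 + b ^+ 2.
Proof. by rewrite /nsq !big_ord_recr big_ord0 /= add0r !mxE. Qed.

Lemma sqr2_eq0 (a b : R) : (a ^+ 2 + b ^+ 2 == 0) = (a == 0) && (b == 0).
Proof. by rewrite paddr_eq0 ?sqr_ge0 // !sqrf_eq0. Qed.

Lemma sqr2_gt0 (a b : R) : (0 < a ^+ 2 + b ^+ 2) = (a != 0) || (b != 0).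
Proof. by rewrite lt_neqAle eq_sym sqr2_eq0 addr_ge0 ?sqr_ge0 // andbT negb_and. Qed.

Lemma cont_row2 (T : topologicalType) (U : topologicalType) (a b : T -> U) p i j :
  cont_at a p -> cont_at b p -> cont_at (fun x => row2 (a x) (b x) i j) p.
Proof.
move=> ca cb.
by apply: (cont_eq (fun x => mxE _ _ _ _)); case: (j == ord0).
Qed.

Section ContFrac.
Variables (T : topologicalType) (n1 n2 m1 m2 d : T -> R) (p : T).

Lemma cont_cfrac : cont_at n1 p -> cont_at n2 p -> cont_at m1 p -> cont_at m2 p ->
  [|| n1 p != 0, n2 p != 0, m1 p != 0 | m2 p != 0] ->
  cont_at (fun x => cfrac (n1 x) (n2 x) (m1 x) (m2 x)) p.
Proof.
move=> c1 c2 c3 c4 nz.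
apply: (@cont_sfrac _ _ _ _ (fun x => m1 x ^+ 2 + m2 x ^+ 2) (fun x => n1 x ^+ 2 + n2 x ^+ 2)).
- by move=> i; apply: cont_row2; cont.
- by cont.
- by cont.
- by move=> x; rewrite nsq2; ring.
move/eqP; rewrite sqr2_eq0 => /andP[/eqP m10 /eqP m20].
by move: nz; rewrite m10 m20 eqxx /= !orbF sqr2_gt0.
Qed.

Lemma cont_rfrac : cont_at n1 p -> cont_at n2 p -> cont_at d p ->
  [|| n1 p != 0, n2 p != 0 | d p != 0] ->
  cont_at (fun x => rfrac (n1 x) (n2 x) (d x)) p.
Proof.
move=> c1 c2 c3 nz.
apply: (@cont_sfrac _ _ _ _ (fun x => d x ^+ 2) (fun x => n1 x ^+ 2 + n2 x ^+ 2)).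
- by move=> i; apply: cont_row2; cont.
- by cont.
- by cont.
- by move=> x; rewrite nsq2; ring.
move/eqP; rewrite sqrf_eq0 => /eqP d0.
by move: nz; rewrite d0 eqxx /= orbF sqr2_gt0.
Qed.

End ContFrac.

(** The unit coordinates share the factor 2 / (|p|^2 + 1), which cancels in W / Z. *)
Lemma hopfE (v : sphere R 3) : hopf v = cfrac (cZ v) (cC v) (cX v) (cY v).
Proof.
case: v => [w|]; last by rewrite /cfrac /cX /cY /= expr0n addr0 /sfrac eqxx.
rewrite /hopf /cfrac /cX /cY /cZ /cC /ulast /=.
set x := w 0 (inord 0); set y := w 0 (inord 1); set z := w 0 (inord 2).
have nE : nsq w = x ^+ 2 + y ^+ 2 + z ^+ 2.
  rewrite /nsq !big_ord_recr big_ord0 /= add0r /x /y /z.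
  by congr (w 0 _ ^+ 2 + w 0 _ ^+ 2 + w 0 _ ^+ 2); apply: val_inj; rewrite /= inordK.
have h := nsq1_gt0 w; rewrite nE in h *; set k := (_ + _ + _ + 1) in h *.
have k0 : k != 0 by rewrite gt_eqF.
have s0 : 2 / k != 0 by rewrite mulf_neq0 ?invr_eq0.
rewrite /sfrac; have -> : (x * (2 / k)) ^+ 2 + (y * (2 / k)) ^+ 2 = (x ^+ 2 + y ^+ 2) * (2 / k) ^+ 2 by ring.
rewrite mulf_eq0 expf_eq0 (negbTE s0) andbF orbF.
case: eqP => // /eqP r0; congr Some; apply/rowP => j; rewrite !mxE.
have -> : (j == ord0) = (j == 0) by [].
have kE : k - 1 = x ^+ 2 + y ^+ 2 + z ^+ 2 by rewrite /k addrK.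
have kE' : (x ^+ 2 + y ^+ 2 + z ^+ 2 - 1) = k - 2 by rewrite /k; ring.
rewrite kE'; case: ifP => _; field; by rewrite r0 k0.
Qed.

End UnitCoordinates.

(** * Continuity into the K-theory spaces *)

Section KspaceTopology.
Variables (R : realType) (D : permutative).

Section Continuity.
Variables (T : topologicalType) (n : nat) (p : T).

(** For a fixed simplex [z] the map goes through the block of [z], then the inclusion into the
    disjoint union and the projection to the quotient, which are continuous. *)
Lemma cont_kpoint k q (z : knerve D k q) (d : T -> stdsimplex R q) (s : T -> 'rV[sphere R n]_k) :
  cont_at d p -> cont_at s p -> cont_at (fun x => kpi (kpoint z (d x) (s x))) p.
Proof.
move=> cd cs.
apply: (@cont_at_comp _ _ _ (fun x => kpoint z (d x) (s x)) (@kpi R D n) p); last exact: pi_continuous.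
refine (@cont_at_comp2 T (stdsimplex R q) 'rV[sphere R n]_k (kraw R D n) d s
  (fun ds => kpoint z ds.1 ds.2) p cd cs _).
move=> A nA.
have h : nbhs ((d p, s p) : (stdsimplex R q * 'rV[sphere R n]_k)%type)
    (fun y => A (existT (@kblock R D n) (kcell z) y)) := @existT_continuous _ (@kblock R D n) (kcell z) (d p, s p) A nA.
have h' : (fun y : (stdsimplex R q * 'rV[sphere R n]_k)%type => A (existT (@kblock R D n) (kcell z) y))
    `<=` (fun y => A (kpoint z y.1 y.2)) by case.
exact: (filterS h' h).
Qed.

Lemma cont_P1 q (z : knerve D 1 q) (d : T -> stdsimplex R q) (A : T -> sphere R n) :
  cont_at d p -> cont_at A p -> cont_at (fun x => P1 z (d x) (A x)) p.
Proof.
move=> cd cA; apply: cont_kpoint cd _; apply: cont_mx => i j.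
exact: (cont_eq (fun x => mxE _ _ _ _)).
Qed.

Lemma cont_P2 q (z : knerve D 2 q) (d : T -> stdsimplex R q) (A B : T -> sphere R n) :
  cont_at d p -> cont_at A p -> cont_at B p -> cont_at (fun x => P2 z (d x) (A x) (B x)) p.
Proof.
move=> cd cA cB; apply: cont_kpoint cd _; apply: cont_mx => i j.
exact: cont_row2.
Qed.

Lemma cont_simplex q (d : T -> stdsimplex R q) :
  (forall i, cont_at (fun x => set_val (d x) 0 i) p) -> cont_at d p.
Proof.
move=> cd.
have cv : cont_at (fun x => set_val (d x)) p by apply: cont_mx => i j; rewrite (ord1 i); exact: cd.
move=> U [? /= [[W oW <-]] /= Wp WU].
have nW : nbhs (set_val (d p)) W by exact: open_nbhs_nbhs.
have h : \forall x \near p, W (set_val (d x)) := cv _ nW.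
suff : \forall x \near p, U (d x) by [].
by near=> x; apply: WU => /=; near: x.
Unshelve. all: end_near. Qed.

Lemma cont_edge (t : T -> R) : cont_at t p -> cont_at (fun x => edge_pt (t x)) p.
Proof.
move=> ct; apply: cont_simplex => i; apply: (cont_eq (fun x => mxE _ _ _ _)).
by case: (i == 0) => /=; cont.
Qed.

Lemma cont_tri (a b : T -> R) : cont_at a p -> cont_at b p -> cont_at (fun x => tri_pt (a x) (b x)) p.
Proof.
move=> ca cb; apply: cont_simplex => i.
have E x : set_val (tri_pt (a x) (b x)) 0 i = tri_coord (Num.min (clamp (a x)) (clamp (b x))) (clamp (b x)) 0 i by [].
apply: (cont_eq (fun x => etrans (E x) (mxE _ _ _ _))).
by case: (val i) => [|[|j]] /=; cont.
Qed.

End Continuity.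

Lemma ob_class2E (x : ob D) (v : sphere R 2) :
  suspn 2 (ob_map R x : sphere R 0 -> kspectrum R D 0) v = P1 (vertex x) (vertex_pt R) v.
Proof.
case: v => [r|]; last by rewrite /= P1_infty.
pose r' : 'rV[R]_1 := \row_j r 0 (lift ord0 j).
change (kstruct (Some (\row_(j < 1) r 0 ord0)) (kstruct (Some (\row_(j < 1) r' 0 ord0))
  (ob_map R x (Some (\row_(j < 0) r' 0 (lift ord0 j))))) = P1 (vertex x) (vertex_pt R) (Some r)).
rewrite /ob_map !kstructE /P1.
refine (congr1 (fun s : 'rV[sphere R 2]_1 => kpi (kpoint (vertex x) (vertex_pt R) s)) _).
apply/rowP => i; rewrite !mxE /=; congr Some; apply/rowP => j.
rewrite mxE; case: splitP => k jk; first by rewrite mxE; congr (r 0 _); apply: ord_inj; rewrite jk ord1.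
rewrite mxE; case: splitP => l kl; last by case: l kl.
by rewrite !mxE; congr (r 0 _); apply: ord_inj; rewrite jk /= kl ord1.
Qed.

(** The suspension coordinates come first, so the parameter of the loop is the last of the three. *)
Lemma loop_class2E (f : mor D) (mf : is_mor f (gunit D) (gunit D)) (v : sphere R 3) :
  suspn 2 (loop_map R mf : sphere R 1 -> kspectrum R D 0) v
  = if v is Some r then P1 (endo_simplex mf) (edge_pt (r 0 (inord 2)))
      (Some (row2 (r 0 (inord 0)) (r 0 (inord 1))) : sphere R 2)
    else kbase R D 2.
Proof.
case: v => [r|] //.
pose r' : 'rV[R]_2 := \row_j r 0 (lift ord0 j).
pose r'' : 'rV[R]_1 := \row_j r' 0 (lift ord0 j).
change (kstruct (Some (\row_(j < 1) r 0 ord0)) (kstruct (Some (\row_(j < 1) r' 0 ord0))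
  (loop_map R mf (Some r''))) =
  P1 (endo_simplex mf) (edge_pt (r 0 (inord 2))) (Some (row2 (r 0 (inord 0)) (r 0 (inord 1))) : sphere R 2)).
have -> : inord 2 = lift ord0 (lift ord0 ord0) :> 'I_3 by apply: ord_inj; rewrite /= inordK.
rewrite /loop_map !kstructE /P1 !mxE.
refine (congr1 (fun s : 'rV[sphere R 2]_1 => kpi (kpoint (endo_simplex mf) (edge_pt _) s)) _).
apply/rowP => i; rewrite !mxE /=; congr Some; apply/rowP => j.
rewrite !mxE; case: splitP => k jk.
  by rewrite ord1 in jk; rewrite -val_eqE /= jk /= !mxE; congr (r 0 _); apply: ord_inj; rewrite /= inordK.
rewrite -val_eqE /= jk /= mxE; case: splitP => l kl; last by case: l kl.
by rewrite !mxE; congr (r 0 _); apply: ord_inj; rewrite /= inordK.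
Qed.

End KspaceTopology.

(** * Homotopies *)

Section Homotopies.
Variables (R : realType) (X : prespectrum R).

(* Unlike in [is_homotopy], the parameter ranges over the whole real line. *)
Definition homotopic (m n : nat) (f g : sphere R m -> X n) : Prop :=
  exists H : R * sphere R m -> X n, [/\ continuous H, forall v, H (0, v) = f v,
    forall v, H (1, v) = g v & forall t, H (t, infty) = base X n].

Lemma homotopicW m n (f g : sphere R m -> X n) : homotopic f g ->
  exists H, is_homotopy H f g.
Proof.
by case=> H [cH H0 H1 Hb]; exists H; split=> //; exact: continuous_subspaceT.
Qed.

Lemma cont_fst (S T : topologicalType) (p : S * T) : cont_at fst p.
Proof. exact: cvg_fst. Qed.
Lemma cont_snd (S T : topologicalType) (p : S * T) : cont_at snd p.
Proof. exact: cvg_snd. Qed.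

(** Clamping the parameter extends to the whole line a homotopy that is controlled on [0, 1]
    only. *)
Lemma mk_homotopic m n (f g : sphere R m -> X n) (H : R * sphere R m -> X n) :
  (forall t v, 0 <= t <= 1 -> cont_at H (t, v)) ->
  (forall v, H (0, v) = f v) -> (forall v, H (1, v) = g v) ->
  (forall t, 0 <= t <= 1 -> H (t, infty) = base X n) -> homotopic f g.
Proof.
move=> cH H0 H1 Hb; exists (fun tv => H (clamp tv.1, tv.2)); split=> [[t v]|v|v|t].
- apply: (@cont_at_comp2 _ _ _ _ (fun tv : R * sphere R m => clamp tv.1) snd H).
  + by apply: cont_clamp; exact: cont_fst.
  + exact: cont_snd.
  + exact: cH (clamp_itv _).
- by rewrite /= clamp_le0.
- by rewrite /= clamp_ge1.
- exact: Hb (clamp_itv t).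
Qed.

Lemma homotopic_sym m n (f g : sphere R m -> X n) : homotopic f g -> homotopic g f.
Proof.
case=> H [cH H0 H1 Hb]; exists (fun tv => H (1 - tv.1, tv.2)); split=> [[t v]|v|v|t] //=.
- apply: (@cont_at_comp2 _ _ _ _ (fun tv : R * sphere R m => 1 - tv.1) snd H); last exact: cH.
  + by apply: cont_add; [exact: cont_cst | apply: cont_opp; exact: cont_fst].
  + exact: cont_snd.
- by rewrite subr0.
- by rewrite subrr.
Qed.

Lemma homotopic_trans m n (g f h : sphere R m -> X n) :
  homotopic f g -> homotopic g h -> homotopic f h.
Proof.
case=> H [cH H0 H1 Hb] [K [cK K0 K1 Kb]].
exists (fun tv => if tv.1 - 2^-1 <= 0 then H (2 * tv.1, tv.2) else K (2 * tv.1 - 1, tv.2)).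
split=> [|v|v|t] /=.
- apply: contP => p; refine (@cont_paste _ _ _ (fun tv : R * sphere R m => tv.1 - 2^-1)
    (fun tv : R * sphere R m => H (2 * tv.1, tv.2))
    (fun tv : R * sphere R m => K (2 * tv.1 - 1, tv.2)) p _ _ _ _).
  + by apply: cont_add; [exact: cont_fst | exact: cont_cst].
  + move=> _; apply: (@cont_at_comp2 _ _ _ _ (fun tv : R * sphere R m => 2 * tv.1) snd H); last exact: cH.
      by apply: cont_mul; [exact: cont_cst | exact: cont_fst].
    exact: cont_snd.
  + move=> _; apply: (@cont_at_comp2 _ _ _ _ (fun tv : R * sphere R m => 2 * tv.1 - 1) snd K); last exact: cK.
      by apply: cont_add; [apply: cont_mul; [exact: cont_cst | exact: cont_fst] | exact: cont_cst].
    exact: cont_snd.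
  + move=> /eqP; rewrite subr_eq0 => /eqP ->.
    by rewrite divff ?pnatr_eq0 // subrr H1 K0.
- by rewrite ifT ?mulr0 ?H0 //; lra.
- rewrite ifF; last by apply/negbTE; lra.
  by rewrite (_ : 2 * 1 - 1 = 1) ?K1 //; lra.
- by case: ifP.
Qed.

Lemma homotopic_eq m n (f f' g g' : sphere R m -> X n) : f =1 f' -> g =1 g' ->
  homotopic f g -> homotopic f' g'.
Proof. by move=> /funext -> /funext ->. Qed.

End Homotopies.

(** * Homotopies along great arcs *)

Section Chord.
Variable R : realType.

Definition antipodal m (v w : sphere R m) : Prop :=
  (forall i, ucoord v i = - ucoord w i) /\ ulast v = - ulast w.

Lemma nsq_eq0 m (v : 'rV[R]_m) : nsq v = 0 -> forall i, v 0 i = 0.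
Proof.
move=> v0 i; apply/eqP; rewrite -sqrf_eq0; apply/eqP/le_anti.
by rewrite sqr_ge0 andbT -v0 nsq_coord.
Qed.

(* Two maps to a sphere which are nowhere antipodal are joined by the shortest
   great arcs. *)
Lemma chord (X : prespectrum R) m k n (A B : sphere R m -> sphere R k) (L : sphere R k -> X n) :
  continuous A -> continuous B -> (forall v, ~ antipodal (A v) (B v)) ->
  A infty = infty -> B infty = infty -> continuous L -> L infty = base X n ->
  homotopic (L \o A) (L \o B).
Proof.
move=> cA cB AB A0 B0 cL L0.
pose u (p : R * sphere R m) : 'rV[R]_k :=
  \row_i ((1 - p.1) * ucoord (A p.2) i + p.1 * ucoord (B p.2) i).
pose l (p : R * sphere R m) := (1 - p.1) * ulast (A p.2) + p.1 * ulast (B p.2).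
(* [N] is the length of the vector (u, l) on the chord. Normalizing it and projecting
   stereographically gives u / (N - l). *)
pose N p := Num.sqrt (nsq (u p) + l p ^+ 2).
have N2 p : nsq (u p) = (N p - l p) * (N p + l p).
  rewrite -subr_sqr /N sqr_sqrtr ?addrK //.
  by rewrite addr_ge0 ?nsq_ge0 ?sqr_ge0.
have Npos t v : 0 <= t <= 1 -> 0 < N (t, v).
  move=> /andP[t0 t1]; rewrite lt_neqAle sqrtr_ge0 andbT eq_sym sqrtr_eq0 -ltNge.
  rewrite lt_neqAle addr_ge0 ?nsq_ge0 ?sqr_ge0 // andbT eq_sym.
  rewrite paddr_eq0 ?nsq_ge0 ?sqr_ge0 // sqrf_eq0; apply/negP => /andP[/eqP u0 /eqP l0].
  have ui i : (1 - t) * ucoord (A v) i = - (t * ucoord (B v) i).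
    by have := nsq_eq0 u0 i; rewrite mxE /=; lra.
  have ul : (1 - t) * ulast (A v) = - (t * ulast (B v)) by rewrite /l /= in l0; lra.
  (* If the chord met 0, comparing the lengths of its two terms would give (1 - t)^2 = t^2: the
     meeting point would be the midpoint and the ends antipodal. *)
  have : (1 - t) ^+ 2 = t ^+ 2.
    have e (c : R) (w : sphere R k) :
        c ^+ 2 = \sum_i (c * ucoord w i) ^+ 2 + (c * ulast w) ^+ 2.
      rewrite exprMn; under eq_bigr do rewrite exprMn.
      by rewrite -mulr_sumr -mulrDr unit_sphere mulr1.
    rewrite (e _ (A v)) [RHS](e _ (B v)) ul sqrrN; congr (_ + _).
    by apply: eq_bigr => i _; rewrite ui sqrrN.
  move=> sq; have sq' : (1 - t) ^+ 2 - t ^+ 2 = 1 - 2 * t by ring.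
  have ht : 1 - t = t by lra.
  have t2 : t != 0 by apply/eqP; lra.
  apply: (AB v); split=> [i|]; apply: (mulfI t2).
    by rewrite mulrN -ui ht.
  by rewrite mulrN -ul ht.
have cu i p : cont_at (fun q => u q 0 i) p.
  apply: (cont_eq (fun q => mxE _ _ _ _)); cont; try exact: cont_fst.
    by apply: cont_ucoord; apply: cont_app => //; exact: cont_snd.
  by apply: cont_ucoord; apply: cont_app => //; exact: cont_snd.
have cl p : cont_at l p.
  rewrite /l; cont; try exact: cont_fst.
    by apply: cont_uscale; apply: cont_app => //; exact: cont_snd.
  by apply: cont_uscale; apply: cont_app => //; exact: cont_snd.
have cN p : cont_at N p.
  by apply: cont_sqrt; apply: cont_add; [exact: cont_nsq | exact: cont_exp].
have E (v : sphere R k) w : w = (\row_i ucoord v i) -> sfrac w (Num.sqrt (nsq w + ulast v ^+ 2) - ulast v) = v.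
  move=> ->; have -> : nsq (\row_i ucoord v i) + ulast v ^+ 2 = 1.
    by rewrite -[RHS](unit_sphere v); congr (_ + _); apply: eq_bigr => i _; rewrite mxE.
  rewrite sqrtr1 /ulast subKr /sfrac uscale_eq0; case: eqP => [->|] //.
  case: v => [v|] // _; congr Some; apply/rowP => i; rewrite !mxE /= mulrCA mulVf ?mulr1 //.
  by rewrite mulf_neq0 ?invr_eq0 ?pnatr_eq0 // gt_eqF // nsq1_gt0.
apply: (mk_homotopic (H := fun p => L (sfrac (u p) (N p - l p)))).
- move=> t v t01; apply: cont_app; first exact: cL.
  apply: (@cont_sfrac _ _ _ u (fun p => N p - l p) (fun p => N p + l p)) => //.
  + by apply: cont_add (cN _) (cont_opp (cl _)).
  + exact: cont_add (cN _) (cl _).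
  + by move=> h; have := Npos _ v t01; lra.
- move=> v /=; congr (L _); rewrite -[RHS](E _ _ erefl).
  have uE : u (0, v) = \row_i ucoord (A v) i.
    by apply/rowP => i; rewrite !mxE /= subr0 mul0r mul1r addr0.
  by rewrite /N /l uE /= subr0 mul0r mul1r addr0.
- move=> v /=; congr (L _); rewrite -[RHS](E _ _ erefl).
  have uE : u (1, v) = \row_i ucoord (B v) i.
    by apply/rowP => i; rewrite !mxE /= subrr mul0r mul1r add0r.
  by rewrite /N /l uE /= subrr mul0r mul1r add0r.
- move=> t /andP[t0 t1].
  have uE : u (t, infty) = 0.
    by apply/rowP => i; rewrite !mxE /= A0 B0 /= !mulr0 addr0.
  have lE : l (t, infty) = 1 by rewrite /l /= A0 B0 /ulast /=; lra.
  rewrite /N uE lE /sfrac ifT //; rewrite (_ : nsq _ = 0) ?add0r ?expr1n ?sqrtr1 ?subrr //.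
  by rewrite /nsq big1 // => i _; rewrite mxE expr0n.
Qed.

End Chord.

Section LoopClass.
Variables (R : realType) (D : permutative) (f : mor D) (mf : is_mor f (gunit D) (gunit D)).
Local Notation KD := (kspectrum R D).
Local Notation L := (suspn 2 (loop_map R mf : sphere R 1 -> KD 0)).

Lemma nsq3 (r : 'rV[R]_3) :
  nsq r = nsq (row2 (r 0 (inord 0)) (r 0 (inord 1))) + r 0 (inord 2) ^+ 2.
Proof.
rewrite nsq2 /nsq !big_ord_recr big_ord0 /= add0r.
by congr (r 0 _ ^+ 2 + r 0 _ ^+ 2 + r 0 _ ^+ 2); apply: ord_inj; rewrite /= inordK.
Qed.

(** Near infinity there are two cases: the loop coordinate is in [0, 1] and the other two are large,
    which the tube lemma treats uniformly over the edge, or it is outside [0, 1], where the label is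
    [e] and the value is the basepoint. *)
Lemma loop_class2_continuous : continuous L.
Proof.
have -> : L = fun v => _ := funext (loop_class2E mf).
apply: contP => -[r|].
  apply: cont_at_Some; apply: cont_P1.
    by apply: cont_edge; exact: coord_continuous.
  apply: cont_Some; apply: cont_mx => i j.
  by apply: cont_row2; exact: coord_continuous.
move=> U; rewrite nbhsE => -[V [oV V0] VU].
pose G (p : sphere R 2 * R) : KD 2 := P1 (endo_simplex mf) (edge_pt p.2) p.1.
have cG p : cont_at G p.
  by apply: cont_P1; [apply: cont_edge; exact: cont_snd | exact: cont_fst].
have h t : `[0, 1]%classic t -> V (G (infty, t)) by move=> _; rewrite /G P1_infty.
have := tube (p := infty : sphere R 2) (@segment_compact R 0 1) oV (fun _ _ => cG _) h.
move=> /nbhs_inftyP[_ [B HB]].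
apply/nbhs_inftyP; split; first exact: VU.
exists (B + 1) => r hr; apply: VU => /=.
have [r01|r01] := boolP (0 <= r 0 (inord 2) <= 1).
  apply: HB; last by rewrite /= in_itv.
  move: hr; rewrite nsq3; case/andP: r01 => r0 r1.
  have : r 0 (inord 2) ^+ 2 <= 1 by rewrite expr_le1.
  lra.
rewrite (vertexE mf (vertex_pt R)) ?P1_unit //.
by move: r01; rewrite negb_and -!ltNge => /orP[/ltW->|/ltW->]; rewrite ?orbT.
Qed.

End LoopClass.

(** * Maps between spheres *)

Section Pages.
Variable R : realType.
Implicit Types v : sphere R 3.

(* A neighbourhood of the z-axis, where cD vanishes, is collapsed to the
   basepoint: this makes the angle around the axis harmless. *)
Definition cD v : R := Num.max 0 (cX v ^+ 2 + cY v ^+ 2 - 2^-1).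

(** With W = cZ + i cC and d = [cD], this is W / d^2. It maps the part d > 0 of each page, a
    half-plane bounded by the binding, onto the plane. The square makes it the case a = 0 of
    [disc]. *)
Definition page v : sphere R 2 := rfrac (cZ v) (cC v) (cD v ^+ 2).

Lemma cD_ge0 v : 0 <= cD v.
Proof. by rewrite /cD le_max lexx. Qed.

Lemma cD_gt0 v : 0 < cD v -> cD v = cX v ^+ 2 + cY v ^+ 2 - 2^-1.
Proof. by rewrite /cD; case: (leP 0 (cX v ^+ 2 + cY v ^+ 2 - 2^-1)) => // _; rewrite ltxx. Qed.

Lemma cD_eq0 v : cD v = 0 -> cX v ^+ 2 + cY v ^+ 2 <= 2^-1.
Proof. by move=> h; rewrite -subr_le0 -h /cD le_max lexx orbT. Qed.

Lemma cont_cX (T : topologicalType) (A : T -> sphere R 3) p :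
  cont_at A p -> cont_at (fun x => cX (A x)) p.
Proof. exact: cont_ucoord. Qed.
Lemma cont_cY (T : topologicalType) (A : T -> sphere R 3) p :
  cont_at A p -> cont_at (fun x => cY (A x)) p.
Proof. exact: cont_ucoord. Qed.
Lemma cont_cZ (T : topologicalType) (A : T -> sphere R 3) p :
  cont_at A p -> cont_at (fun x => cZ (A x)) p.
Proof. exact: cont_ucoord. Qed.
Lemma cont_cC (T : topologicalType) (A : T -> sphere R 3) p :
  cont_at A p -> cont_at (fun x => cC (A x)) p.
Proof. exact: cont_ulast. Qed.
Lemma cont_cD (T : topologicalType) (A : T -> sphere R 3) p :
  cont_at A p -> cont_at (fun x => cD (A x)) p.
Proof.
move=> cA; apply: (@cont_max _ _ (fun _ => 0)); first exact: cont_cst.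
apply: (@cont_add _ _ (fun x => cX (A x) ^+ 2 + cY (A x) ^+ 2)); last exact: cont_cst.
by apply: cont_add; apply: cont_exp; [exact: cont_cX | exact: cont_cY].
Qed.

Lemma cD_infty : cD infty = 0.
Proof. by rewrite /cD /cX /cY /= expr0n addr0 sub0r; apply/max_idPl; rewrite oppr_le0 invr_ge0. Qed.

Lemma rfrac0 (a b : R) : rfrac a b 0 = infty.
Proof. by rewrite /rfrac /sfrac expr0n eqxx. Qed.

Lemma rfrac_neq0 (a b d : R) : d != 0 -> rfrac a b d = Some (row2 (a / d) (b / d)).
Proof.
move=> d0; rewrite /rfrac /sfrac sqrf_eq0 (negbTE d0); congr Some; apply/rowP => i.
by rewrite !mxE; case: ifP => _; field.
Qed.

Lemma page_D0 v : cD v = 0 -> page v = infty.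
Proof. by rewrite /page => ->; rewrite expr0n rfrac0. Qed.

Lemma cont_page (T : topologicalType) (A : T -> sphere R 3) p :
  cont_at A p -> cont_at (fun x => page (A x)) p.
Proof.
move=> cA; apply: cont_rfrac; [exact: cont_cZ | exact: cont_cC | by apply: cont_exp; exact: cont_cD |].
apply/negPn/negP; rewrite !negb_or !negbK sqrf_eq0 => /and3P[/eqP z0 /eqP c0 /eqP d0].
have := unit_sphere3 (A p); rewrite z0 c0; have := cD_eq0 d0; lra.
Qed.

Definition row3 (a b c : R) : 'rV[R]_3 := \row_(i < 3) (match val i with 0 => a | 1 => b | _ => c end).

Lemma row3E a b c : [/\ row3 a b c 0 (inord 0) = a, row3 a b c 0 (inord 1) = b
  & row3 a b c 0 (inord 2) = c].
Proof. by split; rewrite mxE /= inordK. Qed.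

Lemma nsq_row3 a b c : nsq (row3 a b c) = a ^+ 2 + b ^+ 2 + c ^+ 2.
Proof. by rewrite /nsq !big_ord_recr big_ord0 /= add0r !mxE. Qed.

Lemma cont_row3 (T : topologicalType) (a b c : T -> R) p : cont_at a p -> cont_at b p ->
  cont_at c p -> cont_at (fun x => row3 (a x) (b x) (c x)) p.
Proof.
move=> ca cb cc; apply: cont_mx => i j; apply: (cont_eq (fun x => mxE _ _ _ _)).
by case: (val j) => [|[|k]].
Qed.

Lemma rowE3 (w : 'rV[R]_3) : w = row3 (w 0 (inord 0)) (w 0 (inord 1)) (w 0 (inord 2)).
Proof.
apply/rowP => i; rewrite mxE; case: i => [[|[|[|i]]] hi] //=; congr (w 0 _);
  by apply: ord_inj; rewrite inordK.
Qed.

Lemma antipodal_Some m (a b : 'rV[R]_m) : antipodal (Some a : sphere R m) (Some b : sphere R m) ->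
  nsq a * nsq b = 1 /\ exists l, 0 < l /\ forall i, a 0 i = - (l * b 0 i).
Proof.
case=> /= h; rewrite /ulast /= => hl.
have [a0 b0] := conj (nsq1_gt0 a) (nsq1_gt0 b).
have [a1 b1] : nsq a + 1 != 0 /\ nsq b + 1 != 0 by rewrite !gt_eqF.
split.
  have e : 2 / (nsq a + 1) + 2 / (nsq b + 1) = 2 by lra.
  have : (nsq a + 1) + (nsq b + 1) = (nsq a + 1) * (nsq b + 1).
    have -> : nsq a + 1 + (nsq b + 1) = (2 / (nsq a + 1) + 2 / (nsq b + 1)) *
      ((nsq a + 1) * (nsq b + 1)) / 2 by field; rewrite a1 b1.
    by rewrite e; field.
  by lra.
exists ((nsq a + 1) / (nsq b + 1)); split; first by rewrite divr_gt0.
move=> i; have := h i => hi.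
have -> : a 0 i = a 0 i * (2 / (nsq a + 1)) * ((nsq a + 1) / 2) by field; rewrite a1.
by rewrite hi; field; rewrite b1.
Qed.

(** The last coordinate is the loop parameter k + cY, with cY divided by a factor that is 1 for cX
    >= 1/2 and tends to 0 with cX. The image thus tends to infinity at the boundary of the half
    space cX > 0, where cY is bounded away from 0 as long as [cD] is positive. *)
Definition pole_map (k : R) v : sphere R 3 :=
  if (0 < cX v) && (0 < cD v) then
    Some (row3 (cZ v / cD v ^+ 2) (cC v / cD v ^+ 2) (k + cY v / Num.min 1 (2 * cX v)))
  else infty.

Lemma pole_map_continuous k : continuous (pole_map k).
Proof.
apply: contP => p.
have cid : cont_at (fun v : sphere R 3 => v) p by exact: cvg_id.
have [cx cy cz cc] := And4 (cont_cX cid) (cont_cY cid) (cont_cZ cid) (cont_cC cid).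
have cd := cont_cD cid.
have US := unit_sphere3 p.
have cm : cont_at (fun v => Num.min 1 (2 * cX v)) p.
  apply: (@cont_min _ _ (fun _ => 1)); first exact: cont_cst.
  by apply: cont_mul => //; exact: cont_cst.
have [D0|Dn0] := eqVneq (cD p) 0.
  apply: (@cont_infty _ _ _ _ (fun v => cD v ^+ 4) (fun v => cZ v ^+ 2 + cC v ^+ 2)).
  - exact: cont_exp.
  - by apply: cont_add; exact: cont_exp.
  - by rewrite D0 expr0n.
  - by have := cD_eq0 D0; lra.
  - by rewrite /pole_map D0 ltxx andbF.
  near=> v => w; rewrite /pole_map; case: ifP => // /andP[x0 d0] [<-].
  rewrite nsq_row3 !expr_div_n.
  have -> : (cZ v ^+ 2 / (cD v ^+ 2) ^+ 2 + cC v ^+ 2 / (cD v ^+ 2) ^+ 2 +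
     (k + cY v / Num.min 1 (2 * cX v)) ^+ 2) * cD v ^+ 4 =
     cZ v ^+ 2 + cC v ^+ 2 + ((k + cY v / Num.min 1 (2 * cX v)) * cD v ^+ 2) ^+ 2.
    by field; rewrite !gt_eqF // lt_min ltr01 mulr_gt0.
  by rewrite lerDl sqr_ge0.
have Dp : 0 < cD p by rewrite lt_neqAle eq_sym Dn0 cD_ge0.
have DE := cD_gt0 Dp.
have [X0|X0|X0] := ltgtP (cX p) 0.
- apply: (@cont_at_near _ _ (fun _ => infty : sphere R 3)); first exact: cont_cst.
  near=> v; rewrite /pole_map ifF //; apply/negbTE; rewrite negb_and -!leNgt.
  by apply/orP; left; apply: ltW; near: v; exact: near_lt.
- apply: (@cont_at_near _ _ (fun v => Some (row3 (cZ v / cD v ^+ 2) (cC v / cD v ^+ 2)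
    (k + cY v / Num.min 1 (2 * cX v))) : sphere R 3)); last first.
    near=> v; rewrite /pole_map ifT //; apply/andP; split; near: v; exact: near_gt.
  have d2 : cD p ^+ 2 != 0 by rewrite expf_neq0.
  apply: cont_Some; apply: cont_row3.
  + by apply: cont_mul => //; apply: cont_inv => //; exact: cont_exp.
  + by apply: cont_mul => //; apply: cont_inv => //; exact: cont_exp.
  + apply: cont_add; first exact: cont_cst.
    apply: cont_mul => //; apply: cont_inv => //.
    by rewrite gt_eqF // lt_min ltr01 mulr_gt0.
apply: (@cont_infty _ _ _ _ (fun v => Num.min 1 (2 * cX v) ^+ 2)
  (fun v => (k * Num.min 1 (2 * cX v) + cY v) ^+ 2)).
- exact: cont_exp.
- by apply: cont_exp; apply: cont_add => //; apply: cont_mul => //; exact: cont_cst.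
- by rewrite X0 mulr0 (min_idPr ler01) expr0n.
- rewrite X0 mulr0 (min_idPr ler01) mulr0 add0r.
  by rewrite X0 expr0n add0r in DE; lra.
- by rewrite /pole_map X0 ltxx.
near=> v => w; rewrite /pole_map; case: ifP => // /andP[x0 d0] [<-].
have m0 : 0 < Num.min 1 (2 * cX v) by rewrite lt_min ltr01 mulr_gt0.
rewrite nsq_row3 [leRHS]mulrDl; set m := Num.min _ _ in m0 *.
have -> : (k + cY v / m) ^+ 2 * m ^+ 2 = (k * m + cY v) ^+ 2 by field; rewrite gt_eqF.
by rewrite lerDr mulr_ge0 ?addr_ge0 ?sqr_ge0.
Unshelve. all: end_near. Qed.

Definition ext3 (g : 'rV[R]_3 -> 'rV[R]_3) v : sphere R 3 := if v is Some w then Some (g w) else infty.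

Lemma ext3_continuous g : continuous g -> (forall w, nsq w / 2 - 1 <= nsq (g w)) ->
  continuous (ext3 g).
Proof.
move=> cg hg; apply: contP => -[w|].
  by apply: cont_at_Some; apply: cont_Some; exact: cg.
move=> U /nbhs_inftyP[U0 [B UB]]; apply/nbhs_inftyP; split => //.
exists (2 * (B + 1)) => w hw; apply: UB; apply: lt_le_trans (hg w); lra.
Qed.

(** The first-order form of [pole_map 0] at (1, 0, 0), up to positive factors: there cZ, cC and cY
    are close to z, x - 1 and y. *)
Definition shift_cycle (w : 'rV[R]_3) := row3 (w 0 (inord 2)) (w 0 (inord 0) - 1) (w 0 (inord 1)).
Definition cycle3 (w : 'rV[R]_3) := row3 (w 0 (inord 2)) (w 0 (inord 0)) (w 0 (inord 1)).

Lemma coord_cont (i : 'I_3) : continuous (fun w : 'rV[R]_3 => w 0 i).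
Proof. exact: coord_continuous. Qed.

Lemma shift_cycle_continuous : continuous (ext3 shift_cycle).
Proof.
apply: ext3_continuous => [|w].
  apply: contP => w; apply: cont_row3; try exact: coord_cont.
  by apply: cont_add; [exact: coord_cont | exact: cont_cst].
rewrite /shift_cycle nsq_row3 {1}(rowE3 w) nsq_row3.
set x := w 0 _; set y := w 0 _; set z := w 0 _.
have -> : z ^+ 2 + (x - 1) ^+ 2 + y ^+ 2 = (x ^+ 2 + y ^+ 2 + z ^+ 2) / 2 - 1
   + ((x - 2) ^+ 2 / 2 + y ^+ 2 / 2 + z ^+ 2 / 2) by field.
by rewrite lerDl !addr_ge0 // divr_ge0 // sqr_ge0.
Qed.

Lemma cycle3_continuous : continuous (ext3 cycle3).
Proof.
apply: ext3_continuous => [|w].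
  by apply: contP => w; apply: cont_row3; exact: coord_cont.
rewrite /cycle3 nsq_row3 {1}(rowE3 w) nsq_row3.
have := (sqr_ge0 (w 0 (inord 0)), sqr_ge0 (w 0 (inord 1)), sqr_ge0 (w 0 (inord 2))).
move=> [[? ?] ?]; lra.
Qed.

(** Antipodal values would have zero first coordinates, and last coordinates q + 1/2 and q of
    product -1; but q^2 + q/2 + 1 has no real root. *)
Lemma pole_map_shift v : ~ antipodal (pole_map 2^-1 v) (pole_map 0 v).
Proof.
rewrite /pole_map; case: ifP => _; last by case=> _; rewrite /ulast /=; lra.
set a := row3 _ _ _; set b := row3 _ _ _ => /antipodal_Some[n1 [l [l0 hl]]].
have [[a0 a1 a2] [b0 b1 b2]] := conj (row3E (cZ v / cD v ^+ 2) (cC v / cD v ^+ 2) (2^-1 + cY v / Num.min 1 (2 * cX v)))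
  (row3E (cZ v / cD v ^+ 2) (cC v / cD v ^+ 2) (0 + cY v / Num.min 1 (2 * cX v))).
have [h0 h1 h2] := And3 (hl (inord 0)) (hl (inord 1)) (hl (inord 2)).
rewrite a0 b0 in h0; rewrite a1 b1 in h1; rewrite a2 b2 add0r in h2.
rewrite /a /b !nsq_row3 add0r in n1.
move: h0 h1 h2 n1; set z := _ / _; set c := _ / _; set q := _ / _ => h0 h1 h2 n1.
have z0 : z = 0 by nra.
have c0 : c = 0 by nra.
rewrite z0 c0 expr0n !add0r in n1.
have le0 : (2^-1 + q) * q <= 0 by rewrite h2; nra.
have sq1 : ((2^-1 + q) * q) ^+ 2 = 1 by rewrite exprMn.
have : (2^-1 + q) * q = -1 by nra.
by nra.
Qed.

(** The coordinates of two finite values have matching signs (for the second, once the other two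
    vanish), so antipodal ones would both be 0, which is impossible. If [pole_map 0] is infinite,
    its antipode 0 is taken by [shift_cycle] only at (1, 0, 0), where [pole_map 0] is finite. *)
Lemma pole_map_shift_cycle v : ~ antipodal (pole_map 0 v) (ext3 shift_cycle v).
Proof.
case: v => [w|] /=; last first.
  by rewrite /pole_map cD_infty ltxx andbF; case=> _; rewrite /ulast /=; lra.
rewrite /pole_map; case: ifP => [/andP[X0 D0]|XD].
  move=> /antipodal_Some[n1 [l [l0 hl]]].
  have [h0 h1 h2] := And3 (hl (inord 0)) (hl (inord 1)) (hl (inord 2)).
  rewrite !mxE /= !inordK //= add0r in h0 h1 h2.
  rewrite !nsq_row3 in n1.
  have s0 : 0 < 2 / (nsq w + 1) by rewrite divr_gt0 // nsq1_gt0.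
  have m0 : 0 < Num.min 1 (2 * cX (Some w : sphere R 3)) by rewrite lt_min ltr01 mulr_gt0.
  have w2 : w 0 (inord 2) = 0.
    have : w 0 (inord 2) * (2 / (nsq w + 1) / cD (Some w : sphere R 3) ^+ 2 + l) = 0.
      by rewrite mulrDr mulrA mulrA; move: h0; rewrite /cZ /= !mulrA => ->; ring.
    by move/eqP; rewrite mulf_eq0 => /orP[/eqP //|]; rewrite gt_eqF // addr_gt0 // divr_gt0 // exprn_gt0.
  have w1 : w 0 (inord 1) = 0.
    have : w 0 (inord 1) * (2 / (nsq w + 1) / Num.min 1 (2 * cX (Some w : sphere R 3)) + l) = 0.
      by rewrite mulrDr mulrA mulrA; move: h2; rewrite /cY /= !mulrA => ->; ring.
    by move/eqP; rewrite mulf_eq0 => /orP[/eqP //|]; rewrite gt_eqF // addr_gt0 // divr_gt0.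
  have nE : nsq w = w 0 (inord 0) ^+ 2 by rewrite (rowE3 w) nsq_row3 w1 w2 expr0n !addr0 mxE /= inordK.
  have x0 : 0 < w 0 (inord 0) by move: X0; rewrite /cX /= pmulr_lgt0.
  have h : (w 0 (inord 0) - 1) * ((w 0 (inord 0) + 1) / (nsq w + 1) / cD (Some w : sphere R 3) ^+ 2 + l) = 0.
    have cE : cC (Some w : sphere R 3) = (w 0 (inord 0) - 1) * (w 0 (inord 0) + 1) / (nsq w + 1).
      by rewrite /cC /ulast /= nE; field; rewrite -nE gt_eqF // nsq1_gt0.
    by rewrite mulrDr !mulrA -cE h1; ring.
  have w0 : w 0 (inord 0) = 1.
    move/eqP: h; rewrite mulf_eq0 => /orP[|]; first by rewrite subr_eq0 => /eqP.
    by rewrite gt_eqF // addr_gt0 // !divr_gt0 ?exprn_gt0 ?nsq1_gt0 // addr_gt0.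
  by move: n1; rewrite w0 w1 w2 subrr expr0n !addr0 mulr0 => /eqP; rewrite eq_sym oner_eq0.
case=> _; rewrite /ulast /= subr0 => h.
have n0 : nsq (shift_cycle w) = 0.
  have := nsq1_gt0 (shift_cycle w); set k := _ + 1 in h * => k0.
  have : 2 / k = 2 by lra.
  move=> /(congr1 (fun t => t * k)); rewrite mulfVK ?gt_eqF // /k; lra.
have := nsq_eq0 n0; rewrite /shift_cycle => hw.
have [r0 r1 r2] := row3E (w 0 (inord 2)) (w 0 (inord 0) - 1) (w 0 (inord 1)).
have w2 := hw (inord 0); have w0 := hw (inord 1); have w1 := hw (inord 2).
rewrite r0 in w2; rewrite r1 in w0; rewrite r2 in w1.
have {}w0 : w 0 (inord 0) = 1 by lra.
have nE : nsq w = 1 by rewrite (rowE3 w) nsq_row3 w0 w1 w2 !expr0n expr1n !addr0.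
have XE : cX (Some w : sphere R 3) = 1 by rewrite /cX /= nE w0; field.
have YE : cY (Some w : sphere R 3) = 0 by rewrite /cY /= w1 mul0r.
move: XD; rewrite XE ltr01 /=; rewrite /cD XE YE expr1n expr0n addr0 lt_max => /negP; apply.
by apply/orP; right; lra.
Qed.

(** As for [pole_map_shift]: x^2 - x + 1 has no real root. *)
Lemma shift_cycle_cycle3 v : ~ antipodal (ext3 shift_cycle v) (ext3 cycle3 v).
Proof.
case: v => [w|] /=; last by case=> _; rewrite /ulast /=; lra.
move=> /antipodal_Some[n1 [l [l0 hl]]].
have [h0 h1 h2] := And3 (hl (inord 0)) (hl (inord 1)) (hl (inord 2)).
rewrite !mxE /= !inordK //= in h0 h1 h2.
rewrite !nsq_row3 in n1.
move: h0 h1 h2 n1; set z := w 0 _; set x := w 0 _; set y := w 0 _ => h0 h1 h2 n1.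
have z0 : z = 0 by nra.
have y0 : y = 0 by nra.
rewrite z0 y0 expr0n !add0r !addr0 in n1.
have le0 : (x - 1) * x <= 0 by rewrite h1; nra.
have sq1 : ((x - 1) * x) ^+ 2 = 1 by rewrite exprMn.
have : (x - 1) * x = -1 by nra.
by nra.
Qed.

(** A rotation of order 3 has no negative eigenvalue: x = -l^3 x forces x = 0 for l > 0. *)
Lemma cycle3_id v : ~ antipodal (ext3 cycle3 v) v.
Proof.
case: v => [w|] /=; last by case=> _; rewrite /ulast /=; lra.
move=> /antipodal_Some[n1 [l [l0 hl]]].
have [h0 h1 h2] := And3 (hl (inord 0)) (hl (inord 1)) (hl (inord 2)).
rewrite !mxE /= !inordK //= in h0 h1 h2.
move: n1; rewrite (rowE3 w) !nsq_row3.
move: h0 h1 h2; set z := w 0 _; set x := w 0 _; set y := w 0 _ => h0 h1 h2.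
have x0 : x * (1 + l ^+ 3) = 0 by rewrite mulrDr {1}h1 h2 h0; ring.
have {}x0 : x = 0.
  by move/eqP: x0; rewrite mulf_eq0 => /orP[/eqP //|]; rewrite gt_eqF // addr_gt0 // exprn_gt0.
have z0 : z = 0 by rewrite h0 x0 mulr0 oppr0.
have y0 : y = 0 by rewrite h2 z0 mulr0 oppr0.
by rewrite x0 y0 z0 expr0n !addr0 mulr0 => /eqP; rewrite eq_sym oner_eq0.
Qed.

End Pages.

(** * Pairs of discs on the pages and the passage to the Hopf map *)

Section Discs.
Variable R : realType.
Implicit Types (v : sphere R 3) (t : R).

(* On the page with coordinate W/d, the pinch map of the half plane
   (1 - |a|^2) d + Re (W conj a) > 0 sending a to 0. *)
Definition half (a1 a2 : R) v : R :=
  Num.max 0 ((1 - (a1 ^+ 2 + a2 ^+ 2)) * cD v + (cZ v * a1 + cC v * a2)).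
Definition disc (a1 a2 : R) v : sphere R 2 :=
  rfrac (cZ v - a1 * cD v) (cC v - a2 * cD v) (cD v * half a1 a2 v).

(* With W = z + i c and a = a1 + i a2: the numerator W^2 - a^2 d^2. *)
Definition num1 (a1 a2 : R) v : R := cZ v ^+ 2 - cC v ^+ 2 - (a1 ^+ 2 - a2 ^+ 2) * cD v ^+ 2.
Definition num2 (a1 a2 : R) v : R := 2 * cZ v * cC v - 2 * a1 * a2 * cD v ^+ 2.
(** Real part of d ((1 - t) ((W + a d) h + (W - a d) h') + t W), where h and h' are [half] at a and
    at -a. At t = 0, if h or h' vanishes, a linear factor cancels against W^2 - a^2 d^2 and a single
    disc remains; at t = 1 the quotient is (W^2 - a^2 d^2) / (d W). *)
Definition den1 (a1 a2 : R) t v : R := cD v * ((1 - t) * ((cZ v + a1 * cD v) * half a1 a2 v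
  + (cZ v - a1 * cD v) * half (- a1) (- a2) v) + t * cZ v).
Definition den2 (a1 a2 : R) t v : R := cD v * ((1 - t) * ((cC v + a2 * cD v) * half a1 a2 v
  + (cC v - a2 * cD v) * half (- a1) (- a2) v) + t * cC v).
Definition two_discs (a1 a2 : R) t v : sphere R 2 :=
  cfrac (num1 a1 a2 v) (num2 a1 a2 v) (den1 a1 a2 t v) (den2 a1 a2 t v).

Definition lin1 (a1 a2 : R) t v := (1 - t) * num1 a1 a2 v + t * cX v.
Definition lin2 (a1 a2 : R) t v := (1 - t) * num2 a1 a2 v + t * cY v.
Definition lin3 t v := ((1 - t) * cD v + t) * cZ v.
Definition lin4 t v := ((1 - t) * cD v + t) * cC v.
(* The homotopy [L1 : L2] from W^2 - a^2 d^2 : d W to Z : W, followed by a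
   rotation which keeps the image of the basepoint at infinity. *)
Definition to_hopf (a1 a2 : R) t v : sphere R 2 :=
  cfrac ((1 - t) * lin1 a1 a2 t v - t * lin4 t v) ((1 - t) * lin2 a1 a2 t v + t * lin3 t v)
        ((1 - t) * lin3 t v - t * lin2 a1 a2 t v) (t * lin1 a1 a2 t v + (1 - t) * lin4 t v).

Lemma disc_D0 (a1 a2 : R) v : cD v = 0 -> disc a1 a2 v = infty.
Proof. by rewrite /disc => ->; rewrite mul0r rfrac0. Qed.

Lemma disc_half0 (a1 a2 : R) v : half a1 a2 v = 0 -> disc a1 a2 v = infty.
Proof. by rewrite /disc => ->; rewrite mulr0 rfrac0. Qed.

Lemma disc00 v : disc 0 0 v = page v.
Proof.
rewrite /disc /page /half !mul0r !mulr0 !subr0 expr0n /= !addr0 subr0 mul1r expr2.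
by rewrite (max_idPr (cD_ge0 v)).
Qed.

(** For |a| >= 1 the two half-planes are disjoint: their linear forms add up to 2 (1 - |a|^2) d <=
    0. *)
Lemma half_wedge (a1 a2 : R) v : 1 <= a1 ^+ 2 + a2 ^+ 2 ->
  half a1 a2 v = 0 \/ half (- a1) (- a2) v = 0.
Proof.
move=> a1a; rewrite /half !sqrrN !mulrN; have d0 := cD_ge0 v.
set q := cZ v * a1; set q' := cC v * a2.
have e0 : (1 - (a1 ^+ 2 + a2 ^+ 2)) * cD v <= 0 by nra.
by have [h|h] := leP 0 (q + q'); [right|left]; apply/max_idPl; lra.
Qed.

Lemma disc_wedge (a1 a2 : R) v : (0 < cD v -> 1 <= a1 ^+ 2 + a2 ^+ 2) ->
  disc a1 a2 v = infty \/ disc (- a1) (- a2) v = infty.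
Proof.
have [D0|D0 /(_ isT) h] := leP (cD v) 0.
  by left; apply: disc_D0; apply/le_anti; rewrite D0 cD_ge0.
by have [?|?] := half_wedge v h; [left|right]; apply: disc_half0.
Qed.

(** Cancellation of a nonzero complex factor u = u1 + i u2 in (n u) / (d u), for a real d. *)
Lemma cfrac_scale (n1 n2 u1 u2 d : R) : (u1 != 0) || (u2 != 0) ->
  cfrac (n1 * u1 - n2 * u2) (n1 * u2 + n2 * u1) (d * u1) (d * u2) = rfrac n1 n2 d.
Proof.
rewrite -sqr2_gt0 => u0; have [->|d0] := eqVneq d 0.
  by rewrite rfrac0 /cfrac !mul0r expr0n addr0 /sfrac eqxx.
rewrite rfrac_neq0 // /cfrac /sfrac ifF; last first.
  by apply/negbTE; rewrite !exprMn -mulrDr mulf_neq0 ?expf_neq0 // gt_eqF.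
congr Some; apply/rowP => i; rewrite !mxE.
have u0' : u1 ^+ 2 + u2 ^+ 2 != 0 by rewrite gt_eqF.
have -> : (d * u1) ^+ 2 + (d * u2) ^+ 2 = d ^+ 2 * (u1 ^+ 2 + u2 ^+ 2) by ring.
by case: ifP => _; field; rewrite d0 u0'.
Qed.

Lemma cfrac_eq (n1 n2 m1 m2 n1' n2' m1' m2' : R) :
  n1 * m1 + n2 * m2 = n1' * m1' + n2' * m2' -> n2 * m1 - n1 * m2 = n2' * m1' - n1' * m2' ->
  m1 ^+ 2 + m2 ^+ 2 = m1' ^+ 2 + m2' ^+ 2 -> cfrac n1 n2 m1 m2 = cfrac n1' n2' m1' m2'.
Proof. by rewrite /cfrac => -> -> ->. Qed.

Lemma two_discs0 (a1 a2 : R) v : (0 < cD v -> 1 <= a1 ^+ 2 + a2 ^+ 2) ->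
  (disc a1 a2 v = infty /\ two_discs a1 a2 0 v = disc (- a1) (- a2) v) \/
  (disc (- a1) (- a2) v = infty /\ two_discs a1 a2 0 v = disc a1 a2 v).
Proof.
have cf0 n1 n2 : cfrac n1 n2 0 0 = infty by rewrite /cfrac expr0n addr0 /sfrac eqxx.
have [D0 _|D0 /(_ isT) h] := leP (cD v) 0.
  have D : cD v = 0 by apply/le_anti; rewrite D0 cD_ge0.
  by left; rewrite !disc_D0 // /two_discs /den1 /den2 D !mul0r cf0.
have US := unit_sphere3 v.
have H b1 b2 : 1 <= b1 ^+ 2 + b2 ^+ 2 -> half b1 b2 v != 0 -> half (- b1) (- b2) v = 0 ->
    (cZ v + b1 * cD v != 0) || (cC v + b2 * cD v != 0).
  move=> hb b0 _; rewrite -negb_and; apply/negP => /andP[/eqP z0 /eqP c0].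
  move: b0; rewrite /half (_ : cZ v = - b1 * cD v) 1?(_ : cC v = - b2 * cD v); try lra.
  move/eqP; apply; apply/max_idPl.
  have : 0 <= (b1 ^+ 2 + b2 ^+ 2 - 1) * cD v by rewrite mulr_ge0 ?subr_ge0 // ltW.
  nra.
have [h0|h0] := half_wedge v h.
  left; split; first exact: disc_half0.
  have [h1|h1] := eqVneq (half (- a1) (- a2) v) 0.
    by rewrite disc_half0 // /two_discs /den1 /den2 h0 h1 !mulr0 !mul0r !addr0 !mulr0 cf0.
  have u0 := H (- a1) (- a2); rewrite !sqrrN !opprK in u0.
  rewrite /disc -(cfrac_scale _ _ _ (u0 h h1 h0)) /two_discs /num1 /num2 /den1 /den2 h0.
  by congr cfrac; ring.
right; split; first exact: disc_half0.
have [h1|h1] := eqVneq (half a1 a2 v) 0.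
  by rewrite disc_half0 // /two_discs /den1 /den2 h0 h1 !mulr0 !mul0r !addr0 !mulr0 cf0.
rewrite /disc -(cfrac_scale _ _ _ (H a1 a2 h h1 h0)) /two_discs /num1 /num2 /den1 /den2 h0.
by congr cfrac; ring.
Qed.

(** W^2 - a^2 d^2 is the product of W - a d and W + a d, and the complex norm is multiplicative. *)
Lemma num_eq0 (a1 a2 : R) v : num1 a1 a2 v = 0 -> num2 a1 a2 v = 0 ->
  (cZ v = a1 * cD v /\ cC v = a2 * cD v) \/ (cZ v = - a1 * cD v /\ cC v = - a2 * cD v).
Proof.
move=> n1 n2.
have : ((cZ v - a1 * cD v) ^+ 2 + (cC v - a2 * cD v) ^+ 2)
    * ((cZ v + a1 * cD v) ^+ 2 + (cC v + a2 * cD v) ^+ 2) = num1 a1 a2 v ^+ 2 + num2 a1 a2 v ^+ 2.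
  by rewrite /num1 /num2; ring.
rewrite n1 n2 expr0n addr0 => /eqP; rewrite mulf_eq0 !sqr2_eq0.
by case/orP => /andP[/eqP h1 /eqP h2]; [left|right]; split; lra.
Qed.

(** At a zero W = a d of the numerator with d > 0, the denominator is a d^2 (2 (1 - t) d + t), which
    is not 0; the zero W = - a d is similar. For d = 0 the numerator vanishes only with W, which
    |Z|^2 <= 1/2 excludes. *)
Lemma two_discs_nz (a1 a2 : R) t v : 0 <= t <= 1 -> (0 < cD v -> 1 <= a1 ^+ 2 + a2 ^+ 2) ->
  [|| num1 a1 a2 v != 0, num2 a1 a2 v != 0, den1 a1 a2 t v != 0 | den2 a1 a2 t v != 0].
Proof.
move=> /andP[t0 t1] ha; apply/negPn/negP; rewrite !negb_or !negbK.
move=> /and4P[/eqP n1 /eqP n2 /eqP d1 /eqP d2].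
have US := unit_sphere3 v.
have [D0|Dp] := leP (cD v) 0.
  have D : cD v = 0 by apply/le_anti; rewrite D0 cD_ge0.
  have := cD_eq0 D.
  by case: (num_eq0 n1 n2) => -[z0 c0]; rewrite z0 c0 D !mulr0 !expr0n /= in US; lra.
have {}ha := ha Dp.
have k0 : 0 < 2 * (1 - t) * cD v + t.
  have [->|tp] := eqVneq t 0; first by rewrite subr0 addr0 !mulr1 mulr_gt0.
  by rewrite ltr_wpDl ?lt_neqAle 1?eq_sym ?tp // !mulr_ge0 ?subr_ge0 // ltW.
have hp b1 b2 : 1 <= b1 ^+ 2 + b2 ^+ 2 -> cZ v = b1 * cD v -> cC v = b2 * cD v ->
    half b1 b2 v = cD v /\ half (- b1) (- b2) v = 0.
  move=> hb z0 c0; rewrite /half z0 c0 !sqrrN; split.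
    rewrite (_ : (1 - (b1 ^+ 2 + b2 ^+ 2)) * cD v + (b1 * cD v * b1 + b2 * cD v * b2) = cD v); last by ring.
    by apply/max_idPr; exact: ltW.
  apply/max_idPl.
  have : 0 <= (b1 ^+ 2 + b2 ^+ 2 - 1) * cD v by rewrite mulr_ge0 ?subr_ge0 // ltW.
  nra.
suff [az cz] : a1 = 0 /\ a2 = 0 by move: ha; rewrite az cz !expr0n addr0 ler10.
have nz : cD v ^+ 2 * (2 * (1 - t) * cD v + t) != 0 by rewrite mulf_neq0 ?expf_neq0 ?gt_eqF.
case: (num_eq0 n1 n2) => -[z0 c0].
  have [e1 e2] := hp _ _ ha z0 c0.
  rewrite /den1 /den2 e1 e2 z0 c0 in d1 d2.
  split; apply: (mulIf nz); rewrite mul0r; [rewrite -d1 | rewrite -d2]; ring.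
have ha' : 1 <= (- a1) ^+ 2 + (- a2) ^+ 2 by rewrite !sqrrN.
have [e1 e2] := hp _ _ ha' z0 c0; rewrite !opprK in e2.
rewrite /den1 /den2 e1 e2 z0 c0 in d1 d2.
split; apply: (mulIf nz); rewrite mul0r; apply/eqP; rewrite -oppr_eq0; apply/eqP;
  [rewrite -d1 | rewrite -d2]; ring.
Qed.

(** The rotation has determinant (1 - t)^2 + t^2, so both L1 and L2 would vanish. Apart from the
    case t = 0 and d = 0, excluded by |Z|^2 <= 1/2, this forces W = 0 and d = 1/2, hence (1 - t) a^2
    / 4 = t Z; the second hypothesis says that a^2 and Z are never so aligned. *)
Lemma to_hopf_nz (a1 a2 : R) t v : 0 <= t <= 1 ->
  (cX v ^+ 2 + cY v ^+ 2 = 1 -> forall s u : R, 0 <= s -> 0 <= u -> 0 < s + u ->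
     s * (a1 ^+ 2 - a2 ^+ 2) = u * cX v -> s * (2 * a1 * a2) = u * cY v -> False) ->
  (0 < cD v -> 1 <= a1 ^+ 2 + a2 ^+ 2) ->
  [|| (1 - t) * lin1 a1 a2 t v - t * lin4 t v != 0, (1 - t) * lin2 a1 a2 t v + t * lin3 t v != 0,
      (1 - t) * lin3 t v - t * lin2 a1 a2 t v != 0 | t * lin1 a1 a2 t v + (1 - t) * lin4 t v != 0].
Proof.
move=> /andP[t0 t1] al ha; apply/negPn/negP; rewrite !negb_or !negbK.
move=> /and4P[/eqP n1 /eqP n2 /eqP m1 /eqP m2].
have dt : (1 - t) ^+ 2 + t ^+ 2 != 0.
  by rewrite gt_eqF // sqr2_gt0; have [->|_] := eqVneq t 0; rewrite ?subr0 ?oner_eq0 ?orbT.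
have [l1 l2 l3 l4] : [/\ lin1 a1 a2 t v = 0, lin2 a1 a2 t v = 0, lin3 t v = 0 & lin4 t v = 0].
  move: (lin1 a1 a2 t v) (lin2 a1 a2 t v) (lin3 t v) (lin4 t v) n1 n2 m1 m2 => x1 x2 x3 x4 n1 n2 m1 m2.
  split; apply: (mulfI dt); rewrite mulr0.
  - by rewrite (_ : _ * _ = (1 - t) * ((1 - t) * x1 - t * x4) + t * (t * x1 + (1 - t) * x4)); [rewrite n1 m2 !mulr0 addr0 | ring].
  - by rewrite (_ : _ * _ = (1 - t) * ((1 - t) * x2 + t * x3) - t * ((1 - t) * x3 - t * x2)); [rewrite n2 m1 !mulr0 subr0 | ring].
  - by rewrite (_ : _ * _ = (1 - t) * ((1 - t) * x3 - t * x2) + t * ((1 - t) * x2 + t * x3)); [rewrite n2 m1 !mulr0 addr0 | ring].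
  - by rewrite (_ : _ * _ = (1 - t) * (t * x1 + (1 - t) * x4) - t * ((1 - t) * x1 - t * x4)); [rewrite n1 m2 !mulr0 subr0 | ring].
have US := unit_sphere3 v; have d0 := cD_ge0 v.
have [k0|k0] := eqVneq ((1 - t) * cD v + t) 0.
  have td : 0 <= (1 - t) * cD v by rewrite mulr_ge0 ?subr_ge0.
  have tE : t = 0 by lra.
  have D : cD v = 0 by rewrite tE subr0 mul1r addr0 in k0.
  rewrite /lin1 /lin2 tE subr0 !mul1r !mul0r !addr0 in l1 l2.
  have := cD_eq0 D.
  by case: (num_eq0 l1 l2) => -[z0 c0]; rewrite z0 c0 D !mulr0 !expr0n /= in US; lra.
have z0 : cZ v = 0 by move/eqP: l3; rewrite mulf_eq0 (negbTE k0) => /eqP.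
have c0 : cC v = 0 by move/eqP: l4; rewrite mulf_eq0 (negbTE k0) => /eqP.
rewrite z0 c0 !expr0n /= !addr0 in US.
have D : cD v = 2^-1.
  have [D0|Dp] := leP (cD v) 0; last by rewrite (cD_gt0 Dp) US; lra.
  have : cD v = 0 by apply/le_anti; rewrite D0 d0.
  by move/cD_eq0; rewrite US; lra.
rewrite /lin1 /lin2 /num1 /num2 z0 c0 D in l1 l2.
apply: (al US ((1 - t) / 4) t) => //; try lra.
Qed.

Lemma to_hopf1 (a1 a2 : R) v : to_hopf a1 a2 1 v = hopf v.
Proof.
rewrite hopfE; apply: cfrac_eq; rewrite /lin1 /lin2 /lin3 /lin4; ring.
Qed.

Lemma to_hopf0 (a1 a2 : R) v : to_hopf a1 a2 0 v = two_discs a1 a2 1 v.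
Proof.
rewrite /to_hopf /two_discs /lin1 /lin2 /lin3 /lin4 /den1 /den2.
by congr cfrac; ring.
Qed.

Section Continuity.
Variables (T : topologicalType) (A : T -> sphere R 3) (a1 a2 t : T -> R) (p : T).
Hypotheses (cA : cont_at A p) (c1 : cont_at a1 p) (c2 : cont_at a2 p) (ct : cont_at t p).

Let cX' := cont_cX cA.
Let cY' := cont_cY cA.
Let cZ' := cont_cZ cA.
Let cC' := cont_cC cA.
Let cD' := cont_cD cA.

Lemma cont_sub (f g : T -> R) : cont_at f p -> cont_at g p -> cont_at (fun x => f x - g x) p.
Proof. by move=> cf cg; apply: cont_add => //; exact: cont_opp. Qed.

Lemma cont_half (b1 b2 : T -> R) : cont_at b1 p -> cont_at b2 p ->
  cont_at (fun x => half (b1 x) (b2 x) (A x)) p.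
Proof.
move=> cb1 cb2; apply: (@cont_max _ _ (fun _ => 0)); first exact: cont_cst.
apply: cont_add; last by apply: cont_add; exact: cont_mul.
apply: cont_mul => //; apply: (@cont_sub (fun _ => 1)); first exact: cont_cst.
by apply: cont_add; exact: cont_exp.
Qed.

Lemma cont_disc : cont_at (fun x => disc (a1 x) (a2 x) (A x)) p.
Proof.
have ch := cont_half c1 c2.
apply: cont_rfrac.
- by apply: cont_sub => //; exact: cont_mul.
- by apply: cont_sub => //; exact: cont_mul.
- exact: cont_mul.
have US := unit_sphere3 (A p); apply/negPn/negP; rewrite !negb_or !negbK => /and3P[/eqP z0 /eqP d0 /eqP e0].
have [D0|Dp] := leP (cD (A p)) 0.
  have D : cD (A p) = 0 by apply/le_anti; rewrite D0 cD_ge0.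
  rewrite D !mulr0 !subr0 in z0 d0.
  by rewrite z0 d0 !expr0n /= in US; have := cD_eq0 D; lra.
have zE : cZ (A p) = a1 p * cD (A p) by lra.
have cE : cC (A p) = a2 p * cD (A p) by lra.
move/eqP: e0; rewrite mulf_eq0 gt_eqF //= /half zE cE.
rewrite (_ : (1 - (a1 p ^+ 2 + a2 p ^+ 2)) * cD (A p) + (a1 p * cD (A p) * a1 p + a2 p * cD (A p) * a2 p) = cD (A p)); last by ring.
by rewrite (max_idPr (ltW Dp)) gt_eqF.
Qed.

Lemma cont_num1 : cont_at (fun x => num1 (a1 x) (a2 x) (A x)) p.
Proof.
apply: cont_sub; first by apply: cont_sub; exact: cont_exp.
by apply: cont_mul; [apply: cont_sub; exact: cont_exp | exact: cont_exp].
Qed.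

Lemma cont_num2 : cont_at (fun x => num2 (a1 x) (a2 x) (A x)) p.
Proof.
have c2x := @cont_cst T _ (2 : R) p.
by apply: cont_sub; repeat (apply: cont_mul => //); exact: cont_exp.
Qed.

Lemma cont_1t : cont_at (fun x => 1 - t x) p.
Proof. by apply: (@cont_sub (fun _ => 1)) => //; exact: cont_cst. Qed.

Lemma cont_two_discs : 0 <= t p <= 1 -> (0 < cD (A p) -> 1 <= a1 p ^+ 2 + a2 p ^+ 2) ->
  cont_at (fun x => two_discs (a1 x) (a2 x) (t x) (A x)) p.
Proof.
move=> t01 ha; have c1t := cont_1t.
have h1 := cont_half c1 c2; have h2 := cont_half (cont_opp c1) (cont_opp c2).
apply: cont_cfrac; [exact: cont_num1 | exact: cont_num2 | | | exact: two_discs_nz].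
- apply: cont_mul => //; apply: cont_add; last exact: cont_mul.
  apply: cont_mul => //; apply: cont_add; apply: cont_mul => //.
    by apply: cont_add => //; exact: cont_mul.
  by apply: cont_sub => //; exact: cont_mul.
- apply: cont_mul => //; apply: cont_add; last exact: cont_mul.
  apply: cont_mul => //; apply: cont_add; apply: cont_mul => //.
    by apply: cont_add => //; exact: cont_mul.
  by apply: cont_sub => //; exact: cont_mul.
Qed.

Lemma cont_to_hopf : 0 <= t p <= 1 -> (0 < cD (A p) -> 1 <= a1 p ^+ 2 + a2 p ^+ 2) ->
  (cX (A p) ^+ 2 + cY (A p) ^+ 2 = 1 -> forall s u : R, 0 <= s -> 0 <= u -> 0 < s + u ->
     s * (a1 p ^+ 2 - a2 p ^+ 2) = u * cX (A p) -> s * (2 * a1 p * a2 p) = u * cY (A p) -> False) ->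
  cont_at (fun x => to_hopf (a1 x) (a2 x) (t x) (A x)) p.
Proof.
move=> t01 ha al; have c1t := cont_1t.
have l1 : cont_at (fun x => lin1 (a1 x) (a2 x) (t x) (A x)) p.
  by apply: cont_add; apply: cont_mul => //; exact: cont_num1.
have l2 : cont_at (fun x => lin2 (a1 x) (a2 x) (t x) (A x)) p.
  by apply: cont_add; apply: cont_mul => //; exact: cont_num2.
have l3 : cont_at (fun x => lin3 (t x) (A x)) p.
  by apply: cont_mul => //; apply: cont_add => //; exact: cont_mul.
have l4 : cont_at (fun x => lin4 (t x) (A x)) p.
  by apply: cont_mul => //; apply: cont_add => //; exact: cont_mul.
apply: cont_cfrac; last exact: to_hopf_nz.
- by apply: cont_sub; exact: cont_mul.
- by apply: cont_add; exact: cont_mul.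
- by apply: cont_sub; exact: cont_mul.
- by apply: cont_add; exact: cont_mul.
Qed.

End Continuity.

End Discs.

(** * The composite with the Hopf map *)

Section Stages.
Variable R : realType.
Implicit Types v : sphere R 3.

Lemma cX_infty : cX (infty : sphere R 3) = 0.
Proof. by []. Qed.

(** The open book is cut along [cX v = 0], and a homotopy is given by one formula on each side: the
    discs turn on the left, and the label depends on the angle on the right. *)
Lemma paste_homotopy (X : prespectrum R) n (Lf Rt : R * sphere R 3 -> X n) :
  (forall t v, 0 <= t <= 1 -> cX v <= 0 -> cont_at Lf (t, v)) ->
  (forall t v, 0 <= t <= 1 -> 0 <= cX v -> cont_at Rt (t, v)) ->
  (forall t v, 0 <= t <= 1 -> cX v = 0 -> Lf (t, v) = Rt (t, v)) ->
  (forall t, 0 <= t <= 1 -> Lf (t, infty) = base X n) ->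
  homotopic (fun v => if cX v <= 0 then Lf (0, v) else Rt (0, v))
            (fun v => if cX v <= 0 then Lf (1, v) else Rt (1, v)).
Proof.
move=> cL cR LR L0.
apply: (mk_homotopic (H := fun p => if cX p.2 <= 0 then Lf p else Rt p)) => //.
- move=> t v t01; refine (@cont_paste _ _ _ (fun p : R * sphere R 3 => cX p.2) Lf Rt (t, v) _ _ _ _).
  + by apply: cont_cX; exact: cont_snd.
  + exact: cL.
  + exact: cR.
  + exact: LR.
- by move=> t t01; rewrite [(t, infty).2]/= cX_infty lexx; exact: L0.
Qed.

(** On the left half the centre is a = 2 cX + i kap(cY). It makes a half turn from i to -i through
    the negative reals, so that -a^2 follows Z, and the factors 2 keep |a| >= 1 wherever [cD] is
    positive. *)
Definition kap (y : R) : R := Num.max (-1) (Num.min 1 (2 * y)).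

Lemma kap_cases (y : R) : [\/ (1 <= 2 * y /\ kap y = 1), (2 * y <= -1 /\ kap y = -1)
  | (-1 < 2 * y < 1 /\ kap y = 2 * y)].
Proof.
rewrite /kap; case: (lerP 1 (2 * y)) => h.
  by constructor 1; split=> //; rewrite max_r //; lra.
case: (lerP (2 * y) (-1)) => h'.
  by constructor 2.
by constructor 3; split=> //; apply/andP.
Qed.

Lemma cont_kap (T : topologicalType) (f : T -> R) p : cont_at f p -> cont_at (fun x => kap (f x)) p.
Proof.
move=> cf; apply: (@cont_max _ _ (fun _ => -1)); first exact: cont_cst.
apply: (@cont_min _ _ (fun _ => 1)); first exact: cont_cst.
by apply: cont_mul => //; exact: cont_cst.
Qed.

(** This is where the threshold 1/2 of [cD] matters: it gives cY^2 > 1/2, so that 1/2 + cY lies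
    beyond an end of [0, 1] and the label is at an end of its edge. *)
Lemma half_plane_edge v : cX v = 0 -> 0 < cD v ->
  (cY v <= - 2^-1 /\ kap (cY v) = -1) \/ (2^-1 <= cY v /\ kap (cY v) = 1).
Proof.
move=> X0 D0; have := cD_gt0 D0; rewrite X0 expr0n add0r => DE.
have Y2 : 2^-1 < cY v ^+ 2 by lra.
by case: (kap_cases (cY v)) => -[h ->]; [right|left|]; [split; lra | split; lra | nra].
Qed.

(** Either |cY| >= 1/2 and kap(cY)^2 = 1, or the sum is 4 |Z|^2, which exceeds 2. *)
Lemma left_norm v : 0 < cD v -> 1 <= (2 * cX v) ^+ 2 + kap (cY v) ^+ 2.
Proof.
move=> D0; have := cD_gt0 D0; have x2 := sqr_ge0 (cX v) => DE.
have xy : 2^-1 < cX v ^+ 2 + cY v ^+ 2 by lra.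
by case: (kap_cases (cY v)) => -[h ->]; nra.
Qed.

(** The relation is s a^2 = u Z. Since kap(cY) has the sign of cY and cX <= 0, the imaginary parts
    have opposite signs; this leaves the case u = 0, where a would vanish, and the point Z = -1,
    where a^2 = 4. *)
Lemma left_align v s u : cX v <= 0 -> cX v ^+ 2 + cY v ^+ 2 = 1 -> 0 <= s -> 0 <= u -> 0 < s + u ->
  s * ((2 * cX v) ^+ 2 - kap (cY v) ^+ 2) = u * cX v ->
  s * (2 * (2 * cX v) * kap (cY v)) = u * cY v -> False.
Proof.
move=> X0 r1 s0 u0 su e1 e2.
have ky : 0 <= kap (cY v) * cY v /\ (kap (cY v) = 0 -> cY v = 0).
  by case: (kap_cases (cY v)) => -[h ->]; split; nra.
have [ky0 kyz] := ky.
have h1 : u * cY v ^+ 2 = 4 * (s * cX v * (kap (cY v) * cY v)).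
  by rewrite (_ : u * cY v ^+ 2 = (u * cY v) * cY v); [rewrite -e2 | ]; ring.
have h2 : s * cX v * (kap (cY v) * cY v) <= 0.
  by rewrite mulr_le0_ge0 // mulr_ge0_le0.
have uY : u * cY v ^+ 2 = 0.
  by apply/le_anti; rewrite mulr_ge0 ?sqr_ge0 // andbT h1; lra.
have [uz|un] := eqVneq u 0.
  have sp : s != 0 by rewrite uz addr0 in su; rewrite gt_eqF.
  rewrite uz !mul0r in e1 e2.
  have f1 : (2 * cX v) ^+ 2 = kap (cY v) ^+ 2.
    by move/eqP: e1; rewrite mulf_eq0 (negbTE sp) /= subr_eq0 => /eqP.
  have f2 : cX v * kap (cY v) = 0.
    by move/eqP: e2; rewrite mulf_eq0 (negbTE sp) /= => /eqP h; lra.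
  have k0 : kap (cY v) = 0.
    move/eqP: f2; rewrite mulf_eq0 => /orP[/eqP x0|/eqP //].
    by apply/eqP; rewrite -sqrf_eq0 -f1 x0 mulr0 expr0n.
  have := kyz k0; rewrite k0 expr0n in f1 => y0.
  by move: f1 r1; rewrite y0; nra.
have y0 : cY v = 0.
  by move/eqP: uY; rewrite mulf_eq0 (negbTE un) sqrf_eq0 => /eqP.
have k0 : kap (cY v) = 0.
  by rewrite y0 /kap mulr0 (min_idPr ler01); apply/max_idPr; rewrite oppr_le0 ler01.
have x1 : cX v = -1 by rewrite y0 in r1; nra.
rewrite k0 x1 in e1; nra.
Qed.

Lemma right_align v s u : 0 <= cX v -> cX v ^+ 2 + cY v ^+ 2 = 1 -> 0 <= s -> 0 <= u -> 0 < s + u ->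
  s * (0 ^+ 2 - 1 ^+ 2) = u * cX v -> s * (2 * 0 * 1) = u * cY v -> False.
Proof.
move=> X0 r1 s0 u0 su; rewrite expr0n expr1n sub0r mulrN1 !mulr0 mul0r mulr0 => e1 /esym/eqP.
have ux : 0 <= u * cX v by rewrite mulr_ge0.
have sz : s = 0 by lra.
rewrite sz add0r in su; rewrite mulf_eq0 gt_eqF //= => /eqP y0.
rewrite sz oppr0 in e1; move/esym/eqP: e1; rewrite mulf_eq0 gt_eqF //= => /eqP x0.
by move: r1; rewrite x0 y0 expr0n addr0 => /eqP; rewrite eq_sym oner_eq0.
Qed.

Lemma right_norm v : 0 < cD v -> (1 : R) <= 0 ^+ 2 + 1 ^+ 2.
Proof. by rewrite expr0n expr1n add0r. Qed.

Lemma two_discsN (a1 a2 t : R) v : two_discs (- a1) (- a2) t v = two_discs a1 a2 t v.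
Proof.
rewrite /two_discs /num1 /num2 /den1 /den2 !opprK.
by congr cfrac; ring.
Qed.

Lemma two_discs_D0 (a1 a2 t : R) v : cD v = 0 -> two_discs a1 a2 t v = infty.
Proof.
by move=> D; rewrite /two_discs /den1 /den2 D !mul0r /cfrac expr0n addr0 /sfrac eqxx.
Qed.

Variable D : picard.
Local Notation KD := (kspectrum R D).
Local Notation e := (gunit D).
Local Notation pt := (vertex_pt R).

Section Object.
Variable x : ob D.

Let on_x (s : sphere R 2) : KD 2 := P1 (vertex x) pt s.

Let cont_on_x (T : topologicalType) (A : T -> sphere R 2) p : cont_at A p -> cont_at (fun q => on_x (A q)) p.
Proof. by move=> cA; apply: cont_P1 => //; exact: cont_cst. Qed.

Let c1 (p : R * sphere R 3) := @cont_fst R (sphere R 3) p.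
Let c2 (p : R * sphere R 3) := @cont_snd R (sphere R 3) p.
Arguments c1 p : clear implicits.
Arguments c2 p : clear implicits.

Lemma c2X (p : R * sphere R 3) : cont_at (fun q => 2 * cX q.2) p.
Proof. by apply: cont_mul; [exact: cont_cst | apply: cont_cX; exact: c2]. Qed.
Lemma ckap (p : R * sphere R 3) : cont_at (fun q => kap (cY q.2)) p.
Proof. by apply: cont_kap; apply: cont_cY; exact: c2. Qed.

Arguments c2X p : clear implicits.
Arguments ckap p : clear implicits.

(** The centre enters [to_hopf] only through a^2 d^2, and on [cX v = 0] this is -d^2 from both
    sides. *)
Lemma stage_hopf : homotopic (X := KD)
  (fun v => on_x (if cX v <= 0 then two_discs (2 * cX v) (kap (cY v)) 1 v else two_discs 0 1 1 v))
  (fun v => on_x (hopf v)).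
Proof.
apply: homotopic_eq (paste_homotopy
  (Lf := fun p => on_x (to_hopf (2 * cX p.2) (kap (cY p.2)) p.1 p.2))
  (Rt := fun p => on_x (to_hopf 0 1 p.1 p.2)) _ _ _ _).
- by move=> v /=; rewrite !to_hopf0; case: ifP.
- by move=> v /=; rewrite !to_hopf1; case: ifP.
- move=> t v t01 X0; apply: cont_on_x.
  refine (@cont_to_hopf _ _ snd (fun p => 2 * cX p.2) (fun p => kap (cY p.2)) fst (t, v)
    (c2 _) (c2X _) (ckap _) (c1 _) t01 _ _); first exact: left_norm.
  by move=> r1 s u; exact: left_align.
- move=> t v t01 X0; apply: cont_on_x.
  refine (@cont_to_hopf _ _ snd (fun _ => 0) (fun _ => 1) fst (t, v) (c2 _) _ _ (c1 _) t01 _ _);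
    try exact: cont_cst; first exact: right_norm.
  by move=> r1 s u; exact: right_align.
- move=> t v t01 X0 /=.
  suff [n1 n2] : num1 (2 * cX v) (kap (cY v)) v = num1 0 1 v /\ num2 (2 * cX v) (kap (cY v)) v = num2 0 1 v.
    by rewrite /to_hopf /lin1 /lin2 n1 n2.
  rewrite /num1 /num2 X0 mulr0 !mul0r !mulr0 !mul0r; split=> //.
  have [D0|Dp] := leP (cD v) 0.
    have -> : cD v = 0 by apply/le_anti; rewrite D0 cD_ge0.
    by rewrite expr0n !mulr0.
  by case: (half_plane_edge X0 Dp) => -[_ ->]; rewrite ?sqrrN.
- move=> t t01 /=; rewrite -[RHS](@P1_infty _ _ _ _ (vertex x) pt); congr P1.
  rewrite /to_hopf /lin1 /lin2 /lin3 /lin4 /num1 /num2 /cfrac /sfrac ifT // cD_infty.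
  rewrite /cX /cY /cZ /cC /ulast /=; apply/eqP; ring.
Qed.

Lemma stage_two_discs : homotopic (X := KD)
  (fun v => on_x (if cX v <= 0 then two_discs (2 * cX v) (kap (cY v)) 0 v else two_discs 0 1 0 v))
  (fun v => on_x (if cX v <= 0 then two_discs (2 * cX v) (kap (cY v)) 1 v else two_discs 0 1 1 v)).
Proof.
apply: homotopic_eq (paste_homotopy
  (Lf := fun p => on_x (two_discs (2 * cX p.2) (kap (cY p.2)) p.1 p.2))
  (Rt := fun p => on_x (two_discs 0 1 p.1 p.2)) _ _ _ _).
- by move=> v /=; case: ifP.
- by move=> v /=; case: ifP.
- move=> t v t01 X0; apply: cont_on_x.
  refine (@cont_two_discs _ _ snd (fun p => 2 * cX p.2) (fun p => kap (cY p.2)) fst (t, v)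
    (c2 _) (c2X _) (ckap _) (c1 _) t01 _); exact: left_norm.
- move=> t v t01 X0; apply: cont_on_x.
  refine (@cont_two_discs _ _ snd (fun _ => 0) (fun _ => 1) fst (t, v) (c2 _) _ _ (c1 _) t01 _);
    try exact: cont_cst; exact: right_norm.
- move=> t v t01 X0 /=; congr P1; rewrite X0 mulr0.
  have [D0|Dp] := leP (cD v) 0.
    by rewrite !two_discs_D0 //; apply/le_anti; rewrite D0 cD_ge0.
  by case: (half_plane_edge X0 Dp) => -[_ ->] //; rewrite -{1}oppr0 two_discsN.
- move=> t t01 /=; rewrite -[RHS](@P1_infty _ _ _ _ (vertex x) pt); congr P1.
  by rewrite two_discs_D0 // cD_infty.
Qed.

Let pair (a b : sphere R 2) : KD 2 := P2 (pairv x x) pt a b.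

Let cont_pair (T : topologicalType) (A B : T -> sphere R 2) p : cont_at A p -> cont_at B p ->
  cont_at (fun q => pair (A q) (B q)) p.
Proof. by move=> cA cB; apply: cont_P2 => //; exact: cont_cst. Qed.

(** One of the two points is at infinity, so the pair reduces to a single point labelled [x]. *)
Lemma pair_two_discs (a1 a2 : R) v : (0 < cD v -> 1 <= a1 ^+ 2 + a2 ^+ 2) ->
  pair (disc a1 a2 v) (disc (- a1) (- a2) v) = on_x (two_discs a1 a2 0 v).
Proof.
by move=> h; case: (two_discs0 h) => -[-> ->]; [exact: pairv_snd | exact: pairv_fst].
Qed.

Lemma pairC (a b : sphere R 2) : a = infty \/ b = infty -> pair a b = pair b a.
Proof. by case=> ->; rewrite /pair pairv_fst pairv_snd. Qed.

Lemma pair_infty : pair infty infty = base KD 2.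
Proof. exact: P2_infty. Qed.

Lemma disc_edge v : cX v = 0 ->
  pair (disc 0 (kap (cY v)) v) (disc 0 (- kap (cY v)) v) = pair (disc 0 1 v) (disc 0 (-1) v).
Proof.
move=> X0; have [D0|Dp] := leP (cD v) 0.
  by rewrite !disc_D0 //; apply/le_anti; rewrite D0 cD_ge0.
case: (half_plane_edge X0 Dp) => -[_ ->] //; rewrite opprK; apply: pairC.
have /(_ (fun _ => right_norm Dp)) := @disc_wedge R 0 1 v; rewrite oppr0.
by case; [right|left].
Qed.

(** The real part of the centres grows from 0 to 2 cX. The discs may overlap on the way, so two
    labelled points are carried; at the end |a| >= 1 and one of them is always at infinity. *)
Lemma stage_disc : homotopic (X := KD)
  (fun v => if cX v <= 0 then pair (disc 0 (kap (cY v)) v) (disc 0 (- kap (cY v)) v)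
            else pair (disc 0 1 v) (disc 0 (-1) v))
  (fun v => on_x (if cX v <= 0 then two_discs (2 * cX v) (kap (cY v)) 0 v else two_discs 0 1 0 v)).
Proof.
apply: homotopic_eq (paste_homotopy
  (Lf := fun p => pair (disc (p.1 * (2 * cX p.2)) (kap (cY p.2)) p.2)
                       (disc (- (p.1 * (2 * cX p.2))) (- kap (cY p.2)) p.2))
  (Rt := fun p => pair (disc 0 1 p.2) (disc 0 (-1) p.2)) _ _ _ _).
- by move=> v /=; rewrite mul0r oppr0.
- move=> v /=; rewrite mul1r; case: ifP => _.
    by rewrite pair_two_discs //; exact: left_norm.
  by rewrite -pair_two_discs ?oppr0 //; exact: right_norm.
- move=> t v t01 X0.
  have ca : cont_at (fun p : R * sphere R 3 => p.1 * (2 * cX p.2)) (t, v) := cont_mul (c1 _) (c2X _).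
  apply: cont_pair.
    exact: (@cont_disc _ _ snd _ (fun p => kap (cY p.2)) _ (c2 _) ca (ckap _)).
  exact: (@cont_disc _ _ snd _ _ _ (c2 _) (cont_opp ca) (cont_opp (ckap _))).
- move=> t v t01 X0; apply: cont_pair.
    by refine (@cont_disc _ _ snd (fun _ => 0) (fun _ => 1) _ (c2 _) _ _); exact: cont_cst.
  by refine (@cont_disc _ _ snd (fun _ => 0) (fun _ => -1) _ (c2 _) _ _); exact: cont_cst.
- by move=> t v t01 X0 /=; rewrite X0 !mulr0 oppr0; exact: disc_edge.
- by move=> t t01 /=; rewrite !disc_D0 ?cD_infty //; exact: pair_infty.
Qed.

(** The two discs separate from the common centre 0. At the start they coincide, and the merged
    point has the label [x x] on the left and the loop [beta x x] on the right; at the end they are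
    disjoint, and on the right each point has a constant label. *)
Lemma stage_swap : homotopic (X := KD)
  (fun v => if cX v <= 0 then P1 (vertex (tens x x)) pt (page v)
            else P1 (endo_simplex (beta_mor x x)) (edge_pt (2^-1 + cY v)) (page v))
  (fun v => if cX v <= 0 then pair (disc 0 (kap (cY v)) v) (disc 0 (- kap (cY v)) v)
            else pair (disc 0 1 v) (disc 0 (-1) v)).
Proof.
pose w := edge_simplex (swap_kmor x).
apply: homotopic_eq (paste_homotopy
  (Lf := fun p => pair (disc 0 (p.1 * kap (cY p.2)) p.2) (disc 0 (- (p.1 * kap (cY p.2))) p.2))
  (Rt := fun p => P2 w (edge_pt (2^-1 + cY p.2)) (disc 0 (- p.1) p.2) (disc 0 p.1 p.2) : KD 2) _ _ _ _).
- move=> v /=; rewrite mul0r oppr0 !disc00; case: ifP => _; first exact: pairv_fold.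
  exact: swap_fold.
- move=> v /=; rewrite mul1r; case: ifP => // _.
  have [D0|Dp] := leP (cD v) 0.
    by rewrite !disc_D0 ?P2_infty ?pair_infty //; apply/le_anti; rewrite D0 cD_ge0.
  have /(_ (fun _ => right_norm Dp)) := @disc_wedge R 0 1 v; rewrite oppr0.
  case=> ->; first by rewrite (swap_fst _ _ pt) /pair pairv_snd.
  by rewrite (swap_snd _ _ pt) /pair pairv_fst.
- move=> t v t01 X0.
  have ca : cont_at (fun p : R * sphere R 3 => p.1 * kap (cY p.2)) (t, v) := cont_mul (c1 _) (ckap _).
  apply: cont_pair.
    by refine (@cont_disc _ _ snd (fun _ => 0) _ _ (c2 _) _ ca); exact: cont_cst.
  by refine (@cont_disc _ _ snd (fun _ => 0) _ _ (c2 _) _ (cont_opp ca)); exact: cont_cst.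
- move=> t v t01 X0; apply: cont_P2.
  + apply: cont_edge; apply: cont_add; first exact: cont_cst.
    by apply: cont_cY; exact: c2.
  + by refine (@cont_disc _ _ snd (fun _ => 0) _ _ (c2 _) _ (cont_opp (c1 _))); exact: cont_cst.
  + by refine (@cont_disc _ _ snd (fun _ => 0) _ _ (c2 _) _ (c1 _)); exact: cont_cst.
- move=> t v t01 X0 /=; have [D0|Dp] := leP (cD v) 0.
    by rewrite !disc_D0 ?P2_infty ?pair_infty //; apply/le_anti; rewrite D0 cD_ge0.
  (* At the end 0 of [w] the pair is as on the left with [kap] equal to -1; at the end 1 the pair is
     exchanged, which matches [kap] equal to 1. *)
  case: (half_plane_edge X0 Dp) => -[h ->].
    by rewrite (swap0 _ pt) ?mulrN1 ?opprK //; lra.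
  by rewrite (swap1 _ pt) ?mulr1 //; lra.
- by move=> t t01 /=; rewrite !disc_D0 ?cD_infty //; exact: pair_infty.
Qed.

End Object.

End Stages.

(** * Open books labelled by an endomorphism *)

Section Loops.
Variables (R : realType) (D : picard).
Local Notation KD := (kspectrum R D).
Local Notation e := (gunit D).
Local Notation pt := (vertex_pt R).
Implicit Types v : sphere R 3.

(** The open book with monodromy [g]: as the page turns around the binding, the label runs once
    along [g] in the half [cX > 0]. The parameter 1/2 + cY is cut off to [0, 1] by [edge_pt]. *)
Definition ob_loop (y : ob D) g (mg : is_mor g y y) v : KD 2 :=
  if cX v <= 0 then P1 (vertex y) pt (page v)
  else P1 (endo_simplex mg) (edge_pt (2^-1 + cY v)) (page v).

Let c1 (p : R * sphere R 3) := @cont_fst R (sphere R 3) p.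
Let c2 (p : R * sphere R 3) := @cont_snd R (sphere R 3) p.
Arguments c1 p : clear implicits.
Arguments c2 p : clear implicits.

Let cpage (p : R * sphere R 3) : cont_at (fun q => page q.2) p.
Proof. by apply: cont_page; exact: c2. Qed.
Arguments cpage p : clear implicits.

Let cY2 (p : R * sphere R 3) : cont_at (fun q => 2^-1 + cY q.2) p.
Proof. by apply: cont_add; [exact: cont_cst | apply: cont_cY; exact: c2]. Qed.
Arguments cY2 p : clear implicits.

(** A deformation of [page] to infinity. The term 2 s keeps the numerator nonzero when 1 - s
    vanishes, since cC >= -1; the term s (1 - cC) keeps the denominator nonzero for 0 < s < 1 except
    at the basepoint, where cC = 1. *)
Definition fading_page (s : R) v : sphere R 2 :=
  rfrac (cZ v) (cC v + 2 * s) ((1 - s) * (cD v ^+ 2 + s * (1 - cC v))).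

Lemma fading_page0 v : fading_page 0 v = page v.
Proof. by rewrite /fading_page mulr0 addr0 subr0 mul0r addr0 mul1r. Qed.

Lemma fading_page1 v : fading_page 1 v = infty.
Proof. by rewrite /fading_page subrr mul0r rfrac0. Qed.

Lemma fading_page_infty s : fading_page s infty = infty.
Proof. by rewrite /fading_page cD_infty /cC /ulast /= subr0 subrr expr0n mulr0 addr0 mulr0 rfrac0. Qed.

Lemma cont_fading_page t v : 0 <= t <= 1 -> cont_at (fun q => fading_page q.1 q.2) (t, v).
Proof.
move=> /andP[t0 t1].
have ct := c1 (t, v); have cc := cont_cC (c2 (t, v)); have o := @cont_cst _ _ (1 : R) (t, v).
apply: cont_rfrac.
- by apply: cont_cZ; exact: c2.
- by apply: cont_add => //; apply: cont_mul => //; exact: cont_cst.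
- apply: cont_mul; first by apply: cont_add => //; exact: cont_opp.
  apply: cont_add; first by apply: cont_exp; apply: cont_cD; exact: c2.
  by apply: cont_mul => //; apply: cont_add => //; exact: cont_opp.
apply/negPn/negP; rewrite !negb_or !negbK => /and3P[/eqP /= z0 /eqP /= c0 /eqP /= d0].
have U := unit_sphere3 v; have [x2 y2] := conj (sqr_ge0 (cX v)) (sqr_ge0 (cY v)).
have cc1 : -1 <= cC v <= 1 by move: U; rewrite z0 => U; apply/andP; split; nra.
have d2 := sqr_ge0 (cD v).
have t1' : t < 1 by rewrite lt_neqAle t1 andbT; apply/eqP => te; move: c0; rewrite te; lra.
have e0 : cD v ^+ 2 + t * (1 - cC v) = 0.
  by move/eqP: d0; rewrite mulf_eq0 subr_eq0 gt_eqF //= => /eqP.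
have tC : 0 <= t * (1 - cC v) by rewrite mulr_ge0 // subr_ge0; lra.
have D0 : cD v = 0 by apply/eqP; rewrite -sqrf_eq0; apply/eqP; lra.
have := cD_eq0 D0.
have : t * (1 - cC v) = 0 by lra.
move/eqP; rewrite mulf_eq0 => /orP[/eqP tz|/eqP c1z]; nra.
Qed.

(** The point labelled [y X] is split into two coinciding points labelled [y] and [X]; the second,
    whose label does not move, is then pushed to infinity. *)
Lemma ob_loop_rten (y X : ob D) g (mg : is_mor g y y) :
  homotopic (X := KD) (ob_loop (rten_mor X mg)) (ob_loop mg).
Proof.
pose w := edge_simplex (act_kmor X mg).
apply: homotopic_eq (paste_homotopy
  (Lf := fun p => P2 (pairv y X) pt (page p.2) (fading_page p.1 p.2) : KD 2)
  (Rt := fun p => P2 w (edge_pt (2^-1 + cY p.2)) (page p.2) (fading_page p.1 p.2) : KD 2) _ _ _ _).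
- by move=> v /=; rewrite fading_page0 /ob_loop pairv_fold act_fold.
- by move=> v /=; rewrite fading_page1 /ob_loop pairv_fst act_fst.
- move=> t v t01 X0; apply: cont_P2; [exact: cont_cst | exact: cpage | exact: cont_fading_page].
- move=> t v t01 X0; apply: cont_P2; [exact: cont_edge (cY2 _) | exact: cpage | exact: cont_fading_page].
- move=> t v t01 X0 /=; have [D0|Dp] := leP (cD v) 0.
    by rewrite page_D0 ?pairv_snd ?(act_snd _ _ _ pt) //; apply/le_anti; rewrite D0 cD_ge0.
  rewrite /w (act_end _ _ pt) //.
  by case: (half_plane_edge X0 Dp) => -[h _]; apply/orP; [left|right]; lra.
- by move=> t t01 /=; rewrite page_D0 ?cD_infty // fading_page_infty P2_infty.
Qed.

(** A square with loop coordinate [tau] and homotopy coordinate is cut along its diagonal [h f] into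
    [T1], on f then h, and [T2], on h then g and filled by the given 2-cell. On the sides [tau = 0]
    and [tau = 1] the label runs along [h], as it does on the left half. *)
Lemma ob_loop_conj (y : ob D) g f h (mg : is_mor g y y) (mf : is_mor f e e) (mh : is_mor h e y) :
  iso1 (h \c f) (g \c h) -> homotopic (X := KD) (ob_loop mf) (ob_loop mg).
Proof.
move=> /iso1_sym [a ca _]; have mhf := is_mor_comp mf mh.
have c0 : is_cell (id2 (h \c f)) (h \c f) (h \c f) by split; rewrite ?dom_id2 ?cod_id2.
pose T1 := tri_simplex mf mh mhf c0; pose T2 := tri_simplex mh mg mhf ca.
pose tau v := clamp (2^-1 + cY v); have tau01 v : 0 <= tau v <= 1 := clamp_itv _.
pose Rt (p : R * sphere R 3) : KD 2 := if tau p.2 - p.1 <= 0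
  then P1 T2 (tri_pt (tau p.2) p.1) (page p.2) else P1 T1 (tri_pt p.1 (tau p.2)) (page p.2).
have zero01 : ((0 : R) <= 0) && ((0 : R) <= 1) by rewrite lexx ler01.
have one01 : ((0 : R) <= 1) && ((1 : R) <= 1) by rewrite lexx ler01.
have Rt0 v : Rt (0, v) = P1 (endo_simplex mf) (edge_pt (2^-1 + cY v)) (page v).
  rewrite /Rt /= subr0 endo_edgeE -[edge_pt (_ + _)]edge_pt_clamp -/(tau v); case: ifP => [t0|_].
    have -> : tau v = 0 by apply/le_anti; rewrite t0; case/andP: (tau01 v).
    by rewrite P1_tri02 // !(P1_edge0 _ pt).
  by rewrite P1_tri01.
have Rt1 v : Rt (1, v) = P1 (endo_simplex mg) (edge_pt (2^-1 + cY v)) (page v).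
  rewrite /Rt /= endo_edgeE -[edge_pt (_ + _)]edge_pt_clamp -/(tau v) ifT ?P1_tri12 //.
  by rewrite subr_le0; case/andP: (tau01 v).
apply: homotopic_eq (paste_homotopy
  (Lf := fun p => P1 (edge_simplex (kmor1 mh)) (edge_pt p.1) (page p.2) : KD 2) (Rt := Rt) _ _ _ _).
- by move=> v; rewrite /ob_loop Rt0 /= (P1_edge0 _ pt).
- by move=> v; rewrite /ob_loop Rt1 /= (P1_edge1 _ pt).
- by move=> t v t01 X0; apply: cont_P1; [apply: cont_edge; exact: c1 | exact: cpage].
- move=> t v t01 X0.
  have ctau : cont_at (fun p : R * sphere R 3 => tau p.2) (t, v) := cont_clamp (cY2 _).
  refine (@cont_paste _ _ _ (fun p : R * sphere R 3 => tau p.2 - p.1)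
    (fun p => P1 T2 (tri_pt (tau p.2) p.1) (page p.2)) (fun p => P1 T1 (tri_pt p.1 (tau p.2)) (page p.2))
    (t, v) _ _ _ _).
  + by apply: cont_add => //; apply: cont_opp; exact: c1.
  + by move=> _; apply: cont_P1; [apply: cont_tri => //; exact: c1 | exact: cpage].
  + by move=> _; apply: cont_P1; [apply: cont_tri => //; exact: c1 | exact: cpage].
  + move=> /= /eqP; rewrite subr_eq0 => /eqP ->.
    by rewrite !P1_tri02.
- move=> t v t01 X0 /=; have [D0|Dp] := leP (cD v) 0.
    rewrite /Rt /= page_D0; last by apply/le_anti; rewrite D0 cD_ge0.
    by case: ifP => _; rewrite !P1_infty.
  case: (half_plane_edge X0 Dp) => -[h0 _]; rewrite /Rt /=.
    have -> : tau v = 0 by apply: clamp_le0; lra.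
    by rewrite ifT ?P1_tri01 // sub0r oppr_le0; case/andP: t01.
  have -> : tau v = 1 by apply: clamp_ge1; lra.
  case: ifP => [t1|_]; last by rewrite P1_tri12.
  have -> : t = 1 by apply/le_anti; case/andP: t01 => _ ->; lra.
  by rewrite P1_tri12 // !(P1_edge1 _ pt).
- by move=> t t01 /=; rewrite page_D0 ?cD_infty // P1_infty.
Qed.

(** Points labelled [e] can be deleted, so the open book factors as the suspended loop after
    [pole_map] with k = 1/2. Four chords join that map of the 3-sphere to the identity. *)
Lemma ob_loop_unit f (mf : is_mor f e e) :
  homotopic (X := KD) (ob_loop mf) (suspn 2 (loop_map R mf : sphere R 1 -> KD 0)).
Proof.
set L := suspn 2 _; have cL : continuous L := @loop_class2_continuous R D f mf.
have L0 : L infty = base KD 2 by [].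
have E v : L (pole_map 2^-1 v) = ob_loop mf v.
  rewrite /L loop_class2E /pole_map /ob_loop; case: (ltP 0 (cX v)) => X0 /=; last by rewrite P1_unit.
  case: (ltP 0 (cD v)) => D0 /=; last first.
    by rewrite page_D0 ?P1_infty //; apply/le_anti; rewrite D0 cD_ge0.
  have [-> -> ->] := row3E (cZ v / cD v ^+ 2) (cC v / cD v ^+ 2) (2^-1 + cY v / Num.min 1 (2 * cX v)).
  have -> : page v = Some (row2 (cZ v / cD v ^+ 2) (cC v / cD v ^+ 2)).
    by rewrite /page rfrac_neq0 // expf_neq0 // gt_eqF.
  (* If cX < 1/2 and [cD] is positive, then |cY| > 1/2: with or without the division, the parameter
     lies beyond the same end of the edge. *)
  case: (lerP 1 (2 * cX v)) => h; first by rewrite divr1.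
  have DE := cD_gt0 D0.
  have X2 : 0 < 2 * cX v by lra.
  have Y2 : 4^-1 < cY v ^+ 2 by nra.
  have [Yn|Yp] := leP (cY v) 0.
    have Y1 : cY v <= - 2^-1 by nra.
    have Y3 : cY v / (2 * cX v) <= - 2^-1 by rewrite ler_pdivrMr //; nra.
    by rewrite !(vertexE mf pt) //; apply/orP; left; lra.
  have Y1 : 2^-1 <= cY v by nra.
  have Y3 : 2^-1 <= cY v / (2 * cX v) by rewrite ler_pdivlMr //; nra.
  by rewrite !(vertexE mf pt) //; apply/orP; right; lra.
have p0 k : pole_map k (infty : sphere R 3) = infty by rewrite /pole_map cD_infty ltxx andbF.
have cid : continuous (fun v : sphere R 3 => v) by move=> ?; exact: cvg_id.
have h1 := chord (@pole_map_continuous R 2^-1) (@pole_map_continuous R 0) (@pole_map_shift R) (p0 _) (p0 _) cL L0.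
have h2 := chord (@pole_map_continuous R 0) (@shift_cycle_continuous R) (@pole_map_shift_cycle R) (p0 _) erefl cL L0.
have h3 := chord (@shift_cycle_continuous R) (@cycle3_continuous R) (@shift_cycle_cycle3 R) erefl erefl cL L0.
have h4 := chord (@cycle3_continuous R) cid (@cycle3_id R) erefl erefl cL L0.
apply: homotopic_eq E (fun v => erefl (L v)) _.
exact: homotopic_trans (homotopic_trans (homotopic_trans h1 h2) h3) h4.
Qed.

Lemma eta_homotopic (x : ob D) (f : loop D) : k0_map (ob_class x) = loop_class f ->
  homotopic (X := KD) (fun v => ob_class2 x (hopf v)) (loop_class2 f).
Proof.
rewrite k0_mapE => /loop_classP xf.
have [X [h [mh hf]]] := transports_iso (svalP (beta_loop x)) xf (beta_loopP x).
apply: homotopic_eq (fun v => esym (ob_class2E x (hopf v))) (fun _ => erefl) _.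
apply: homotopic_trans (homotopic_sym (stage_hopf R x)) _.
apply: homotopic_trans (homotopic_sym (stage_two_discs R x)) _.
apply: homotopic_trans (homotopic_sym (stage_disc R x)) _.
apply: homotopic_trans (homotopic_sym (stage_swap R x)) _.
apply: homotopic_trans (homotopic_sym (ob_loop_rten X (beta_mor x x))) _.
apply: homotopic_trans (homotopic_sym (ob_loop_conj (rten_mor X (beta_mor x x)) (svalP f) mh hf)) _.
exact: ob_loop_unit.
Qed.

End Loops.

(** * Suspensions and glued nullhomotopies *)

Section Smash.
Variables (R : realType) (P Y : topologicalType).

Definition vhead m (r : 'rV[R]_m.+1) : sphere R 1 := Some (\row_(j < 1) r 0 ord0).
Definition vtail m (r : 'rV[R]_m.+1) : sphere R m := Some (\row_(j < m) r 0 (lift ord0 j)).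

Lemma cont_pair (T U V : topologicalType) (f : T -> U) (g : T -> V) p :
  cont_at f p -> cont_at g p -> cont_at (fun x => (f x, g x)) p.
Proof. exact: cvg_pair. Qed.

Lemma sphere_compact m : compact [set: sphere R m].
Proof. exact: one_point_compactification_compact. Qed.

Lemma cont_coord m (r : 'rV[R]_m) i :
  cont_at (fun v : sphere R m => if v is Some w then w 0 i else 0) (Some r).
Proof. by apply: cont_at_Some; exact: coord_continuous. Qed.

Lemma nsq_recl m (r : 'rV[R]_m.+1) :
  nsq r = r 0 ord0 ^+ 2 + nsq (\row_(j < m) r 0 (lift ord0 j)).
Proof.
by rewrite /nsq big_ord_recl; congr (_ + _); apply: eq_bigr => j _; rewrite mxE.
Qed.

(** Near infinity the head or the tail of the vector is large. Since spheres are compact, the tube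
    lemma makes the condition at an infinite head uniform in the tail, and conversely. *)
Lemma smash_family m (Phi : P * (sphere R 1 * sphere R m) -> Y) (y0 : Y) : continuous Phi ->
  (forall p w, Phi (p, (infty, w)) = y0) -> (forall p s, Phi (p, (s, infty)) = y0) ->
  continuous (fun q : P * sphere R m.+1 =>
    if q.2 is Some r then Phi (q.1, (vhead r, vtail r)) else y0).
Proof.
move=> cPhi Ph Pt; apply: contP => -[p [r|]].
  pose co (v : sphere R m.+1) i := if v is Some w then w 0 i else 0.
  have cco i : cont_at (fun q : P * sphere R m.+1 => co q.2 i) (p, Some r).
    by apply: (@cont_at_comp _ _ _ snd (fun v => co v i)); [exact: cont_snd | exact: cont_coord].
  pose hd (q : P * sphere R m.+1) : sphere R 1 := Some (\row_(j < 1) co q.2 ord0).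
  pose tl (q : P * sphere R m.+1) : sphere R m := Some (\row_(j < m) co q.2 (lift ord0 j)).
  have chd : cont_at hd (p, Some r).
    by apply: cont_Some; apply: cont_mx => i j; apply: (cont_eq (fun x => mxE _ _ _ _)); exact: cco.
  have ctl : cont_at tl (p, Some r).
    by apply: cont_Some; apply: cont_mx => i j; apply: (cont_eq (fun x => mxE _ _ _ _)); exact: cco.
  apply: (@cont_at_near _ _ (fun q => Phi (q.1, (hd q, tl q)))).
    by apply: (@cont_app _ _ _ Phi) => //; apply: cont_pair; [exact: cont_fst | exact: cont_pair].
  have n1 : nbhs (Some r : sphere R m.+1) [set v | v <> infty].
    by apply: (@filterS _ (nbhs r) _ setT) => //; exact: filterT.
  exists (setT, [set v | v <> infty]); first by split=> //=; exact: filterT.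
  by move=> [q [w|]] [].
move=> A /=; rewrite nbhsE => -[V [oV Vy] VA].
have c1 (q : (P * sphere R 1) * sphere R m) : cont_at (fun q => Phi (q.1.1, (q.1.2, q.2))) q.
  have [cf cs] := conj (@cont_fst _ _ q) (@cont_snd _ _ q).
  by apply: cont_app => //; apply: cont_pair; [|apply: cont_pair] => //;
    apply: cont_app cf; move=> ?; [exact: cont_fst | exact: cont_snd].
have c2 (q : (P * sphere R m) * sphere R 1) : cont_at (fun q => Phi (q.1.1, (q.2, q.1.2))) q.
  have [cf cs] := conj (@cont_fst _ _ q) (@cont_snd _ _ q).
  by apply: cont_app => //; apply: cont_pair; [|apply: cont_pair] => //;
    apply: cont_app cf; move=> ?; [exact: cont_fst | exact: cont_snd].
have h1 w : [set: sphere R m] w -> V (Phi (p, (infty, w))) by rewrite Ph.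
have h2 s : [set: sphere R 1] s -> V (Phi (p, (s, infty))) by rewrite Pt.
have := tube (p := (p, infty)) (@sphere_compact 1) oV (fun k _ => c2 _) h2.
have := tube (p := (p, infty)) (@sphere_compact m) oV (fun k _ => c1 _) h1.
move=> [[U1 S1] [/= nU1 /nbhs_inftyP[_ [B1 HB1]]] H1].
move=> [[U2 S2] [/= nU2 /nbhs_inftyP[_ [B2 HB2]]] H2].
exists (U1 `&` U2, [set v | v = infty \/ exists2 r, v = Some r & B1 + B2 < nsq r]) => /=.
  split; first exact: filterI.
  by apply/nbhs_inftyP; split; [left | exists (B1 + B2) => v hv; right; exists v].
move=> [p' v] [/= [p1 p2] [->|[r -> hr]]] /=; first exact: VA.
apply: VA; move: hr; rewrite nsq_recl => hr.
have [h|h] := ltP B1 (r 0 ord0 ^+ 2).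
  apply: (H1 (p', vhead r) _ (vtail r)) => //; split=> //=; apply: HB1.
  by rewrite /nsq big_ord1 mxE.
apply: (H2 (p', vtail r) _ (vhead r)) => //; split=> //=; apply: HB2; lra.
Qed.

End Smash.

Section Families.
Variables (R : realType) (X : prespectrum R).

Lemma within_clamp (T U : topologicalType) (H : R * T -> U) :
  {within (`[0, 1] : set R) `*` setT, continuous H} ->
  continuous (fun p : R * T => H (clamp p.1, p.2)).
Proof.
move=> /subspace_continuousP cH; apply: contP => p A.
have p01 : ((`[0, 1] : set R) `*` [set: T]) (clamp p.1, p.2).
  by split=> //=; rewrite in_itv /= clamp_itv.
move=> /(cH _ p01) nA.
have cc : cont_at (fun p : R * T => (clamp p.1, p.2)) p.
  by apply: cont_pair; [apply: cont_clamp; exact: cont_fst | exact: cont_snd].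
apply: (@filterS _ _ (nbhs_filter p) _ _ _ (cc _ nA)) => q h; apply: h.
by split=> //=; rewrite in_itv /= clamp_itv.
Qed.

(** The arbitrary parameter space covers single maps, homotopies and two-parameter families at
    once. *)
Definition based_family (P : topologicalType) m n (f : P * sphere R m -> X n) : Prop :=
  continuous f /\ forall p, f (p, infty) = base X n.

Hypothesis pX : is_prespectrum X.

Lemma family_susp (P : topologicalType) m n (f : P * sphere R m -> X n) : based_family f ->
  based_family (fun q : P * sphere R m.+1 => susp (fun v => f (q.1, v)) q.2).
Proof.
have [cs sb si] := pX n; case=> cf f0; split=> //.
apply: (@smash_family R P (X n.+1) m (fun q => struct q.2.1 (f (q.1, q.2.2))) (base X n.+1)).
- apply: contP => q.
  have [c1 c2] := conj (@cont_fst _ _ q) (@cont_snd _ _ q).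
  apply: (@cont_app _ _ _ (fun ty : sphere R 1 * X n => struct ty.1 ty.2)
    (fun q : P * (sphere R 1 * sphere R m) => (q.2.1, f (q.1, q.2.2)))) => //.
  apply: cont_pair; first by apply: (@cont_app _ _ _ fst _ _ _ c2); move=> ?; exact: cont_fst.
  apply: (@cont_app _ _ _ f) => //; apply: cont_pair => //.
  by apply: (@cont_app _ _ _ snd _ _ _ c2); move=> ?; exact: cont_snd.
- by move=> p w; exact: si.
- by move=> p s; rewrite /= f0; exact: sb.
Qed.

Lemma family_suspn (P : topologicalType) N m n (f : P * sphere R m -> X n) : based_family f ->
  based_family (fun q : P * sphere R (N + m) => suspn N (fun v => f (q.1, v)) q.2).
Proof.
move=> ff; elim: N => [|N IH].
  by rewrite (_ : (fun q => _) = f) //; apply/funext => -[].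
exact: (family_susp IH).
Qed.

Lemma pmap_suspn N m n (f : sphere R m -> X n) : is_pmap f -> is_pmap (suspn N f).
Proof.
move=> [cf f0]; have [cF Fb] : based_family (fun q : R * sphere R (N + m) => suspn N (fun v => f v) q.2).
  apply: (@family_suspn R N _ _ (fun q => f q.2)); split=> // q.
  by apply: cont_app cf _; exact: cont_snd.
split; last exact: (Fb 0).
apply: contP => v; apply: (@cont_app _ _ _ (fun q : R * sphere R (N + m) => suspn N (fun v => f v) q.2)
  (fun v => (0, v))) => //.
by apply: cont_pair; [exact: cont_cst | exact: cvg_id].
Qed.

Lemma susp_base m n : susp (fun _ : sphere R m => base X n) = fun _ => base X n.+1.
Proof. by have [_ sb _] := pX n; apply/funext => -[r|] //=. Qed.

Lemma suspn_base N m n : suspn N (fun _ : sphere R m => base X n) = fun _ => base X (N + n).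
Proof. by elim: N => //= N ->; rewrite susp_base. Qed.

Lemma homotopic_susp m n (f g : sphere R m -> X n) : homotopic f g -> homotopic (susp f) (susp g).
Proof.
case=> H [cH H0 H1 Hb].
have [cS Sb] := family_susp (conj cH Hb).
exists (fun q : R * sphere R m.+1 => susp (fun v => H (q.1, v)) q.2); split=> //= v.
  by rewrite (_ : (fun v => _) = f) //; exact/funext.
by rewrite (_ : (fun v => _) = g) //; exact/funext.
Qed.

Lemma is_homotopyW m n (f g : sphere R m -> X n) H : is_homotopy H f g -> homotopic f g.
Proof.
case=> cH H0 H1 Hb; exists (fun p => H (clamp p.1, p.2)); split=> [|v|v|t] /=.
- exact: within_clamp.
- by rewrite clamp_le0.
- by rewrite clamp_ge1.
- exact: Hb (clamp_itv t).
Qed.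

Definition stably_at N m n (f g : sphere R m -> X n) : Prop := homotopic (suspn N f) (suspn N g).

Lemma stably_atD K N m n (f g : sphere R m -> X n) : stably_at N f g -> stably_at (K + N) f g.
Proof. by move=> h; elim: K => //= K IH; exact: (homotopic_susp IH). Qed.

Lemma stably_equalP m n (f g : sphere R m -> X n) : stably_equal f g <-> exists N, stably_at N f g.
Proof.
split=> [[N [H hH]]|[N hN]]; exists N; first exact: is_homotopyW hH.
exact: homotopicW.
Qed.

Lemma stably_equal_trans m n (g f h : sphere R m -> X n) :
  stably_equal f g -> stably_equal g h -> stably_equal f h.
Proof.
move=> /stably_equalP[N fg] /stably_equalP[K gh]; apply/stably_equalP; exists (K + N)%N.
have gh' : stably_at (K + N) g h by rewrite addnC; exact: stably_atD.
exact: homotopic_trans (stably_atD K fg) gh'.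
Qed.

Lemma stably_equal_sym m n (f g : sphere R m -> X n) : stably_equal f g -> stably_equal g f.
Proof. by move=> /stably_equalP[N h]; apply/stably_equalP; exists N; exact: homotopic_sym. Qed.

Lemma homotopic_stably m n (f g : sphere R m -> X n) : homotopic f g -> stably_equal f g.
Proof. by move=> h; apply/stably_equalP; exists 0%N. Qed.

Lemma suspn_ext N m n (f g : sphere R m -> X n) (r s : 'rV[R]_(N + m)) :
  (forall i : 'I_N, r 0 (lshift m i) = s 0 (lshift m i)) ->
  f (Some (\row_j r 0 (rshift N j))) = g (Some (\row_j s 0 (rshift N j))) ->
  suspn N f (Some r) = suspn N g (Some s).
Proof.
elim: N r s => [|N IH] r s rs fg.
  have E (u : 'rV[R]_m) : \row_j u 0 (rshift 0 j) = u.
    by apply/rowP => j; rewrite mxE; congr (u 0 _); exact: ord_inj.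
  by rewrite /= -(E r) -(E s).
change (struct (vhead (r : 'rV_(N + m).+1)) (suspn N f (vtail (r : 'rV_(N + m).+1)))
  = struct (vhead (s : 'rV_(N + m).+1)) (suspn N g (vtail (s : 'rV_(N + m).+1)))).
congr struct.
  congr Some; apply/rowP => j; rewrite !mxE.
  by have := rs ord0; rewrite (_ : lshift m (ord0 : 'I_N.+1) = (ord0 : 'I_(N + m).+1) :> 'I_(N + m).+1) //; exact: ord_inj.
apply: IH => [i|].
  rewrite !mxE; have := rs (lift ord0 i).
  by rewrite (_ : lshift m (lift ord0 i) = lift ord0 (lshift m i) :> 'I_(N + m).+1) //; exact: ord_inj.
have E (u : 'rV[R]_(N.+1 + m)) :
    \row_j (\row_(j < N + m) u 0 (lift ord0 j)) 0 (rshift N j) = \row_j u 0 (rshift N.+1 j).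
  by apply/rowP => j; rewrite !mxE; congr (u 0 _); exact: ord_inj.
by rewrite !E.
Qed.

End Families.

Section Precomposition.
Variables (R : realType) (X : prespectrum R).
Hypothesis struct_base : forall n t, struct t (base X n) = base X n.+1.

Lemma susp_comp m m' n (g : sphere R m -> X n) (phi : sphere R m' -> sphere_prespectrum R m) :
  g infty = base X n ->
  susp (fun v => g (phi v)) = fun v => susp g (susp phi v).
Proof.
move=> g0; apply/funext => -[r|] //=.
case E : (phi _) => [w|] /=; last by rewrite g0 struct_base.
have -> : (\row_(j < 1) row_mx (\row__ r 0 ord0 : 'rV_1) w 0 ord0) = \row_(j < 1) r 0 ord0 :> 'rV[R]_1.
  by apply/rowP => j; rewrite !mxE; case: splitP => k; rewrite ?ord1 ?mxE.
congr (struct _ (g _)); congr Some; apply/rowP => j; rewrite !mxE.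
by case: splitP => k /=; rewrite ?ord1 //= => -[/ord_inj <-].
Qed.

Lemma suspn_comp N m m' n (g : sphere R m -> X n) (phi : sphere R m' -> sphere_prespectrum R m) :
  g infty = base X n -> phi infty = infty ->
  suspn N (fun v => g (phi v)) = fun v => suspn N g (suspn N phi v).
Proof.
move=> g0 p0; elim: N => [|N IH] //.
transitivity (susp (fun v => suspn N g (suspn N phi v))); first by rewrite -IH.
by apply: (@susp_comp _ _ _ (suspn N g) (suspn N phi)); case: (N).
Qed.

End Precomposition.

(** * The sphere prespectrum *)

Section SpherePrespectrum.
Variable R : realType.

Lemma nsq_row_mx m n (t : 'rV[R]_m) (s : 'rV[R]_n) : nsq (row_mx t s) = nsq t + nsq s.
Proof.
rewrite /nsq big_split_ord; congr (_ + _); apply: eq_bigr => i _.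
  by rewrite row_mxEl.
by rewrite row_mxEr.
Qed.

Lemma sphere_prespectrumP : is_prespectrum (sphere_prespectrum R).
Proof.
move=> n; split=> [|t|y] //; last by case: t.
have inf (t : sphere R 1) (s : sphere R n) : t = infty \/ s = infty ->
    cont_at (fun ty : sphere R 1 * sphere R n => smash ty.1 ty.2) (t, s).
  move=> ts A; have -> : smash (t, s).1 (t, s).2 = infty by case: ts => ->; case: (t).
  move=> /nbhs_inftyP[A0 [B AB]].
  have nB k : nbhs (infty : sphere R k) [set v | forall v', v = Some v' -> B < nsq v'].
    by apply/nbhs_inftyP; split => //; exists B => v hv v' [<-].
  case: ts => ->; [exists ([set v | forall v', v = Some v' -> B < nsq v'], setT)
    | exists (setT, [set v | forall v', v = Some v' -> B < nsq v'])];
    try by split=> //; exact: filterT.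
    move=> [[t'|] [s'|]] [/= h _] //; apply: AB.
    by rewrite nsq_row_mx; apply: lt_le_trans (h _ erefl) _; rewrite lerDl nsq_ge0.
  move=> [[t'|] [s'|]] [/= _ h] //; apply: AB.
  by rewrite nsq_row_mx; apply: lt_le_trans (h _ erefl) _; rewrite lerDr nsq_ge0.
apply: contP => -[[t|] [s|]]; try by [apply: inf; left | apply: inf; right].
move=> A nA.
have cm : cont_at (fun q : 'rV[R]_1 * 'rV[R]_n => row_mx q.1 q.2) (t, s).
  apply: cont_mx => i j; apply: (cont_eq (fun q => mxE _ _ _ _)).
  case: (fintype.split j) => k.
    apply: (@cont_app _ _ _ (fun w : 'rV[R]_1 => w i k)); first exact: coord_continuous.
    exact: cont_fst.
  apply: (@cont_app _ _ _ (fun w : 'rV[R]_n => w i k)); first exact: coord_continuous.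
  exact: cont_snd.
have [[U1 U2] [/= n1 n2] sU] := cm _ nA.
exists ([set v : sphere R 1 | exists2 w, v = Some w & U1 w],
        [set v : sphere R n | exists2 w, v = Some w & U2 w]).
  split=> /=.
    by apply: (@filterS _ (nbhs t) _ U1) => // w hw; exists w.
  by apply: (@filterS _ (nbhs s) _ U2) => // w hw; exists w.
by move=> [v1 v2] [/= [w1 -> h1] [w2 -> h2]]; exact: (sU (w1, w2)).
Qed.

End SpherePrespectrum.

(** * Gluing two nullhomotopies *)

Section Glue.
Variables (R : realType) (X : prespectrum R).

(** The glued map is a function of head and tail, so [smash_family] applies; once the head leaves
    [-1, 1] both halves are at the basepoint, which gives continuity at an infinite head. *)
Lemma glue_family (P : topologicalType) m n (A B : P * (R * sphere R m) -> X n) :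
  continuous A -> continuous B -> (forall p w, A (p, (0, w)) = B (p, (0, w))) ->
  (forall p t w, 1 <= t -> A (p, (t, w)) = base X n) ->
  (forall p t w, 1 <= t -> B (p, (t, w)) = base X n) ->
  (forall p t, A (p, (t, infty)) = base X n) -> (forall p t, B (p, (t, infty)) = base X n) ->
  based_family (fun q : P * sphere R m.+1 => glue (fun tv => A (q.1, tv)) (fun tv => B (q.1, tv)) q.2).
Proof.
move=> cA cB AB A1 B1 Ai Bi; split=> //.
pose co (s : sphere R 1) : R := if s is Some w then w 0 0 else 0.
pose K (t : R) p w := if - t <= 0 then A (p, (Num.min t 1, w)) else B (p, (Num.min (- t) 1, w)).
pose Phi (q : P * (sphere R 1 * sphere R m)) :=
  if q.2.1 is Some r then K (r 0 0) q.1 q.2.2 else base X n.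
have -> : (fun q : P * sphere R m.+1 => glue (fun tv => A (q.1, tv)) (fun tv => B (q.1, tv)) q.2)
  = (fun q : P * sphere R m.+1 => if q.2 is Some r then Phi (q.1, (vhead r, vtail r)) else base X n).
  by apply/funext => -[p [r|]] //; rewrite /Phi /K /= mxE oppr_le0.
apply: smash_family => [|p w|p s] //; last first.
  by rewrite /Phi /K /=; case: s => [r|] //; case: ifP.
apply: contP => -[p [s w]].
have c1 : cont_at fst (p, (s, w)) by exact: cont_fst.
have c2 : cont_at (fun q : P * (sphere R 1 * sphere R m) => q.2.1) (p, (s, w)).
  by apply: (@cont_app _ _ _ fst snd); [move=> ?; exact: cont_fst | exact: cont_snd].
have c3 : cont_at (fun q : P * (sphere R 1 * sphere R m) => q.2.2) (p, (s, w)).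
  by apply: (@cont_app _ _ _ snd snd); [move=> ?; exact: cont_snd | exact: cont_snd].
case: s c1 c2 c3 => [r|] c1 c2 c3; last first.
  apply: (@cont_at_near _ _ (fun _ => base X n)); first exact: cont_cst.
  have : nbhs (infty : sphere R 1) [set v | forall v', v = Some v' -> 1 < nsq v'].
    by apply/nbhs_inftyP; split => //; exists 1 => v hv v' [<-].
  move=> /(c2 _); apply: (@filterS _ _ (nbhs_filter _)) => -[q [[r|] u]] //= /(_ _ erefl).
  rewrite /nsq big_ord1 /Phi /K /= => r1; case: ifP => [h|/negbT h].
    by rewrite A1 // le_min lexx andbT; nra.
  by rewrite B1 // le_min lexx andbT; nra.
have cco : cont_at (fun q : P * (sphere R 1 * sphere R m) => co q.2.1) (p, (Some r, w)).
  by apply: (@cont_at_comp _ _ _ (fun q : P * (sphere R 1 * sphere R m) => q.2.1) co) => //; exact: cont_coord.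
have one := @cont_cst (P * (sphere R 1 * sphere R m))%type _ (1 : R) (p, (Some r, w)).
apply: (@cont_at_near _ _ (fun q => K (co q.2.1) q.1 q.2.2)).
  refine (@cont_paste _ _ _ (fun q : P * (sphere R 1 * sphere R m) => - co q.2.1)
    (fun q => A (q.1, (Num.min (co q.2.1) 1, q.2.2)))
    (fun q => B (q.1, (Num.min (- co q.2.1) 1, q.2.2))) (p, (Some r, w)) (cont_opp cco) _ _ _).
  + move=> _; apply: (@cont_app _ _ _ A) => //; do 2 apply: cont_pair => //; exact: cont_min.
  + move=> _; apply: (@cont_app _ _ _ B) => //; do 2 apply: cont_pair => //; apply: cont_min => //; exact: cont_opp.
  + move=> /= r0; have -> : r 0 0 = 0 by lra.
    by rewrite oppr0 (min_idPl ler01).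
have n1 : nbhs (Some r : sphere R 1) [set v | v <> infty].
  by apply: (@filterS _ (nbhs r) _ setT) => //; exact: filterT.
by move: (c2 _ n1); apply: (@filterS _ _ (nbhs_filter _)) => -[q [[r'|] u]].
Qed.

(** Time ranges over the whole line and the value is the basepoint from time 1 on, which is the form
    required by [glue_family]. *)
Definition null_homotopy m n (H : R * sphere R m -> X n) (f : sphere R m -> X n) : Prop :=
  [/\ continuous H, forall v, H (0, v) = f v, forall t v, 1 <= t -> H (t, v) = base X n
    & forall t, H (t, infty) = base X n].

Lemma null_homotopyW m n (H : R * sphere R m -> X n) f : is_nullhomotopy H f ->
  null_homotopy (fun p => H (clamp p.1, p.2)) f.
Proof.
case=> cH H0 H1 Hb; split=> [|v|t v t1|t] /=.
- exact: within_clamp.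
- by rewrite clamp_le0.
- by rewrite clamp_ge1.
- exact: Hb (clamp_itv t).
Qed.

Lemma glue_eq m n (A B A' B' : R * sphere R m -> X n) :
  (forall t v, 0 <= t <= 1 -> A (t, v) = A' (t, v)) ->
  (forall t v, 0 <= t <= 1 -> B (t, v) = B' (t, v)) -> glue A B = glue A' B'.
Proof.
move=> AA BB; apply/funext => -[r|] //=; case: (lerP 0 (r 0 ord0)) => h.
  by apply: AA; rewrite le_min h ler01 ge_min lexx orbT.
by apply: BB; rewrite le_min ler01 ge_min lexx orbT !andbT oppr_ge0 ltW.
Qed.

Lemma glue_pmap m n (A B : R * sphere R m -> X n) f :
  null_homotopy A f -> null_homotopy B f -> is_pmap (glue A B).
Proof.
move=> [cA A0 A1 Ab] [cB B0 B1 Bb]; split=> //.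
have cs (Z : topologicalType) (q : R * Z) : cont_at snd q by exact: cont_snd.
have [cG _] := @glue_family R m n (fun q => A q.2) (fun q => B q.2)
  (fun q => cont_app cA (cs _ q)) (fun q => cont_app cB (cs _ q))
  (fun _ w => etrans (A0 w) (esym (B0 w))) (fun _ => A1) (fun _ => B1) (fun _ => Ab) (fun _ => Bb).
apply: contP => v.
apply: (@cont_app _ _ _ (fun q : R * sphere R m.+1 => glue (fun tv => A tv) (fun tv => B tv) q.2)
  (fun v => (0, v))) => //.
by apply: cont_pair; [exact: cont_cst | exact: cvg_id].
Qed.

Lemma glue_comp m m' n (A B : R * sphere R m -> X n) (phi : sphere R m' -> sphere_prespectrum R m) :
  (forall t, A (t, infty) = base X n) -> (forall t, B (t, infty) = base X n) ->
  glue (fun tv => A (tv.1, phi tv.2)) (fun tv => B (tv.1, phi tv.2)) = fun v => glue A B (susp phi v).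
Proof.
move=> Ab Bb; apply/funext => -[r|] //=.
case E : (phi _) => [w|] /=; last by case: ifP.
have -> : row_mx (\row__ r 0 ord0 : 'rV_1) w 0 ord0 = r 0 ord0.
  by rewrite mxE; case: splitP => k; rewrite ?mxE.
suff -> : \row_j row_mx (\row__ r 0 ord0 : 'rV_1) w 0 (lift ord0 j) = w by [].
apply/rowP => j; rewrite !mxE.
by case: splitP => k /=; rewrite ?ord1 //= => -[/ord_inj <-].
Qed.

End Glue.

Lemma suspn_infty (R : realType) (X : prespectrum R) N m n (f : sphere R m -> X n) :
  f infty = base X n -> suspn N f infty = base X (N + n).
Proof. by case: N. Qed.

(** * Replacing one of two glued nullhomotopies *)

Section ChangeGlue.
Variables (R : realType) (X : prespectrum R) (N m n : nat).
Hypothesis pX : is_prespectrum X.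
Local Notation S := (sphere R (N + m.+1)).
Local Notation i0 := (rshift N (ord0 : 'I_m.+1)).

(* The gluing coordinate of a suspended glued map is the one of index N. *)
Definition set_mid (r : 'rV[R]_(N + m.+1)) (u : R) : 'rV[R]_(N + m.+1) :=
  \row_j (if j == i0 then u else r 0 j).

Lemma set_midE r u : set_mid r u 0 i0 = u.
Proof. by rewrite mxE eqxx. Qed.

Lemma set_mid_id r : set_mid r (r 0 i0) = r.
Proof. by apply/rowP => j; rewrite mxE; case: eqP => [->|]. Qed.

Lemma nsq_set_mid r u : nsq (set_mid r u) = nsq r - r 0 i0 ^+ 2 + u ^+ 2.
Proof.
rewrite /nsq (bigD1 i0) //= set_midE [in RHS](bigD1 i0) //= addrC; congr (_ + _).
rewrite addrAC subrr add0r; apply: eq_bigr => j /negbTE ji.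
by rewrite mxE ji.
Qed.

Lemma suspn_glue_eq (A B A' B' : R * sphere R m -> X n) (r : 'rV[R]_(N + m.+1)) (u : R) :
  (forall w, (if 0 <= r 0 i0 then A (Num.min (r 0 i0) 1, w) else B (Num.min (- r 0 i0) 1, w))
    = (if 0 <= u then A' (Num.min u 1, w) else B' (Num.min (- u) 1, w))) ->
  suspn N (glue A B) (Some r) = suspn N (glue A' B') (Some (set_mid r u)).
Proof.
move=> h; apply: suspn_ext => [i|]; first by rewrite mxE eq_lrshift.
set s := \row_j r 0 _; set s' := \row_j set_mid r u 0 _.
have E1 : s 0 ord0 = r 0 i0 by rewrite mxE.
have E2 : s' 0 ord0 = u by rewrite mxE set_midE.
have E3 : vtail s' = vtail s.
  congr Some; apply/rowP => j; rewrite !mxE ifF //; apply/negbTE.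
  by rewrite (inj_eq (@rshift_inj _ _)) eq_sym neq_lift.
rewrite [LHS](_ : _ = if 0 <= s 0 ord0 then A (Num.min (s 0 ord0) 1, vtail s)
  else B (Num.min (- s 0 ord0) 1, vtail s)) //.
rewrite [RHS](_ : _ = if 0 <= s' 0 ord0 then A' (Num.min (s' 0 ord0) 1, vtail s')
  else B' (Num.min (- s' 0 ord0) 1, vtail s')) //.
by rewrite E1 E2 E3 h.
Qed.

Definition mid (v : S) : R := if v is Some r then r 0 i0 else 0.

Lemma cont_set_mid (T : topologicalType) (f : T -> S) (u : T -> R) p r : cont_at f p -> f p = Some r ->
  cont_at u p ->
  cont_at (fun q => if f q is Some r then Some (set_mid r (u q)) : S else infty) p.
Proof.
move=> cf fp cu; pose co (v : S) i := if v is Some w then w 0 i else 0.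
have cco i : cont_at (fun q => co (f q) i) p.
  by apply: (@cont_at_comp _ _ _ f (fun v => co v i)) => //; rewrite fp; exact: cont_coord.
apply: (@cont_at_near _ _ (fun q => Some (\row_j (if j == i0 then u q else co (f q) j)) : S)).
  apply: cont_Some; apply: cont_mx => i j; apply: (cont_eq (fun x => mxE _ _ _ _)).
  by case: (j == i0).
have n1 : nbhs (f p) [set v | v <> infty].
  by rewrite fp; apply: (@filterS _ (nbhs r) _ setT) => //; exact: filterT.
move: (cf _ n1); apply: (@filterS _ _ (nbhs_filter _)) => q; rewrite /=; case: (f q) => [w _|h] //; by case: h.
Qed.

(* Half of the sphere is left alone; on the other half, the nullhomotopy Th of the
   difference of Q and Q' is used to move from one end of the gluing coordinate to
   the other. *)
Lemma glue_change (P Q Q' : R * sphere R m -> X n) f :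
  null_homotopy P f -> null_homotopy Q f -> null_homotopy Q' f ->
  stably_at N (glue Q Q') (fun _ => base X n) -> stably_at N (glue P Q) (glue P Q').
Proof.
move=> nP nQ nQ'; rewrite /stably_at suspn_base // => -[Th [cTh Th0 Th1 Thb]].
have [cG G0] := pmap_suspn pX N (glue_pmap nP nQ).
have [[_ P0 _ _] [_ Q0 _ _] [_ Q'0 _ _]] := And3 nP nQ nQ'.
(* In the half-plane whose coordinates are the gluing coordinate and the time of [Th], the point -t
   (a, b), for t < 0, moves from (-t, 0), where the value is that of [Q], to (t, 0), where it is
   that of [Q']. *)
pose a (s : R) : R := 1 - 2 * s; pose b s := Num.max 0 (1 - a s ^+ 2).
have b0 s : 0 <= b s by rewrite le_max lexx.
pose Rt (q : R * S) : X (N + n)%N := Th (Num.min 1 (- (mid q.2 * b q.1)),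
  if q.2 is Some r then Some (set_mid r (- (mid q.2 * a q.1))) else infty).
pose H (q : R * S) : X (N + n)%N := if - mid q.2 <= 0 then suspn N (glue P Q) q.2 else Rt q.
have ca (q : R * S) : cont_at (fun q : R * S => a q.1) q.
  by apply: cont_add; [exact: cont_cst | apply: cont_opp; apply: cont_mul; [exact: cont_cst | exact: cont_fst]].
have cb (q : R * S) : cont_at (fun q : R * S => b q.1) q.
  apply: (@cont_max _ _ (fun _ => 0)); first exact: cont_cst.
  apply: (@cont_add _ _ (fun _ => 1)); first exact: cont_cst.
  by apply: cont_opp; exact: cont_exp.
apply: (mk_homotopic (H := H)) => [s v s01|[r|]|[r|]|s s01] //=; last by rewrite /H /= oppr0 lexx.
- case: v => [r|].
    have cs : cont_at snd (s, Some r : S) by exact: cont_snd.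
    have cm : cont_at (fun q : R * S => mid q.2) (s, Some r).
      by apply: (@cont_at_comp _ _ _ snd mid) => //; exact: cont_coord.
    refine (@cont_paste _ _ _ (fun q : R * S => - mid q.2) (fun q => suspn N (glue P Q) q.2) Rt
      (s, Some r) (cont_opp cm) _ _ _).
    + by move=> _; exact: cont_app cG cs.
    + move=> _; apply: (@cont_app _ _ _ Th) => //; apply: cont_pair.
        by apply: cont_min; [exact: cont_cst | apply: cont_opp; exact: cont_mul].
      apply: (@cont_set_mid _ snd (fun q : R * S => - (mid q.2 * a q.1)) _ r) => //.
      by apply: cont_opp; exact: cont_mul.
    + move=> /= /eqP; rewrite oppr_eq0 => /eqP m0; rewrite /Rt /= m0 !mul0r oppr0 (min_idPr ler01) Th0.
      apply: suspn_glue_eq => w; rewrite /mid in m0.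
      by rewrite m0 lexx (min_idPl ler01) P0 Q0.
  move=> A; rewrite {1}/H /= oppr0 lexx G0 nbhsE => -[V [oV V0] VA].
  have := cG infty V; rewrite G0 => /(_ (open_nbhs_nbhs (conj oV V0))) /nbhs_inftyP[_ [B1 HB1]].
  have cT (q : S * R) : cont_at (fun q : S * R => Th (q.2, q.1)) q.
    by apply: (@cont_app _ _ _ Th) => //; apply: cont_pair; [exact: cont_snd | exact: cont_fst].
  have hT t : `[0, 1]%classic t -> V (Th (t, infty)) by rewrite Thb.
  have := tube (p := infty : S) (@segment_compact R 0 1) oV (fun _ _ => cT _) hT.
  move=> /nbhs_inftyP[_ [B2 HB2]].
  (* The bound works in both regimes: if a^2 >= 1/4 the moved coordinate is comparable to t;
     otherwise b >= 3/4, and either the time is at least 1, where [Th] is the basepoint, or |t| <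
     4/3 and the other coordinates are large. *)
  exists (setT, [set v | forall r, v = Some r -> `|B1| + 4 * `|B2| + 4 < nsq r]).
    split; first exact: filterT.
    by apply/nbhs_inftyP; split=> //; exists (`|B1| + 4 * `|B2| + 4) => v hv r [<-].
  move=> [s' [r|]] [/= _ h]; apply: VA; last by rewrite /H /= oppr0 lexx G0.
  have {}h := h _ erefl; have [B1n B2n] := conj (ler_norm B1) (ler_norm B2).
  have [B1p B2p] := conj (normr_ge0 B1) (normr_ge0 B2).
  rewrite /H; case: ifP => [_|/negbT]; first by apply: HB1; lra.
  rewrite -ltNge /= oppr_gt0 => t0; rewrite /Rt /=; set t := r 0 i0 in t0 *.
  have tb : 0 <= - (t * b s') by rewrite oppr_ge0 mulr_le0_ge0 // ltW.
  have [tb1|tb1] := leP 1 (- (t * b s')); first by rewrite Th1.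
  apply: (HB2 (set_mid r (- (t * a s')))); last by rewrite /= in_itv /= tb ltW.
  rewrite nsq_set_mid -/t sqrrN exprMn; set a2 := a s' ^+ 2.
  have a20 : 0 <= a2 := sqr_ge0 _.
  have t2r : t ^+ 2 <= nsq r := nsq_coord r i0.
  have t20 : 0 <= t ^+ 2 := sqr_ge0 _.
  have [a24|a24] := leP (4^-1) a2; first by nra.
  have b34 : 3 / 4 <= b s' by rewrite le_max; apply/orP; right; rewrite -/a2; lra.
  have t43 : - t < 4 / 3 by nra.
  have t2 : t ^+ 2 <= 4 by nra.
  nra.
- rewrite /H /mid; case: (lerP (- r 0 i0) 0) => // t0.
  rewrite /Rt /= /a /b /a mulr0 subr0 expr1n subrr (max_idPl (lexx 0)) mulr0 oppr0 (min_idPr ler01) mulr1 Th0.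
  by apply/esym/suspn_glue_eq => w; rewrite (lt_geF _) -?oppr_gt0 // ltW.
- by rewrite /H /= oppr0 lexx.
- have a1 : a 1 = -1 by rewrite /a; lra.
  rewrite /H [mid _]/=; case: (lerP (- r 0 i0) 0) => t0.
    rewrite -{2}(set_mid_id r); apply: suspn_glue_eq => w.
    by rewrite -oppr_le0 t0.
  rewrite /Rt /= /b a1 sqrrN expr1n subrr (max_idPl (lexx 0)) mulr0 oppr0 (min_idPr ler01) Th0.
  rewrite mulrN1 opprK; apply/esym/suspn_glue_eq => w.
  by rewrite lt_geF // -oppr_gt0.
- by rewrite /H /= oppr0 lexx G0 suspn_infty.
Qed.

(** The reflection of the gluing coordinate exchanges the two halves, which agree at 0. *)
Lemma glue_flip (A B A' B' : R * sphere R m -> X n) :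
  (forall w, A (0, w) = B (0, w)) -> (forall w, A' (0, w) = B' (0, w)) ->
  stably_at N (glue A B) (glue A' B') -> stably_at N (glue B A) (glue B' A').
Proof.
move=> AB AB' [H [cH H0 H1 Hb]].
pose rho (v : S) : S := if v is Some r then Some (set_mid r (- mid v)) else infty.
have crho : continuous rho.
  apply: contP => -[r|].
    refine (@cont_set_mid _ (fun v => v) (fun v => - mid v) _ r _ erefl _); first exact: cvg_id.
    by apply: cont_opp; exact: cont_coord.
  move=> U /nbhs_inftyP[U0 [B0 HB]]; apply/nbhs_inftyP; split=> //.
  exists B0 => r hr; apply: HB.
  by rewrite nsq_set_mid /mid sqrrN subrK.
have E (C C' : R * sphere R m -> X n) : (forall w, C (0, w) = C' (0, w)) ->
    forall v, suspn N (glue C C') (rho v) = suspn N (glue C' C) v.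
  move=> CC [r|]; last by rewrite /= !suspn_infty.
  apply/esym/suspn_glue_eq => w; rewrite /mid oppr_ge0 opprK.
  case: (ltgtP (r 0 i0) 0) => // ->.
  by rewrite oppr0 (min_idPl ler01) CC.
exists (fun q => H (q.1, rho q.2)); split=> [|v|v|t] /=.
- apply: contP => q; apply: (@cont_app _ _ _ H) => //; apply: cont_pair; first exact: cont_fst.
  by apply: cont_app crho _; exact: cont_snd.
- by rewrite H0 E.
- by rewrite H1 E.
- exact: Hb.
Qed.

End ChangeGlue.

(** * The Toda bracket *)

Section SpectrumMaps.
Variable R : realType.

Lemma suspn_map (X Y : prespectrum R) (phi : forall n, X n -> Y n) N m n (f : sphere R m -> X n) v :
  (forall n, phi n (base X n) = base Y n) ->
  (forall n t y, phi n.+1 (struct t y) = struct t (phi n y)) ->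
  phi _ (suspn N f v) = suspn N (fun w => phi _ (f w)) v.
Proof.
move=> p0 ps; elim: N v => [|N IH] v //.
change (phi _ (susp (suspn N f) v) = susp (suspn N (fun w => phi _ (f w))) v).
by case: v => [r|] /=; rewrite ?p0 // ps; congr struct; exact: IH.
Qed.

Lemma null_homotopy_map (X Y : prespectrum R) (phi : forall n, X n -> Y n) m n
    (H : R * sphere R m -> X n) f : is_spectrum_map phi -> null_homotopy H f ->
  null_homotopy (fun tv => phi n (H tv)) (fun v => phi n (f v)).
Proof.
move=> /(_ n)[cphi p0 _] [cH H0 H1 Hb]; split=> [|v|t v t1|t].
- by apply: contP => q; exact: cont_app cphi (cH q).
- by rewrite H0.
- by rewrite H1.
- by rewrite Hb.
Qed.

Lemma null_homotopy_comp (X : prespectrum R) m m' n (H : R * sphere R m -> X n) f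
    (phi : sphere R m' -> sphere_prespectrum R m) : is_pmap phi -> null_homotopy H f ->
  null_homotopy (fun tv => H (tv.1, phi tv.2)) (fun v => f (phi v)).
Proof.
move=> [cphi p0] [cH H0 H1 Hb]; split=> [|v|t v t1|t] //=; last first.
- by rewrite p0 Hb.
- exact: H1.
apply: contP => q; apply: (@cont_app _ _ _ H) => //; apply: cont_pair; first exact: cont_fst.
by apply: cont_app cphi _; exact: cont_snd.
Qed.

Lemma stably_null_map (X Y : prespectrum R) (phi : forall n, X n -> Y n) N m n (g : sphere R m -> X n) :
  is_prespectrum X -> is_prespectrum Y -> is_spectrum_map phi -> stably_at N g (fun _ => base X n) ->
  stably_at N (fun v => phi n (g v)) (fun _ => base Y n).
Proof.
move=> pX pY mphi; rewrite /stably_at !suspn_base // => -[H [cH H0 H1 Hb]].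
have p0 k : phi k (base X k) = base Y k by have [] := mphi k.
have ps k t y : phi k.+1 (struct t y) = struct t (phi k y) by have [] := mphi k.
have cphi k : continuous (phi k) by have [] := mphi k.
exists (fun q => phi _ (H q)); split=> [|v|v|t].
- by apply: contP => q; exact: cont_app (cphi _) (cH q).
- by rewrite H0 suspn_map.
- by rewrite H1 p0.
- by rewrite Hb p0.
Qed.

Lemma stably_null_comp (X : prespectrum R) N m m' n (g : sphere R m -> X n)
    (phi : sphere R m' -> sphere_prespectrum R m) : is_prespectrum X -> g infty = base X n -> is_pmap phi ->
  stably_at N g (fun _ => base X n) -> stably_at N (fun v => g (phi v)) (fun _ => base X n).
Proof.
move=> pX g0 mphi; rewrite /stably_at !suspn_base // => -[H [cH H0 H1 Hb]].
have sb k t : struct t (base X k) = base X k.+1 by have [] := pX k.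
have [cS S0] := pmap_suspn (@sphere_prespectrumP R) N mphi.
exists (fun q => H (q.1, suspn N phi q.2)); split=> [|v|v|t] /=.
- apply: contP => q; apply: (@cont_app _ _ _ H) => //; apply: cont_pair; first exact: cont_fst.
  by apply: cont_app cS _; exact: cont_snd.
- by rewrite H0 (suspn_comp sb N g0 (phi := phi)) //; case: mphi.
- exact: H1.
- by rewrite S0; exact: Hb.
Qed.

Lemma hopf_pmap : is_pmap (hopf : sphere R 3 -> sphere_prespectrum R 2).
Proof.
split=> //; apply: contP => v; apply: (cont_eq (@hopfE R)).
have cid : cont_at (fun v : sphere R 3 => v) v by exact: cvg_id.
apply: cont_cfrac; [exact: cont_cZ | exact: cont_cC | exact: cont_cX | exact: cont_cY |].
apply/negPn/negP; rewrite !negb_or !negbK => /and4P[/eqP z /eqP c /eqP x /eqP y].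
by have := unit_sphere3 v; rewrite x y z c expr0n !addr0 => /eqP; rewrite eq_sym oner_eq0.
Qed.

Lemma susp_hopf_pmap m : is_pmap (X := sphere_prespectrum R) (n := (m + 2)%N) (@susp_hopf R m).
Proof. exact: (pmap_suspn (@sphere_prespectrumP R) m hopf_pmap). Qed.

Lemma kstruct_base (D : permutative) n t :
  struct t (base (kspectrum R D) n) = base (kspectrum R D) n.+1.
Proof.
rewrite [LHS]kstructE; apply: kpoint_infty => i.
by rewrite !mxE; case: t.
Qed.

End SpectrumMaps.

Section TodaBracket.
Variables (R : realType) (D : picard).
Local Notation KD := (kspectrum R D).
Variables (E F : prespectrum R) (p : forall n, KD n -> E n) (k : forall n, E n -> F n).
Variable N : forall n, R * KD n -> F n.
Hypothesis I : is_bottom_invariant p k N.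

Let pE : is_prespectrum E := bi_E I.
Let pF : is_prespectrum F := bi_F I.

(** The suspensions are moved through [p] into [E], where they preserve continuity. *)
Lemma family_p (T : topologicalType) m l (g : T * sphere R l -> KD 2) : based_family g ->
  based_family (fun q : T * sphere R (m + l) => p (suspn m (fun w => g (q.1, w)) q.2) : E (m + 2)%N).
Proof.
move=> [cg g0]; have p0 n : p (base KD n) = base E n by have [] := bi_p I n.
have -> : (fun q : T * sphere R (m + l) => p (suspn m (fun w => g (q.1, w)) q.2) : E (m + 2)%N)
  = fun q => suspn m (fun w => p (g (q.1, w))) q.2.
  by apply/funext => q; apply: suspn_map => // n t y; have [] := bi_p I n.
apply: (@family_suspn _ _ pE T m l _ (fun q => p (g q))); split=> [|q]; last by rewrite g0.
by apply: contP => q; apply: cont_app (cg q); have [] := bi_p I 2.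
Qed.

(** At each time in [0, 1] the map [N] commutes with the structure maps, so the suspensions can be
    taken in [F]. *)
Lemma family_N (T : topologicalType) m l (g : T * sphere R l -> KD 2) : based_family g ->
  based_family (fun q : (R * T) * sphere R (m + l) =>
    N (clamp q.1.1, suspn m (fun w => g (q.1.2, w)) q.2) : F (m + 2)%N).
Proof.
move=> [cg g0].
have N0 n t : N (clamp t, base KD n) = base F n.
  by have [_ _ _ h _] := bi_N I n; apply: h; exact: clamp_itv.
have Ns n t s y : N (clamp t, struct s y) = struct s (N (clamp t, y)) :> F n.+1.
  by have [_ _ _ _ h] := bi_N I n; apply: h; exact: clamp_itv.
have -> : (fun q : (R * T) * sphere R (m + l) =>
    N (clamp q.1.1, suspn m (fun w => g (q.1.2, w)) q.2) : F (m + 2)%N)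
  = fun q => suspn m (fun w => N (clamp q.1.1, g (q.1.2, w)) : F 2) q.2.
  by apply/funext => q; apply: (@suspn_map R KD F (fun n y => N (clamp q.1.1, y))).
apply: (@family_suspn _ _ pF (R * T)%type m l 2 (fun q => N (clamp q.1.1, g (q.1.2, q.2)))).
split=> [|q]; last by rewrite /= g0 N0.
have cN := within_clamp (let: And5 h _ _ _ _ := bi_N I 2 in h).
apply: contP => q; have [c1 c2] := conj (@cont_fst _ _ q) (@cont_snd _ _ q).
apply: (@cont_app _ _ _ (fun p : R * KD 2 => N (clamp p.1, p.2)) (fun q : (R * T) * sphere R l => (q.1.1, g (q.1.2, q.2)))) => //.
apply: cont_pair; first by apply: (@cont_app _ _ _ fst _ _ _ c1); move=> ?; exact: cont_fst.
apply: (@cont_app _ _ _ g) => //; apply: cont_pair => //.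
by apply: (@cont_app _ _ _ snd _ _ _ c1); move=> ?; exact: cont_snd.
Qed.

Lemma null_homotopy_N m l (g : sphere R l -> KD 2) : is_pmap g ->
  null_homotopy (fun tv => N (clamp tv.1, suspn m g tv.2) : F (m + 2)%N)
    (fun v => k (p (suspn m g v))).
Proof.
move=> [cg g0].
have [cN Nb] : based_family (fun q : (R * R) * sphere R (m + l) =>
    N (clamp q.1.1, suspn m g q.2) : F (m + 2)%N).
  apply: (@family_N R m l (fun q => g q.2)); split=> // q.
  by apply: cont_app cg _; exact: cont_snd.
have [_ N0 N1 _ _] := bi_N I (m + 2).
split=> [|v|t v t1|t] /=.
- apply: contP => q; apply: (@cont_app _ _ _ (fun q : (R * R) * sphere R (m + l) =>
    N (clamp q.1.1, suspn m g q.2) : F (m + 2)%N) (fun q : R * sphere R (m + l) => ((q.1, 0), q.2))) => //.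
  apply: cont_pair; last exact: cont_snd.
  by apply: cont_pair; [exact: cont_fst | exact: cont_cst].
- by rewrite clamp_le0 // N0.
- by rewrite [clamp t]clamp_ge1 // N1.
- exact: (Nb (t, 0)).
Qed.

Variables (x : ob D) (f : loop D) (m : nat).
Hypothesis xf : k0_map (ob_class x) = loop_class f.

Lemma ob_class2_pmap : is_pmap (ob_class2 (R := R) x : _ -> KD 2).
Proof.
split=> //; apply: contP => v; apply: (cont_eq (@ob_class2E R D x)).
by apply: cont_P1; [exact: cont_cst | exact: cvg_id].
Qed.

Lemma toda_bracket (c c' : sphere R (m + 3).+1 -> F (m + 2)%N) :
  quadratic_value k (fun v => p (suspn m (ob_class2 x) v)) c ->
  connecting p k N (suspn m (loop_class2 f)) c' -> stably_equal c c'.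
Proof.
move=> [h [M [/null_homotopyW nh /null_homotopyW nM cE]]] [h' /null_homotopyW nh' c'E].
set hc := fun q => h _ in nh; set Mc := fun q => M _ in nM; set hc' := fun q => h' _ in nh'.
have [G [cG G0 G1 Gb]] := eta_homotopic R xf.
pose eta := @susp_hopf R m; have meta := susp_hopf_pmap R m; rewrite -/eta in meta nh cE.
pose a : sphere R (m + 2) -> KD (m + 2) := suspn m (ob_class2 x).
rewrite -/a in nh nM.
have aE v : suspn m (fun w => G (0, w)) v = a (eta v).
  rewrite (_ : (fun w => _) = fun w => ob_class2 x (hopf w)); last exact/funext.
  by rewrite (suspn_comp (@kstruct_base R D) m (g := ob_class2 x) (phi := hopf)).
have bE v : suspn m (fun w => G (1, w)) v = suspn m (loop_class2 f) v.
  by rewrite (_ : (fun w => _) = loop_class2 f) //; exact/funext.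
have [[_ _ mk] [_ N0 N1 _ _]] := conj (bi_k I (m + 2)) (bi_N I (m + 2)).
have kb n : k (base E n) = base F n by have [] := bi_k I n.
have [cpG pGb] := @family_p R m 3 G (conj cG Gb).
have [cNG NGb] := @family_N R m 3 G (conj cG Gb).
(* During [0, 1] [Gam] follows the image of the homotopy from x eta to f, and during [1, 2] the
   nullhomotopy [hc'] of the image of f. *)
pose Gam (q : R * sphere R (m + 3)) : E (m + 2)%N :=
  if q.1 - 1 <= 0 then p (suspn m (fun w => G (q.1, w)) q.2) else hc' (q.1 - 1, q.2).
have [chc' hc'0 hc'1 hc'b] := nh'.
have cid n : continuous (fun q : R * sphere R n => q.1 - 1).
  by move=> q; apply: cont_add; [exact: cont_fst | exact: cont_cst].
have cGam : continuous Gam.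
  apply: contP => q; refine (@cont_paste _ _ _ (fun q : R * sphere R (m + 3) => q.1 - 1)
    (fun q => p (suspn m (fun w => G (q.1, w)) q.2) : E (m + 2)%N) (fun q => hc' (q.1 - 1, q.2)) q (cid _ q) _ _ _).
  + by move=> _; exact: cpG.
  + move=> _; apply: (@cont_app _ _ _ hc') => //; apply: cont_pair (cid _ q) _; exact: cont_snd.
  + by case: q => u v /= /eqP; rewrite subr_eq0 => /eqP ->; rewrite subrr hc'0 bE.
have Gam2 u v : 2 <= u -> Gam (u, v) = base E (m + 2)%N.
  by move=> u2; rewrite /Gam /= ifF ?hc'1 //; [lra | apply/negbTE; lra].
have Gamb u : Gam (u, infty) = base E (m + 2)%N.
  by rewrite /Gam /=; case: ifP => _; [exact: (pGb u) | rewrite hc'b].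
pose h2 (tv : R * sphere R (m + 3)) := Gam (2 * tv.1, tv.2).
have nh2 : null_homotopy h2 (fun v => p (a (eta v))).
  split=> [|v|t v t1|t]; rewrite /h2 /=.
  - apply: contP => q; apply: (@cont_app _ _ _ Gam) => //; apply: cont_pair; last exact: cont_snd.
    by apply: cont_mul; [exact: cont_cst | exact: cont_fst].
  - by rewrite mulr0 /Gam /= sub0r lerN10 aE.
  - by apply: Gam2; lra.
  - exact: Gamb.
pose NA (tv : R * sphere R (m + 2)) : F (m + 2)%N := N (clamp tv.1, a tv.2).
have nNA : null_homotopy NA (fun v => k (p (a v))) := null_homotopy_N m ob_class2_pmap.
pose Q (tv : R * sphere R (m + 3)) := NA (tv.1, eta tv.2).
pose Q' (tv : R * sphere R (m + 3)) := Mc (tv.1, eta tv.2).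
have nQ : null_homotopy Q (fun v => k (p (a (eta v)))) := null_homotopy_comp meta nNA.
have nQ' : null_homotopy Q' (fun v => k (p (a (eta v)))) := null_homotopy_comp meta nM.
have nkh := null_homotopy_map (bi_k I) nh.
have nkh2 := null_homotopy_map (bi_k I) nh2.
(* The map glued from [NA] and [Mc] has degree 1, so it is stably null in [F]; precomposition with
   the suspended eta gives the one glued from [Q] and [Q']. *)
have s1 : stably_equal (glue (fun tv => k (hc tv)) Q) (glue (fun tv => k (hc tv)) Q').
  have mg := glue_pmap nNA nM.
  have [|N' hN'] := (stably_equalP _ _).1 (bi_F2 I _ mg); first by lia.
  apply/stably_equalP; exists N'; apply: (glue_change pF nkh nQ nQ').
  have [[_ _ _ NAb] [_ _ _ Mb]] := conj nNA nM.
  rewrite /Q /Q' glue_comp //; apply: (stably_null_comp pF mg.2 _ hN').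
  exact: (pmap_suspn (@sphere_prespectrumP R) 1 meta).
(* The map glued from [hc] and [h2] has degree 2 in [E], so it is stably null. [glue_change] alters
   the second half, hence the flip. *)
have s2 : stably_equal (glue (fun tv => k (hc tv)) Q) (glue (fun tv => k (h2 tv)) Q).
  have [|N' hN'] := (stably_equalP _ _).1 (bi_E0 I _ (glue_pmap nh nh2)); first by lia.
  have kg : (fun v => k (glue hc h2 v)) = glue (fun tv => k (hc tv)) (fun tv => k (h2 tv)).
    by apply/funext => -[r|] //=; case: ifP.
  apply/stably_equalP; exists N'.
  have [[_ kh0 _ _] [_ kh20 _ _] [_ Q0 _ _]] := And3 nkh nkh2 nQ.
  apply: glue_flip; try by move=> w; rewrite Q0 ?kh0 ?kh20.
  apply: (glue_change pF nQ nkh nkh2); rewrite -kg.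
  exact: (stably_null_map pE pF (bi_k I) hN').
(* At stage s the two halves meet in the map at time s of [Gam]: [A] follows [Gam] from s to 2, and
   [B] applies [N] to the homotopy at time s. *)
have s3 : stably_equal (glue (fun tv => k (h2 tv)) Q) c'.
  apply: homotopic_stably.
  pose A (q : R * (R * sphere R (m + 3))) : F (m + 2)%N :=
    k (Gam (clamp q.1 + q.2.1 * (2 - clamp q.1), q.2.2)).
  pose B (q : R * (R * sphere R (m + 3))) : F (m + 2)%N :=
    N (clamp q.2.1, suspn m (fun w => G (clamp q.1, w)) q.2.2).
  have two t s : 1 <= t -> 2 <= clamp s + t * (2 - clamp s).
    by move=> t1; have /andP[] := clamp_itv s; nra.
  have c1 (q : R * (R * sphere R (m + 3))) : cont_at (fun q => clamp q.1) q.
    by apply: cont_clamp; exact: cont_fst.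
  have c2 (q : R * (R * sphere R (m + 3))) : cont_at (fun q => q.2.1) q.
    by apply: (@cont_app _ _ _ fst snd); [move=> ?; exact: cont_fst | exact: cont_snd].
  have c3 (q : R * (R * sphere R (m + 3))) : cont_at (fun q => q.2.2) q.
    by apply: (@cont_app _ _ _ snd snd); [move=> ?; exact: cont_snd | exact: cont_snd].
  have [cF Fb] : based_family (fun q : R * sphere R (m + 3).+1 =>
      glue (fun tv => A (q.1, tv)) (fun tv => B (q.1, tv)) q.2).
    apply: glue_family => [||s w|s t w t1|s t w t1|s t|s t]; rewrite /A /B /=.
    - apply: contP => q; apply: cont_app; first by have [] := bi_k I (m + 2).
      apply: (@cont_app _ _ _ Gam) => //; apply: cont_pair => //.
      apply: cont_add => //; apply: cont_mul => //; apply: cont_add; first exact: cont_cst.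
      exact: cont_opp.
    - apply: contP => q; apply: (@cont_app _ _ _ (fun q : (R * R) * sphere R (m + 3) =>
        N (clamp q.1.1, suspn m (fun w => G (q.1.2, w)) q.2) : F (m + 2)%N)
        (fun q : R * (R * sphere R (m + 3)) => ((q.2.1, clamp q.1), q.2.2))) => //.
      by do 2 apply: cont_pair => //.
    - rewrite mul0r addr0 [clamp 0]clamp_le0 // N0 /Gam /= ifT //.
      by have /andP[] := clamp_itv s; lra.
    - by rewrite Gam2 ?kb //; exact: two.
    - by rewrite [clamp t]clamp_ge1 // N1.
    - by rewrite Gamb kb.
    - exact: (NGb (t, clamp s)).
  exists (fun q => glue (fun tv => A (q.1, tv)) (fun tv => B (q.1, tv)) q.2).
  split=> // v /=.
    congr (_ v); apply: glue_eq => t w t01; rewrite /A /B /=.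
      by rewrite clamp_le0 // /h2 /= add0r subr0 mulrC.
    by rewrite [clamp 0]clamp_le0 // aE.
  rewrite c'E; congr (_ v); apply: glue_eq => t w t01; rewrite /A /B /= ?[clamp 1]clamp_ge1 //.
    rewrite (_ : 1 + t * (2 - 1) = t + 1); last by ring.
    rewrite -[h' _](_ : hc' (t, w) = _); last by rewrite /hc' /= clamp_id.
    rewrite /Gam /= addrK; case: ifP => // t0.
    have -> : t = 0 by apply/le_anti; rewrite t0; case/andP: t01.
    by rewrite add0r bE hc'0.
  by rewrite bE clamp_id.
have -> : c = glue (fun tv => k (hc tv)) Q'.
  by rewrite cE; apply: glue_eq => t w t01; rewrite /Q' /hc /Mc /= clamp_id.
apply: (stably_equal_trans pF (stably_equal_sym s1)).
exact: (stably_equal_trans pF s2 s3).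
Qed.

End TodaBracket.

Theorem corollary3p8 (R : realType) (D : picard) :
  exists k0 : {additive pi0 D -> pi1 D},
    [/\ stable_quadratic k0,
        forall (x xs : ob D) (u us : mor D)
          (hx : inverse_ob x xs) (hu : is_mor u (gunit D) (tens x xs))
          (hus : equivalence_pair u us),
          k0 (ob_class x) = loop_class (k0_loop hu hus),
        eta_precomposition R k0
      & models_k0 R k0].
Proof.
exists (@k0_map D); split.
- exact: k0_map_quadratic.
- move=> x xs u us _ hu hus; rewrite /= k0_mapE; apply: beta_loop_uniq; exact: transports_k0.
(* The two maps are homotopic already at level 2, before any further suspension. *)
- by move=> x f xf; exists 0%N; apply: homotopicW; exact: eta_homotopic.
- move=> E F p k N I x f xf m c c'; exact: (toda_bracket I xf).
Qed.
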